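(* For every $1\le p\le q\le\infty$ and every frequency $\lambda$, $$T_{q,p}(\lambda)=\limsup_{j\to\infty}\frac{\log\Lambda_{q,p}(\lambda\cap[j,j+1))}j.$$
   Context: A frequency is a strictly increasing sequence $\lambda=(\lambda_n)_{n\ge1}$ of non-negative real numbers tending to $\infty$; $\lambda$ also denotes the set $\{\lambda_n:n\ge1\}$. A $\lambda$-Dirichlet series is a formal series $D=\sum a_ne^{-\lambda_ns}$ with complex coefficients; it is a $\lambda$-Dirichlet polynomial if only finitely many $a_n$ are non-zero. For $1\le p<\infty$, $\mathcal{H}_p(\lambda)$ is the completion of the space of $\lambda$-Dirichlet polynomials under $$\|D\|_p=\lim_{T\to\infty}\Big(\frac1{2T}\int_{-T}^T\Big|\sum_n a_ne^{-\lambda_nit}\Big|^pdt\Big)^{1/p}.$$ Equivalently, and also for $p=\infty$: let $(G,\beta)$ be a $\lambda$-Dirichlet group, i.e. $G$ is a compact abelian group (with normalized Haar measure) and $\beta:(\mathbb{R},+)\to G$ is a continuous homomorphism with dense range such that for every $n$ there is a character $h_{\lambda_n}\in\widehat G$ with $h_{\lambda_n}(\beta(t))=e^{-i\lambda_nt}$ for all $t$; such a pair always exists. Then for $1\le p\le\infty$, $\mathcal{H}_p(\lambda)$ consists of all $\lambda$-Dirichlet series $\sum\widehat f(h_{\lambda_n})e^{-\lambda_ns}$ with $f\in L_p(G)$ and $\operatorname{supp}\widehat f\subseteq\{h_{\lambda_n}:n\ge1\}$, with norm $\|f\|_p$; this does not depend on the chosen group. For a Dirichlet polynomial, $\|D\|_\infty=\sup_{t\in\mathbb{R}}|\sum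 a_ne^{-i\lambda_nt}|$. For $\sigma\in\mathbb{R}$, $\tau_\sigma D=D_\sigma=\sum a_ne^{-\lambda_n\sigma}e^{-\lambda_ns}$ for $D=\sum a_ne^{-\lambda_ns}$. Let $\sigma_p(D)=\inf\{\sigma\in\mathbb{R}: D_\sigma\in\mathcal{H}_p(\lambda)\}$ and $$T_{q,p}(\lambda)=\sup_D\big(\sigma_q(D)-\sigma_p(D)\big)=\inf\{\sigma>0:\tau_\sigma:\mathcal{H}_p(\lambda)\to\mathcal{H}_q(\lambda)\text{ is bounded}\},$$ where the supremum is over all $\lambda$-Dirichlet series $D$, $\infty-\infty$ is understood to be $0$, and $\inf\emptyset=\infty$. For a finite set $A\subseteq[0,\infty)$, $\Lambda_{q,p}(A)\in[1,\infty]$ is the infimum of all constants $C\ge1$ such that $$\Big\|\sum_{x\in A}a_xe^{-xs}\Big\|_q\le C\Big\|\sum_{x\in A}a_xe^{-xs}\Big\|_p$$ for every choice of complex coefficients $(a_x)_{x\in A}$ (so $\Lambda_{q,p}(\emptyset)=1$). *)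

(* Defs.v *)
From HB Require Import structures.
From mathcomp Require Import all_boot all_order all_algebra.
From mathcomp Require Import all_classical all_reals all_analysis.
From mathcomp Require Import complex.

Set Implicit Arguments.
Unset Strict Implicit.
Unset Printing Implicit Defensive.

Import Order.TTheory GRing.Theory Num.Theory.
Import numFieldNormedType.Exports.

Local Open Scope classical_set_scope.
Local Open Scope ring_scope.
Local Open Scope complex_scope.

(* [borel G] is [G] with its Borel sigma-algebra; the base point 0 only serves
   to meet the requirement that measurable types are pointed. *)
Definition pointed_group (G : topologicalZmodType) : Type := G.

HB.instance Definition _ (G : topologicalZmodType) :=
  TopologicalZmodule.on (pointed_group G).
HB.instance Definition _ (G : topologicalZmodType) :=
  isPointed.Build (pointed_group G) 0.

Notation borel G :=
  (g_sigma_algebraType (@open (pointed_group G) : set (set (pointed_group G)))).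

Section Hardy.
Context {R : realType}.

Definition frequency (lambda : nat -> R) : Prop :=
  [/\ forall n, 0 <= lambda n,
      forall m n, (m < n)%N -> lambda m < lambda n
    & lambda n @[n --> \oo] --> +oo].

Definition cabs (z : R[i]) : R := Normc.normc z.

Definition cis (x : R) : R[i] := cos x +i* sin x.

Definition dpoly (A : set R) (a : R -> R[i]) (t : R) : R[i] :=
  \sum_(x \in A) a x * cis (- (x * t)).

(* For [F] a Dirichlet polynomial restricted to the imaginary axis. The index
   [-oo] is a dummy case. *)
Definition dnorm (p : \bar R) (F : R -> R[i]) : R :=
  match p with
  | r%:E => lim (((2 * T)^-1 *
      \int[lebesgue_measure]_(t in `[- T, T]) (cabs (F t) `^ r)) `^ r^-1
      @[T --> +oo])
  | _ => sup (range (fun t => cabs (F t)))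
  end.

Definition Lambda (q p : \bar R) (A : set R) : \bar R :=
  ereal_inf [set C%:E | C in [set C : R | 1 <= C /\
    forall a : R -> R[i], dnorm q (dpoly A a) <= C * dnorm p (dpoly A a)]].

Section Group.
Context {G : topologicalZmodType}.

Definition character (chi : G -> R[i]) : Prop :=
  [/\ forall x, cabs (chi x) = 1,
      forall x y, chi (x + y) = chi x * chi y,
      continuous (fun x => complex.Re (chi x))
    & continuous (fun x => complex.Im (chi x))].

(* On a compact group, outer regularity of a finite Borel measure implies inner
   regularity, by complementation. *)
Definition haar (mu : probability (borel G) R) : Prop :=
  (forall (x : G) (A : set (borel G)), measurable A ->
     mu [set x + y | y in (A : set G)] = mu A) /\
  (forall A : set (borel G), measurable A ->
     mu A = ereal_inf [set mu U | U in [set U : set G | open U /\ A `<=` U]]).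

Record dirichlet_group (lambda : nat -> R) (mu : probability (borel G) R)
    (beta : R -> G) (h : nat -> G -> R[i]) : Prop := DirichletGroup {
  dgroup_hausdorff : hausdorff_space G ;
  dgroup_compact : compact [set: G] ;
  dgroup_haar : haar mu ;
  dgroup_morph : forall s t, beta (s + t) = beta s + beta t ;
  dgroup_continuous : continuous beta ;
  dgroup_dense : dense (range beta) ;
  dgroup_char : forall n, character (h n) ;
  dgroup_charE : forall n t, h n (beta t) = cis (- (lambda n * t)) }.

Definition in_Lp (mu : probability (borel G) R) (p : \bar R)
    (f : G -> R[i]) : Prop :=
  [/\ measurable_fun [set: borel G] (fun x : borel G => complex.Re (f x)),
      measurable_fun [set: borel G] (fun x : borel G => complex.Im (f x))
    & (Lnorm mu p (fun x : borel G => (cabs (f x))%:E) < +oo)%E].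

Definition fourier (mu : probability (borel G) R) (f : G -> R[i])
    (chi : G -> R[i]) : R[i] :=
  (\int[mu]_x complex.Re (f x * (chi x)^*)) +i*
  (\int[mu]_x complex.Im (f x * (chi x)^*)).

(* The Dirichlet series sum_n a_n e^{-lambda_n s} is represented by its sequence
   of coefficients [a]. *)
Definition in_Hp (mu : probability (borel G) R) (h : nat -> G -> R[i])
    (p : \bar R) (a : nat -> R[i]) : Prop :=
  exists f : G -> R[i],
    [/\ in_Lp mu p f,
        forall chi, character chi -> fourier mu f chi != 0 ->
          exists n, chi = h n
      & forall n, a n = fourier mu f (h n)].

Definition translate (lambda : nat -> R) (sigma : R) (a : nat -> R[i]) :
    nat -> R[i] :=
  fun n => a n * (expR (- (lambda n * sigma)))%:C.

Definition abscissa (lambda : nat -> R) (mu : probability (borel G) R)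
    (h : nat -> G -> R[i]) (p : \bar R) (a : nat -> R[i]) : \bar R :=
  ereal_inf [set sigma%:E | sigma in
    [set sigma : R | in_Hp mu h p (translate lambda sigma a)]].

(* Difference of extended reals in which +oo - +oo and -oo - -oo are 0. *)
Definition gap (x y : \bar R) : \bar R := if x == y then 0%E else (x - y)%E.

Definition T_ (lambda : nat -> R) (mu : probability (borel G) R)
    (h : nat -> G -> R[i]) (q p : \bar R) : \bar R :=
  ereal_sup [set gap (abscissa lambda mu h q a) (abscissa lambda mu h p a)
            | a in [set: nat -> R[i]]].

End Group.
End Hardy.

(* Main.v *)
(* Only p < q requires an argument, and then p is finite. On the group, let P_j
   be the part of a Dirichlet polynomial with frequencies in [j, j + 1).

   Upper bound. Passing from P to P_j is harmless: if F has nonnegative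
   frequencies, then along F one can compare |F|^r with |Re F|^p through
   explicit powers psi of quadratic forms of (Re F, Im F) whose combination is
   superharmonic. A discrete mean value argument in the half plane, based on
   four points and Taylor expansions, then bounds the L_r-norm of the projection
   onto frequencies >= x by the L_p-norm, with r = p for p > 1 and any r < 1 for
   p = 1. In the latter case interpolating r < 1 < q costs only a power 1 + eps
   of the constant Lambda of the block. Hence the blocks of a series of H_p
   satisfy |P_j|_q <= K Lambda_j^(1 + eps), and translating by
   sigma > limsup (log Lambda_j)/j makes them geometrically summable in L_q:
   translation contracts the block by exp (- j sigma), by superharmonicity again.

   Lower bound. If log Lambda_j > j L for infinitely many j, choose blocks P_j
   with |P_j|_p <= 1 and |P_j|_q = exp (j L) along a very sparse sequence of j.
   Their sum has sigma_p <= 0. If a translate by t < L of it were in H_q, then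
   convolving with a trigonometric kernel that is almost 1 on the frequencies up
   to P_j and kills all later blocks would bound |P_j|_q exp (- j t) by a
   constant plus the norms of the earlier blocks, which is impossible.

   The kernels are normalized powers of prod_n (1 + Re h_n) / 2; they also give
   the agreement of time averages with integrals over the group, which
   identifies the norms of Dirichlet polynomials with norms in L_q(G). *)
From HB Require Import structures.
Require Import Defs.
From mathcomp Require Import all_boot all_order all_algebra.
From mathcomp Require Import all_classical all_reals all_analysis.
From mathcomp Require Import complex ring lra measurable_realfun ess_sup_inf.
Import Order.TTheory GRing.Theory Num.Theory.
Import numFieldNormedType.Exports.

Set Implicit Arguments.
Unset Strict Implicit.
Unset Printing Implicit Defensive.

Local Open Scope classical_set_scope.
Local Open Scope ring_scope.

(** * Taylor expansions and the four-point formula *)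

(** The obstacle is the projection onto an interval of frequencies: on an arbitrary compact group it
    needs a bound that depends neither on the interval nor on the number of frequencies in it.
    Multiplying P by the conjugate of one [h m] and conjugating the part of negative frequency turns
    P into functions F analytic in a half plane, with real parts dominated by |P|. Translation by
    [beta t] preserves the Haar measure, so in the mean over the group of a superharmonic function
    of F the two points displaced along [beta] contribute the same as the centre. What remains is a
    function of the height alone with second differences at most O(h^3); being bounded, it is
    nondecreasing, and far up only the constant term of F is left. The summand 1 in [psi] removes
    the singularity at the zeros of F, so that Taylor estimates of third order suffice. On L_1 the
    projection is in general unbounded, hence the exponents r < 1; the loss 1 + eps is harmless
    because Lambda_j matters only through its exponential rate. *)

Section Taylor.
Context {R : realType}.
Implicit Types (f g : R -> R) (a b x y C : R).

Lemma mvt_bound f f' a b C :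
  (forall t : R, t \in `[a, b] -> is_derive t 1 f (f' t)) ->
  forall x y : R, x \in `[a, b] -> y \in `[a, b] ->
  (forall t : R, Num.min x y <= t <= Num.max x y -> `|f' t| <= C) ->
  `|f y - f x| <= C * `|y - x|.
Proof.
move=> df; have main x y : x \in `[a, b] -> y \in `[a, b] -> x <= y ->
    (forall t : R, x <= t <= y -> `|f' t| <= C) -> `|f y - f x| <= C * `|y - x|.
  rewrite !in_itv/= => /andP[ax xb] /andP[ay yb] xy Cf.
  have sub t : t \in `[x, y] -> t \in `[a, b].
    rewrite !in_itv/= => /andP[xt ty].
    by rewrite (le_trans ax)//= (le_trans ty).
  have dxy : forall t : R, t \in `]x, y[ -> is_derive t 1 f (f' t).
    by move=> t /subset_itv_oo_cc /sub; exact: df.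
  have cxy : {within `[x, y], continuous f}.
    by apply: derivable_within_continuous => t /sub /df; case.
  have [c cI ->] := @MVT_segment R f f' x y xy dxy cxy.
  by rewrite normrM ler_wpM2r// Cf//; move: cI; rewrite in_itv.
move=> x y xab yab Cf; have [xy|/ltW yx] := leP x y.
  by apply: main => // t txy; apply: Cf; rewrite min_l// max_r.
rewrite distrC (distrC y); apply: main => // t txy; apply: Cf.
by rewrite min_r// max_l.
Qed.

(** The mean value inequality is applied three times, to [f2], to [f1] minus its linear part and to
    [f] minus its quadratic part. This gives the constant C instead of C / 6, which is of no
    consequence for O(h^3) estimates. *)
Lemma taylor2_bound f f1 f2 f3 a b C : 0 <= C ->
  (forall t : R, t \in `[a, b] -> is_derive t 1 f (f1 t)) ->
  (forall t : R, t \in `[a, b] -> is_derive t 1 f1 (f2 t)) ->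
  (forall t : R, t \in `[a, b] -> is_derive t 1 f2 (f3 t)) ->
  (forall t : R, t \in `[a, b] -> `|f3 t| <= C) ->
  forall x y : R, x \in `[a, b] -> y \in `[a, b] ->
  `|f y - f x - f1 x * (y - x) - f2 x * (y - x) ^+ 2 / 2| <= C * `|y - x| ^+ 3.
Proof.
move=> C0 d0 d1 d2 Cf3 x y xab yab.
have sub s t : s \in `[a, b] -> Num.min x s <= t <= Num.max x s -> t \in `[a, b].
  move: xab; rewrite !in_itv/= => /andP[ax xb] /andP[as_ sb].
  rewrite ge_min le_max => /andP[/orP h1 /orP h2]; apply/andP; split.
    by case: h1 => ?; lra.
  by case: h2 => ?; lra.
have dist s t : Num.min x s <= t <= Num.max x s -> `|t - x| <= `|s - x|.
  have [xs|/ltW sx] := leP x s; first by move=> /andP[? ?]; rewrite !ger0_norm; lra.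
  by move=> /andP[? ?]; rewrite !ler0_norm; lra.
have b2 s : s \in `[a, b] -> `|f2 s - f2 x| <= C * `|s - x|.
  move=> sab; apply: (mvt_bound d2) => // t txs; apply: Cf3.
  exact: sub txs.
have b1 s : s \in `[a, b] ->
    `|(f1 s - f2 x * (s - x)) - (f1 x - f2 x * (x - x))| <= C * `|s - x| ^+ 2.
  move=> sab; rewrite expr2 mulrA.
  apply: (@mvt_bound (fun t => f1 t - f2 x * (t - x))
    (fun t => f2 t - f2 x) a b) => //.
    move=> t /d1 dt; apply: is_derive_eq.
    by rewrite /GRing.scale/=; ring.
  move=> t txs; apply: (le_trans (b2 _ (sub _ _ sab txs))).
  by rewrite ler_wpM2l// dist.
pose g t := f t - f1 x * (t - x) - f2 x * (t - x) ^+ 2 / 2.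
suff : `|g y - g x| <= C * `|y - x| ^+ 2 * `|y - x|.
  rewrite /g subrr expr0n/= !mulr0 !mul0r !subr0 -[leRHS]mulrA -exprSr.
  by apply: le_trans; rewrite le_eqVlt; apply/orP; left; apply/eqP; congr `| _ |; ring.
apply: (@mvt_bound g (fun t => f1 t - f1 x - f2 x * (t - x)) a b) => //.
  move=> t /d0 dt; rewrite /g; apply: is_derive_eq.
  rewrite /GRing.scale/=.
  by field.
move=> t txs; have := b1 t (sub _ _ yab txs).
rewrite (_ : _ - _ = f1 t - f1 x - f2 x * (t - x)); last by ring.
move/le_trans; apply.
by rewrite ler_wpM2l// lerXn2r// ?nnegrE// dist.
Qed.

Lemma mem0_itvN (t : R) : 0 \in `[- `|t|, `|t|].
Proof. by rewrite in_itv/= oppr_le0 normr_ge0. Qed.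

Lemma mem_itvN_norm (t : R) : t \in `[- `|t|, `|t|].
Proof. by rewrite in_itv/= lerNnormlW//= ler_norm. Qed.

Lemma taylor2_cos (t : R) : `|cos t - 1 + t ^+ 2 / 2| <= `|t| ^+ 3.
Proof.
have h : `|cos t - cos 0 - (- sin 0) * (t - 0) - (- cos 0) * (t - 0) ^+ 2 / 2|
    <= 1 * `|t - 0| ^+ 3.
  apply: (@taylor2_bound cos (fun x => - sin x) (fun x => - cos x) sin
    (- `|t|) `|t| 1 ler01 _ _ _ _ _ _ (mem0_itvN t) (mem_itvN_norm t)) => // x _.
    by apply: is_derive_eq; rewrite opprK.
  by rewrite ler_norml sin_geN1 sin_le1.
move: h; rewrite cos0 sin0 [in leRHS]subr0 [in leRHS]mul1r; apply: le_trans.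
by rewrite le_eqVlt; apply/orP; left; apply/eqP; congr `| _ |; ring.
Qed.

Lemma taylor2_sin (t : R) : `|sin t - t| <= `|t| ^+ 3.
Proof.
have h : `|sin t - sin 0 - cos 0 * (t - 0) - (- sin 0) * (t - 0) ^+ 2 / 2|
    <= 1 * `|t - 0| ^+ 3.
  apply: (@taylor2_bound sin cos (fun x => - sin x) (fun x => - cos x)
    (- `|t|) `|t| 1 ler01 _ _ _ _ _ _ (mem0_itvN t) (mem_itvN_norm t)) => // x _.
  by rewrite normrN ler_norml cos_geN1 cos_le1.
move: h; rewrite cos0 sin0 [in leRHS]subr0 [in leRHS]mul1r; apply: le_trans.
by rewrite le_eqVlt; apply/orP; left; apply/eqP; congr `| _ |; ring.
Qed.

Lemma taylor2_expR (M t : R) : `|t| <= M ->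
  `|expR t - 1 - t - t ^+ 2 / 2| <= expR M * `|t| ^+ 3.
Proof.
move=> tM.
have h : `|expR t - expR 0 - expR 0 * (t - 0) - expR 0 * (t - 0) ^+ 2 / 2|
    <= expR M * `|t - 0| ^+ 3.
  apply: (@taylor2_bound expR expR expR expR (- `|t|) `|t| _ (expR_ge0 _)
    _ _ _ _ _ _ (mem0_itvN t) (mem_itvN_norm t)) => // x.
  rewrite in_itv/= => /andP[_ xt].
  by rewrite ger0_norm ?expR_ge0// ler_expR (le_trans xt).
move: h; rewrite expR0 [in leRHS]subr0; apply: le_trans.
by rewrite le_eqVlt; apply/orP; left; apply/eqP; congr `| _ |; ring.
Qed.

Lemma is_derive_powR1D (al t : R) : 0 <= t ->
  is_derive t 1 (fun x => (1 + x) `^ al) (al * (1 + t) `^ (al - 1)).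
Proof.
move=> t0; have t1 : 0 < 1 + t by lra.
have h := is_derive1_powR al t1.
have h1 : is_derive t (1 : R) (fun x : R => 1 + x) 1.
  by apply: is_derive_eq; rewrite add0r mulr1.
have h2 := is_derive1_comp (f := fun x : R => x `^ al) (g := fun x : R => 1 + x) h h1.
by apply: (is_derive_eq h2); rewrite mulr1.
Qed.

(** The base stays in [1, 1 + K], where the third derivative is bounded whatever the sign of
    [al - 3]; the absolute value in the exponent covers both signs. Uniformity in x matters, since x
    will be a quadratic form evaluated at varying points. *)
Lemma taylor2_powR (al K : R) : 0 <= K -> exists2 C, 0 <= C &
  forall x y : R, 0 <= x <= K -> 0 <= y <= K ->
  `|(1 + y) `^ al - (1 + x) `^ al - al * (1 + x) `^ (al - 1) * (y - x)
    - al * (al - 1) * (1 + x) `^ (al - 2) * (y - x) ^+ 2 / 2|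
    <= C * `|y - x| ^+ 3.
Proof.
move=> K0; pose c := al * (al - 1) * (al - 2).
exists (`|c| * (1 + K) `^ `|al - 3|); first by rewrite mulr_ge0// powR_ge0.
move=> x y xK yK.
have c0 : 0 <= `|c| * (1 + K) `^ `|al - 3| by rewrite mulr_ge0// powR_ge0.
have d0 (t : R) : t \in `[0, K] ->
    is_derive t 1 (fun x => (1 + x) `^ al) (al * (1 + t) `^ (al - 1)).
  by rewrite in_itv/= => /andP[t0 _]; exact: is_derive_powR1D.
have d1 (t : R) : t \in `[0, K] -> is_derive t 1 (fun x => al * (1 + x) `^ (al - 1))
    (al * (al - 1) * (1 + t) `^ (al - 2)).
  rewrite in_itv/= => /andP[t0 _]; have h := is_derive_powR1D (al - 1) t0.
  apply: is_derive_eq; rewrite /GRing.scale/= (_ : al - 1 - 1 = al - 2); ring.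
have d2 (t : R) : t \in `[0, K] -> is_derive t 1
    (fun x => al * (al - 1) * (1 + x) `^ (al - 2)) (c * (1 + t) `^ (al - 3)).
  rewrite in_itv/= => /andP[t0 _]; have h := is_derive_powR1D (al - 2) t0.
  apply: is_derive_eq; rewrite /GRing.scale/= /c (_ : al - 2 - 1 = al - 3); ring.
have d3 (t : R) : t \in `[0, K] ->
    `|c * (1 + t) `^ (al - 3)| <= `|c| * (1 + K) `^ `|al - 3|.
  rewrite in_itv/= => /andP[t0 tK]; rewrite normrM ler_wpM2l// ger0_norm ?powR_ge0//.
  apply: (@le_trans _ _ ((1 + t) `^ `|al - 3|)).
    by apply: ler_powR; [lra|exact: ler_norm].
  by apply: ge0_ler_powR; rewrite ?nnegrE ?normr_ge0 //; lra.
exact: (taylor2_bound c0 d0 d1 d2 d3 xK yK).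
Qed.

End Taylor.

Section BigO.
Context {R : realType} {T : Type} (h : T -> R) (D : T -> Prop).
Implicit Types (f g : T -> R) (j k : nat).

(** The point w carries all parameters of an expansion, and the constant may not depend on it.
    Expansions are then combined by identities between functions ([bO_eq] followed by [ring]),
    without tracking constants. *)
Definition bO k f := exists C, forall w, D w -> `|f w| <= C * h w ^+ k.

Hypothesis hD : forall w, D w -> 0 < h w <= 1.

Let h_ge0 w k : D w -> 0 <= h w ^+ k.
Proof. by move=> /hD /andP[h0 _]; rewrite exprn_ge0// ltW. Qed.

Lemma bO_eq k f g : (forall w, D w -> f w = g w) -> bO k f -> bO k g.
Proof. by move=> fg [C Cf]; exists C => w Dw; rewrite -fg//; exact: Cf. Qed.

Lemma bO_pos k f : bO k f -> exists2 C, 0 <= C &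
  forall w, D w -> `|f w| <= C * h w ^+ k.
Proof.
move=> [C Cf]; exists `|C| => // w Dw; apply: (le_trans (Cf w Dw)).
by rewrite ler_wpM2r ?h_ge0// ler_norm.
Qed.

Lemma bO_weaken j k f : (j <= k)%N -> bO k f -> bO j f.
Proof.
move=> jk /bO_pos[C C0 Cf]; exists C => w Dw; apply: (le_trans (Cf w Dw)).
have /andP[h0 h1] := hD Dw.
by rewrite ler_wpM2l// ler_wiXn2l// ltW.
Qed.

Lemma bO_le k f g : (forall w, D w -> `|f w| <= `|g w|) -> bO k g -> bO k f.
Proof.
by move=> fg [C Cf]; exists C => w Dw; apply: (le_trans (fg w Dw)); exact: Cf.
Qed.

Lemma bO_add k f g : bO k f -> bO k g -> bO k (fun w => f w + g w).
Proof.
move=> [C Cf] [C' Cg]; exists (C + C') => w Dw.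
by rewrite mulrDl (le_trans (ler_normD _ _))// lerD ?Cf ?Cg.
Qed.

Lemma bO_mul j k f g : bO j f -> bO k g -> bO (j + k) (fun w => f w * g w).
Proof.
move=> [C Cf] [C' Cg]; exists (C * C') => w Dw.
rewrite normrM exprD mulrACA; apply: ler_pM => //; [exact: Cf|exact: Cg].
Qed.

Lemma bO_cst (c : R) : bO 0 (fun=> c).
Proof. by exists `|c| => w Dw; rewrite expr0 mulr1. Qed.

Lemma bO_opp k f : bO k f -> bO k (fun w => - f w).
Proof. by move=> [C Cf]; exists C => w Dw; rewrite normrN Cf. Qed.

Lemma bO_sub k f g : bO k f -> bO k g -> bO k (fun w => f w - g w).
Proof. by move=> bf /bO_opp; exact: bO_add. Qed.

Lemma bO_h : bO 1 h.
Proof.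
by exists 1 => w Dw; rewrite mul1r expr1 ger0_norm//; case/andP: (hD Dw) => /ltW.
Qed.

Lemma bO_scale k f (c : R) : bO k f -> bO k (fun w => c * f w).
Proof. by move=> bf; exact: (bO_mul (bO_cst c) bf). Qed.

(** Factor the difference as (f + g)(f - g). With j = 1 and k = 2 it replaces an increment by its
    leading term inside a square at the cost of O(h^3). *)
Lemma bO_sqr_sub j k f g : (j <= k)%N -> bO j f -> bO k (fun w => f w - g w) ->
  bO (j + k) (fun w => f w ^+ 2 - g w ^+ 2).
Proof.
move=> jk bf bfg.
have bg : bO j g.
  apply: bO_eq (bO_sub bf (bO_weaken jk bfg)) => w _; ring.
apply: bO_eq (bO_mul (bO_add bf bg) bfg) => w _; ring.
Qed.

Lemma bO_sum k n (F : 'I_n -> T -> R) :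
  (forall i, bO k (F i)) -> bO k (fun w => \sum_(i < n) F i w).
Proof.
move=> bF; have /choice[C CF] := bF; exists (\sum_(i < n) C i) => w Dw.
rewrite mulr_suml; apply: (le_trans (ler_norm_sum _ _ _)).
by apply: ler_sum => i _; exact: CF.
Qed.

End BigO.

Section FourPoint.
Context {R : realType}.

(* In the application [u + i v] is an analytic function and [Lap] is the
   Laplacian of [psi]; the four increments are those in the directions
   i, -i, 1, -1. *)
Definition psi (al ka nu u v : R) := (1 + (ka * u ^+ 2 + nu * v ^+ 2)) `^ al.

Definition Lap (al ka nu u v : R) :=
  let Q := ka * u ^+ 2 + nu * v ^+ 2 in
  2 * al * (ka + nu) * (1 + Q) `^ (al - 1) +
  4 * al * (al - 1) * (ka ^+ 2 * u ^+ 2 + nu ^+ 2 * v ^+ 2) * (1 + Q) `^ (al - 2).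

Context {T : Type} (h : T -> R) (D : T -> Prop).
Hypothesis hD : forall w, D w -> 0 < h w <= 1.
Local Notation O := (bO h D).

Variables (u v a b : T -> R) (du dv mu_ mv_ : 'I_4 -> T -> R).
Hypotheses (bu : O 0 u) (bv : O 0 v) (ba : O 0 a) (bb : O 0 b).
Hypothesis bmu : forall k, O 0 (mu_ k).
Hypothesis bmv : forall k, O 0 (mv_ k).
Hypothesis bdu : forall k, O 2 (fun w => du k w - h w * mu_ k w).
Hypothesis bdv : forall k, O 2 (fun w => dv k w - h w * mv_ k w).
Hypothesis bsu : O 3 (fun w => \sum_(k < 4) du k w).
Hypothesis bsv : O 3 (fun w => \sum_(k < 4) dv k w).
Hypothesis mu2 : forall w, \sum_(k < 4) mu_ k w ^+ 2 = 2 * (a w ^+ 2 + b w ^+ 2).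
Hypothesis mv2 : forall w, \sum_(k < 4) mv_ k w ^+ 2 = 2 * (a w ^+ 2 + b w ^+ 2).
Hypothesis muv : forall w, \sum_(k < 4) mu_ k w * mv_ k w = 0.

(** A second-order expansion of the power around Q, the quadratic form of (u, v). The hypotheses on
    [mu_] and [mv_] are the Cauchy-Riemann relations summed over four orthogonal directions, those
    on the sums of [du] and [dv] express discrete harmonicity of u and v; a^2 + b^2 is the squared
    modulus of the derivative. *)
Lemma four_point_psi (al ka nu : R) : 0 <= ka -> 0 <= nu ->
  O 3 (fun w => \sum_(k < 4) (psi al ka nu (u w + du k w) (v w + dv k w)
     - psi al ka nu (u w) (v w))
     - h w ^+ 2 * (a w ^+ 2 + b w ^+ 2) * Lap al ka nu (u w) (v w)).
Proof.
move=> ka0 nu0.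
pose Q w := ka * u w ^+ 2 + nu * v w ^+ 2.
pose Qk k w := ka * (u w + du k w) ^+ 2 + nu * (v w + dv k w) ^+ 2.
pose l k w := 2 * ka * u w * mu_ k w + 2 * nu * v w * mv_ k w.
have w1 k f : O k.+1 f -> O k f by apply: bO_weaken.
have hm (m : 'I_4 -> T -> R) k : O 0 (m k) -> O 1 (fun w => h w * m k w).
  by move=> bm; exact: (bO_mul (bO_h hD) bm).
have bdu1 k : O 1 (du k).
  by apply: bO_eq (bO_add (w1 _ _ (bdu k)) (hm _ _ (bmu k))) => w _; ring.
have bdv1 k : O 1 (dv k).
  by apply: bO_eq (bO_add (w1 _ _ (bdv k)) (hm _ _ (bmv k))) => w _; ring.
have bl k : O 0 (l k).
  apply: bO_add; apply: (bO_mul (j := 0) (k := 0)) => //.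
    exact: bO_scale.
  exact: bO_scale.
have bQ : O 0 Q.
  apply: bO_add; apply: bO_scale; exact: (bO_mul (j := 0) (k := 0)).
have be1 k : O 2 (fun w => Qk k w - Q w - h w * l k w).
  have h1 := bO_mul (bO_scale (2 * ka) bu) (bdu k).
  have h2 := bO_mul (bO_scale (2 * nu) bv) (bdv k).
  have h3 := bO_scale ka (bO_mul (bdu1 k) (bdu1 k)).
  have h4 := bO_scale nu (bO_mul (bdv1 k) (bdv1 k)).
  apply: bO_eq (bO_add (bO_add h1 h2) (bO_add h3 h4)) => w _.
  by rewrite /Qk /Q /l; ring.
have be k : O 1 (fun w => Qk k w - Q w).
  by apply: bO_eq (bO_add (w1 _ _ (be1 k)) (hm _ _ (bl k))) => w _; ring.
(* The part of Q that is linear in the increments sums to O(h^3) by harmonicity; only the squares of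
   the increments are left, and these are replaced by their leading terms. *)
have bsQ : O 3 (fun w => \sum_(k < 4) (Qk k w - Q w)
    - h w ^+ 2 * (2 * (ka + nu) * (a w ^+ 2 + b w ^+ 2))).
  have hu : O 3 (fun w => \sum_(k < 4) (du k w ^+ 2 - (h w * mu_ k w) ^+ 2)).
    by apply: bO_sum => k; exact: (bO_sqr_sub hD (j := 1) (k := 2)).
  have hv : O 3 (fun w => \sum_(k < 4) (dv k w ^+ 2 - (h w * mv_ k w) ^+ 2)).
    by apply: bO_sum => k; exact: (bO_sqr_sub hD (j := 1) (k := 2)).
  have h1 := bO_mul (bO_scale (2 * ka) bu) bsu.
  have h2 := bO_mul (bO_scale (2 * nu) bv) bsv.
  apply: bO_eq (bO_add (bO_add h1 h2) (bO_add (bO_scale ka hu) (bO_scale nu hv))) => w _.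
  have := mu2 w; have := mv2 w; rewrite /Qk /Q !big_ord_recl !big_ord0 => ev eu.
  have -> : h w ^+ 2 * (2 * (ka + nu) * (a w ^+ 2 + b w ^+ 2)) =
    h w ^+ 2 * ka * (2 * (a w ^+ 2 + b w ^+ 2)) +
    h w ^+ 2 * nu * (2 * (a w ^+ 2 + b w ^+ 2)) by ring.
  rewrite -{1}eu -ev; ring.
(* Here the squares of the linear part itself are summed; the mixed term in u v disappears by
   [muv]. *)
have bsQ2 : O 3 (fun w => \sum_(k < 4) (Qk k w - Q w) ^+ 2
    - h w ^+ 2 * (8 * (ka ^+ 2 * u w ^+ 2 + nu ^+ 2 * v w ^+ 2) * (a w ^+ 2 + b w ^+ 2))).
  have hl : O 3 (fun w => \sum_(k < 4) ((Qk k w - Q w) ^+ 2 - (h w * l k w) ^+ 2)).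
    by apply: bO_sum => k; exact: (bO_sqr_sub hD (j := 1) (k := 2)).
  apply: bO_eq hl => w _; rewrite sumrB; congr (_ - _).
  have := mu2 w; have := mv2 w; have := muv w; rewrite /l.
  rewrite !big_ord_recl !big_ord0 !addr0 => euv ev eu.
  have -> : h w ^+ 2 * (8 * (ka ^+ 2 * u w ^+ 2 + nu ^+ 2 * v w ^+ 2) * (a w ^+ 2 + b w ^+ 2))
    = h w ^+ 2 * (4 * ka ^+ 2 * u w ^+ 2) * (2 * (a w ^+ 2 + b w ^+ 2)) +
     h w ^+ 2 * (4 * nu ^+ 2 * v w ^+ 2) * (2 * (a w ^+ 2 + b w ^+ 2))
     + h w ^+ 2 * 8 * ka * nu * u w * v w * 0 by ring.
  rewrite -{1}eu -ev -euv; ring.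
have [K K0 QK] : exists2 K, 0 <= K &
    forall w, D w -> 0 <= Q w <= K /\ forall k, 0 <= Qk k w <= K.
  have /bO_pos[//|K1 K10 HK1] := bQ.
  have bQk k : O 0 (Qk k).
    by apply: bO_eq (bO_add (w1 _ _ (be k)) bQ) => w _; ring.
  have /choice[K2 HK2] : forall k : 'I_4, exists C, 0 <= C /\
      forall w, D w -> `|Qk k w| <= C.
    move=> k; have /bO_pos[//|C C0 HC] := bQk k; exists C; split => // w Dw.
    by rewrite -[C]mulr1 -(expr0 (h w)) HC.
  exists (K1 + \sum_k K2 k).
    by rewrite addr_ge0// sumr_ge0// => k _; case: (HK2 k).
  move=> w Dw; have s0 : 0 <= \sum_k K2 k.
    by rewrite sumr_ge0// => k _; case: (HK2 k).
  have pos (x y : R) : 0 <= ka * x ^+ 2 + nu * y ^+ 2.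
    by rewrite addr_ge0// mulr_ge0// sqr_ge0.
  split=> [|k]; rewrite pos/=.
    have := HK1 w Dw; rewrite expr0 mulr1 ger0_norm ?pos// => /le_trans; apply.
    by rewrite lerDl.
  have := (HK2 k).2 w Dw; rewrite ger0_norm ?pos// => /le_trans; apply.
  rewrite (bigD1 k)//= addrCA lerDl addr_ge0// sumr_ge0// => i _.
  by case: (HK2 i).
have [C C0 tay] := taylor2_powR al K0.
have bP (c : R) : O 0 (fun w => (1 + Q w) `^ c).
  exists ((1 + K) `^ `|c|) => w Dw; have [/andP[q0 qK] _] := QK w Dw.
  rewrite expr0 mulr1 ger0_norm ?powR_ge0//.
  apply: (@le_trans _ _ ((1 + Q w) `^ `|c|)).
    by apply: ler_powR; [lra|exact: ler_norm].
  by apply: ge0_ler_powR; rewrite ?nnegrE ?normr_ge0//; lra.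
pose rem k w := (1 + Qk k w) `^ al - (1 + Q w) `^ al
  - al * (1 + Q w) `^ (al - 1) * (Qk k w - Q w)
  - al * (al - 1) * (1 + Q w) `^ (al - 2) * (Qk k w - Q w) ^+ 2 / 2.
have brem k : O 3 (rem k).
  have h3 := bO_scale C (bO_mul (be k) (bO_mul (be k) (be k))).
  apply: bO_le h3 => w Dw; have [q1 q2] := QK w Dw.
  apply: (le_trans (tay _ _ q1 (q2 k))).
  by rewrite normrM (ger0_norm C0) ler_wpM2l// -expr2 -exprS normrX.
have h1 := bO_mul (bO_scale al (bP (al - 1))) bsQ.
have h2 := bO_mul (bO_scale (al * (al - 1) / 2) (bP (al - 2))) bsQ2.
have h3 : O 3 (fun w => \sum_(k < 4) rem k w) by apply: bO_sum.
apply: bO_eq (bO_add (bO_add h1 h2) h3) => w _.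
rewrite /Lap /psi -/(Q w) !big_ord_recl !big_ord0 /rem /Qk.
by field.
Qed.

End FourPoint.

Section FourPointSum.
Context {R : realType} (n : nat) (e : 'I_n -> R).

(* Real and imaginary part of
   [\sum_i (r i + i s i) exp (- e i * (y + i t))]. *)
Definition re_sum (r s : 'I_n -> R) (t y : R) : R :=
  \sum_(i < n) expR (- (e i * y)) * (r i * cos (e i * t) + s i * sin (e i * t)).
Definition im_sum (r s : 'I_n -> R) (t y : R) : R :=
  \sum_(i < n) expR (- (e i * y)) * (s i * cos (e i * t) - r i * sin (e i * t)).

Lemma re_sum0 r s : re_sum r s 0 0 = \sum_i r i.
Proof.
apply: eq_bigr => i _.
by rewrite !mulr0 cos0 sin0 oppr0 expR0 mulr0 addr0 mulr1 mul1r.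
Qed.

Lemma im_sum0 r s : im_sum r s 0 0 = \sum_i s i.
Proof.
apply: eq_bigr => i _.
by rewrite !mulr0 cos0 sin0 oppr0 expR0 mulr0 subr0 mulr1 mul1r.
Qed.

Lemma ord4P (P : 'I_4 -> Prop) : P 0 -> P 1 -> P 2%:R -> P 3%:R -> forall k, P k.
Proof.
move=> P0 P1 P2 P3 k.
have : [\/ k = 0, k = 1, k = 2%:R | k = 3%:R].
  case: k => [[|[|[|[|//]]]] lk]; [apply: Or41|apply: Or42|apply: Or43|apply: Or44];
  exact: val_inj.
by case=> ->.
Qed.

Section BigOSum.
Context (T : Type) (h : T -> R) (D : T -> Prop) (r s : T -> 'I_n -> R).
Hypothesis hD : forall w, D w -> 0 < h w <= 1.
Hypothesis br : forall i, bO h D 0 (fun w => r w i).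
Hypothesis bs : forall i, bO h D 0 (fun w => s w i).
Local Notation O := (bO h D).
Variables (al ka nu : R).
Hypotheses (ka0 : 0 <= ka) (nu0 : 0 <= nu).

Let norm3 (c : R) w : D w -> `|c * h w| ^+ 3 = `|c| ^+ 3 * h w ^+ 3.
Proof. by move=> /hD /andP[h0 _]; rewrite normrM exprMn (ger0_norm (ltW h0)). Qed.

Let bcos i : O 3 (fun w => cos (e i * h w) - 1 + (e i * h w) ^+ 2 / 2).
Proof. by exists (`|e i| ^+ 3) => w Dw; rewrite -norm3//; exact: taylor2_cos. Qed.

Let bsin i : O 3 (fun w => sin (e i * h w) - e i * h w).
Proof. by exists (`|e i| ^+ 3) => w Dw; rewrite -norm3//; exact: taylor2_sin. Qed.

Let bexp (c : R) : O 3 (fun w => expR (c * h w) - 1 - c * h w - (c * h w) ^+ 2 / 2).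
Proof.
exists (expR `|c| * `|c| ^+ 3) => w Dw; rewrite -mulrA -norm3//.
apply: taylor2_expR; have /andP[h0 h1] := hD Dw.
by rewrite normrM (ger0_norm (ltW h0)) ler_piMr.
Qed.

Let w1 f : O 3 f -> O 2 f.
Proof. exact: bO_weaken. Qed.

Let bh2 (c : R) : O 2 (fun w => (c * h w) ^+ 2 / 2).
Proof.
apply: bO_eq (bO_scale (c ^+ 2 / 2) (bO_mul (bO_h hD) (bO_h hD))) => w _; ring.
Qed.

Let bcos2 i : O 2 (fun w => cos (e i * h w) - 1).
Proof.
apply: bO_eq (bO_sub (w1 (bcos i)) (bh2 (e i))) => w _; ring.
Qed.

Let bexp2 (c : R) : O 2 (fun w => expR (c * h w) - 1 - c * h w).
Proof.
apply: bO_eq (bO_add (w1 (bexp c)) (bh2 c)) => w _; ring.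
Qed.

Let bexpN (e0 : R) : O 2 (fun w => expR (- (e0 * h w)) - 1 + e0 * h w).
Proof. by apply: bO_eq (bexp2 (- e0)) => w _; rewrite mulNr opprK. Qed.

Let bsin2 i : O 2 (fun w => sin (e i * h w) - e i * h w).
Proof. exact: w1 (bsin i). Qed.

Let lin (F G : 'I_n -> T -> R) :
    (forall i, O 2 (F i)) -> (forall i, O 2 (G i)) ->
    O 2 (fun w => \sum_i (r w i * F i w + s w i * G i w)).
Proof.
move=> bF bG; apply: bO_sum => i.
by apply: bO_add; apply: (bO_mul (j := 0) (k := 2)).
Qed.

Let b0 : O 2 (fun=> 0).
Proof. by exists 0 => w _; rewrite normr0 mul0r. Qed.

(** At the origin the derivative of the sum with respect to y + i t is - (a + i b). The four entries
    of [mu] and [mv] are its real and imaginary parts multiplied by the directions i, -i, 1, -1. *)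
Let a w := \sum_i e i * r w i.
Let b w := \sum_i e i * s w i.
Let U t y w := re_sum (r w) (s w) t y.
Let V t y w := im_sum (r w) (s w) t y.
Let u := U 0 0.
Let v := V 0 0.
Let du (k : 'I_4) w := nth 0 [:: U (h w) 0 w - u w; U (- h w) 0 w - u w;
  U 0 (h w) w - u w; U 0 (- h w) w - u w] k.
Let dv (k : 'I_4) w := nth 0 [:: V (h w) 0 w - v w; V (- h w) 0 w - v w;
  V 0 (h w) w - v w; V 0 (- h w) w - v w] k.
Let mu (k : 'I_4) w := nth 0 [:: b w; - b w; - a w; a w] k.
Let mv (k : 'I_4) w := nth 0 [:: - a w; a w; - b w; b w] k.

Let bdu k : O 2 (fun w => du k w - h w * mu k w).
Proof.
rewrite /du /mu /u /U /a /b; move: k; apply: ord4P => /=.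
- apply: bO_eq (lin (fun i => bcos2 i) (fun i => bsin2 i)) => w _.
  rewrite re_sum0 mulr_sumr -!sumrB; apply: eq_bigr => i _; rewrite ?(mulrN, mulr0, cos0, sin0, oppr0, expR0, mulr1, mul1r, addr0, subr0, opprK, cosN, sinN); ring.
- apply: bO_eq (lin (fun i => bcos2 i) (fun i => bO_opp (bsin2 i))) => w _.
  rewrite re_sum0 mulrN mulr_sumr opprK -sumrB -big_split; apply: eq_bigr => i _.
  rewrite /= ?(mulrN, mulr0, cos0, sin0, oppr0, expR0, mulr1, mul1r, addr0, subr0, opprK, cosN, sinN); ring.
- apply: bO_eq (lin (fun i => bexpN (e i)) (fun i => b0)) => w _.
  rewrite re_sum0 mulrN mulr_sumr opprK -sumrB -big_split; apply: eq_bigr => i _.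
  rewrite /= ?(mulrN, mulr0, cos0, sin0, oppr0, expR0, mulr1, mul1r, addr0, subr0, opprK, cosN, sinN); ring.
- apply: bO_eq (lin (fun i => bexp2 (e i)) (fun i => b0)) => w _.
  rewrite re_sum0 mulr_sumr -!sumrB; apply: eq_bigr => i _; rewrite ?(mulrN, mulr0, cos0, sin0, oppr0, expR0, mulr1, mul1r, addr0, subr0, opprK, cosN, sinN); ring.
Qed.

Let bdv k : O 2 (fun w => dv k w - h w * mv k w).
Proof.
rewrite /dv /mv /v /V /a /b; move: k; apply: ord4P => /=.
- apply: bO_eq (lin (fun i => bO_opp (bsin2 i)) (fun i => bcos2 i)) => w _.
  rewrite im_sum0 mulrN mulr_sumr opprK -sumrB -big_split; apply: eq_bigr => i _.
  rewrite /= ?(mulrN, mulr0, cos0, sin0, oppr0, expR0, mulr1, mul1r, addr0, subr0, opprK, cosN, sinN); ring.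
- apply: bO_eq (lin (fun i => bsin2 i) (fun i => bcos2 i)) => w _.
  rewrite im_sum0 mulr_sumr -!sumrB; apply: eq_bigr => i _; rewrite ?(mulrN, mulr0, cos0, sin0, oppr0, expR0, mulr1, mul1r, addr0, subr0, opprK, cosN, sinN); ring.
- apply: bO_eq (lin (fun i => b0) (fun i => bexpN (e i))) => w _.
  rewrite im_sum0 mulrN mulr_sumr opprK -sumrB -big_split; apply: eq_bigr => i _.
  rewrite /= ?(mulrN, mulr0, cos0, sin0, oppr0, expR0, mulr1, mul1r, addr0, subr0, opprK, cosN, sinN); ring.
- apply: bO_eq (lin (fun i => b0) (fun i => bexp2 (e i))) => w _.
  rewrite im_sum0 mulr_sumr -!sumrB; apply: eq_bigr => i _; rewrite ?(mulrN, mulr0, cos0, sin0, oppr0, expR0, mulr1, mul1r, addr0, subr0, opprK, cosN, sinN); ring.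
Qed.

(** In 2 cos x + exp x + exp (- x) - 4 the quadratic terms cancel: this is the discrete form of the
    harmonicity of an exponential. The sum is therefore one of cubic remainders only. *)
Let bsum3 (z : T -> 'I_n -> R) : (forall i, O 0 (fun w => z w i)) ->
  O 3 (fun w => \sum_i z w i * (2 * (cos (e i * h w) - 1 + (e i * h w) ^+ 2 / 2) +
     (expR (e i * h w) - 1 - e i * h w - (e i * h w) ^+ 2 / 2) +
     (expR (- e i * h w) - 1 - - e i * h w - (- e i * h w) ^+ 2 / 2))).
Proof.
move=> bz; apply: bO_sum => i; apply: (bO_mul (j := 0) (k := 3)) => //.
apply: bO_add; [apply: bO_add|]; [|exact: bexp|exact: bexp].
by apply: bO_scale.
Qed.

Let bsu : O 3 (fun w => \sum_(k < 4) du k w).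
Proof.
apply: bO_eq (bsum3 br) => w _.
rewrite !big_ord_recl big_ord0 /du /= /u /U re_sum0 addr0 -!sumrB -!big_split.
by apply: eq_bigr => i _; rewrite /= ?(mulrN, mulr0, cos0, sin0, oppr0, expR0, mulr1, mul1r, addr0, subr0, opprK, cosN, sinN) mulNr; field.
Qed.

Let bsv : O 3 (fun w => \sum_(k < 4) dv k w).
Proof.
apply: bO_eq (bsum3 bs) => w _.
rewrite !big_ord_recl big_ord0 /dv /= /v /V im_sum0 addr0 -!sumrB -!big_split.
by apply: eq_bigr => i _; rewrite /= ?(mulrN, mulr0, cos0, sin0, oppr0, expR0, mulr1, mul1r, addr0, subr0, opprK, cosN, sinN) mulNr; field.
Qed.

Lemma bO_four_point_sum :
  let P w t y := psi al ka nu (re_sum (r w) (s w) t y) (im_sum (r w) (s w) t y) in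
  O 3 (fun w => P w (h w) 0 + P w (- h w) 0 + P w 0 (h w) + P w 0 (- h w) - 4 * P w 0 0
    - h w ^+ 2 * (a w ^+ 2 + b w ^+ 2) *
      Lap al ka nu (re_sum (r w) (s w) 0 0) (im_sum (r w) (s w) 0 0)).
Proof.
move=> P.
have ba : O 0 a by apply: bO_sum => i; apply: bO_scale.
have bb : O 0 b by apply: bO_sum => i; apply: bO_scale.
have bu : O 0 u by apply: bO_eq (bO_sum br) => w _; rewrite /u /U re_sum0.
have bv : O 0 v by apply: bO_eq (bO_sum bs) => w _; rewrite /v /V im_sum0.
have bmu k : O 0 (mu k) by rewrite /mu; move: k; apply: ord4P => //=; apply: bO_opp.
have bmv k : O 0 (mv k) by rewrite /mv; move: k; apply: ord4P => //=; apply: bO_opp.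
have bmn := @four_point_psi R T h D hD u v a b du dv mu mv bu bv bmu bmv bdu bdv bsu bsv.
have mu2 w : \sum_(k < 4) mu k w ^+ 2 = 2 * (a w ^+ 2 + b w ^+ 2).
  by rewrite !big_ord_recl big_ord0 /mu /=; ring.
have mv2 w : \sum_(k < 4) mv k w ^+ 2 = 2 * (a w ^+ 2 + b w ^+ 2).
  by rewrite !big_ord_recl big_ord0 /mv /=; ring.
have muv w : \sum_(k < 4) mu k w * mv k w = 0.
  by rewrite !big_ord_recl big_ord0 /mu /mv /=; ring.
apply: bO_eq (bmn mu2 mv2 muv al ka nu ka0 nu0) => w _.
rewrite !big_ord_recl big_ord0 /du /dv /= !(addrC (u w)) !(addrC (v w)) !subrK.
rewrite /P /u /v /U /V.
have alg (x1 x2 x3 x4 x0 y : R) : x1 - x0 + (x2 - x0 + (x3 - x0 + (x4 - x0 + 0))) - y =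
    x1 + x2 + x3 + x4 - 4 * x0 - y by ring.
exact: alg.
Qed.

End BigOSum.

(** Taking the step together with both coefficient vectors as the parameter point makes C depend on
    the coefficients through the bound A alone. Later the coefficients vary with the point of the
    group and with the height. *)
Lemma four_point_sum (A : 'I_n -> R) (al ka nu : R) : 0 <= ka -> 0 <= nu ->
  exists2 C, 0 <= C & forall (r s : 'I_n -> R) (h : R), 0 < h <= 1 ->
    (forall i, `|r i| <= A i) -> (forall i, `|s i| <= A i) ->
    let P t y := psi al ka nu (re_sum r s t y) (im_sum r s t y) in
    `|P h 0 + P (- h) 0 + P 0 h + P 0 (- h) - 4 * P 0 0 -
      h ^+ 2 * ((\sum_i e i * r i) ^+ 2 + (\sum_i e i * s i) ^+ 2) *
      Lap al ka nu (re_sum r s 0 0) (im_sum r s 0 0)| <= C * h ^+ 3.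
Proof.
move=> ka0 nu0.
pose T := (R * (('I_n -> R) * ('I_n -> R)))%type.
pose D (w : T) := [/\ 0 < w.1 <= 1, forall i, `|w.2.1 i| <= A i &
  forall i, `|w.2.2 i| <= A i].
have hD w : D w -> 0 < w.1 <= 1 by case.
have br i : bO (fun w : T => w.1) D 0 (fun w => w.2.1 i).
  by exists (A i) => w [_ rA _]; rewrite expr0 mulr1.
have bs i : bO (fun w : T => w.1) D 0 (fun w => w.2.2 i).
  by exists (A i) => w [_ _ sA]; rewrite expr0 mulr1.
have /(bO_pos hD)[C C0 HC] := bO_four_point_sum hD br bs al ka0 nu0.
by exists C => // r s h h01 rA sA; exact: (HC (h, (r, s))).
Qed.

End FourPointSum.

(** * Integration and characters on a compact group *)

Lemma cont_sum {R : realType} (G : topologicalType) (I : Type) (s : seq I) (P : pred I)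
    (F : I -> G -> R) :
  (forall i, continuous (F i)) -> continuous (fun x => \sum_(i <- s | P i) F i x).
Proof.
move=> cF; elim: s => [|i s IH].
  rewrite (_ : (fun _ => _) = cst 0); first by move=> x; exact: cvg_cst.
  by apply/funext => x; rewrite big_nil.
rewrite (_ : (fun _ => _) = fun x => (if P i then F i x else 0) +
    \sum_(j <- s | P j) F j x).
  move=> x; apply: cvgD; last exact: IH.
  by case: (P i); [exact: cF|exact: cvg_cst].
by apply/funext => x; rewrite big_cons; case: (P i); rewrite ?add0r.
Qed.

(* Locked, so that the comparison of two integrals does not unfold the integral. *)
HB.lock Definition gint {R : realType} {G : topologicalZmodType}
    (mu : probability (borel G) R) (f : G -> R) : R :=
  \int[mu]_(x in [set: borel G]) f x.
Arguments gint {R G} mu f.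

Lemma gintE {R : realType} {G : topologicalZmodType} (mu : probability (borel G) R)
  (f : G -> R) : gint mu f = \int[mu]_(x in [set: borel G]) f x.
Proof. by rewrite unlock. Qed.

Section HaarIntegral.
Context {R : realType} {G : topologicalZmodType} (mu : probability (borel G) R).
Hypothesis Gc : compact [set: G].
Hypothesis Gh : haar mu.
Implicit Types (f g : G -> R) (U : set G).

Local Notation gint := (gint mu).

Lemma open_borel U : open U -> measurable (U : set (borel G)).
Proof. by move=> oU; apply: sub_gen_smallest. Qed.

Lemma cont_measurable f : continuous f ->
  measurable_fun [set: borel G] (f : borel G -> R).
Proof.
move=> cf; apply: (measurability _ (measurable_realfun.RGenOpens.measurableE R)).
move=> _ [_ [a [b ->] <-]]; rewrite setTI.
apply: open_borel; exact: (open_comp (fun x _ => cf x) (interval_open _ _)).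
Qed.

Lemma cont_bounded f : continuous f -> exists2 M, 0 <= M & forall x, `|f x| <= M.
Proof.
move=> cf.
have cS : compact (f @` [set: G]).
  by apply: continuous_compact => //; exact: continuous_subspaceT.
have [M [Mr HM]] := compact_bounded cS.
exists (Num.max 0 (M + 1)); first by rewrite le_max lexx.
by move=> x; rewrite le_max; apply/orP; right; apply: HM; [lra|exists x].
Qed.

Lemma cont_integrable f : continuous f ->
  mu.-integrable [set: borel G] (fun x : borel G => (f x)%:E).
Proof.
move=> cf; have [M M0 HM] := cont_bounded cf.
apply: measurable_bounded_integrable => //.
- exact: (le_lt_trans (probability_le1 mu measurableT) (ltry 1)).
- exact: cont_measurable.
- exists M; split; first exact: num_real.
  by move=> z Mz x _ /=; rewrite (le_trans (HM x))// ltW.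
Qed.

Lemma gintD f g : continuous f -> continuous g ->
  gint (fun x => f x + g x) = gint f + gint g.
Proof. by move=> cf cg; rewrite !gintE RintegralD//; exact: cont_integrable. Qed.

Lemma gintB f g : continuous f -> continuous g ->
  gint (fun x => f x - g x) = gint f - gint g.
Proof. by move=> cf cg; rewrite !gintE RintegralB//; exact: cont_integrable. Qed.

Lemma gintZ f c : continuous f -> gint (fun x => c * f x) = c * gint f.
Proof. by move=> cf; rewrite !gintE RintegralZl//; exact: cont_integrable. Qed.

Lemma gint_cst c : gint (fun=> c) = c.
Proof.
rewrite !gintE Rintegral_cst// -[RHS]mulr1; congr (_ * _).
by rewrite -[RHS]/(fine 1%E); congr fine; exact: probability_setT.
Qed.

Lemma eq_gint f g : f =1 g -> gint f = gint g.
Proof. by move=> fg; congr gint; exact/funext. Qed.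

Lemma gint_sum n (F : 'I_n -> G -> R) : (forall i, continuous (F i)) ->
  gint (fun x => \sum_i F i x) = \sum_i gint (F i).
Proof.
elim: n F => [|n IH] F cF.
  by rewrite big_ord0 -[RHS](gint_cst 0); apply: eq_gint => x; rewrite big_ord0.
rewrite big_ord_recl -IH// -gintD//.
  by apply: eq_gint => x; rewrite big_ord_recl.
by apply: cont_sum => i; exact: cF.
Qed.

Lemma le_gint f g : continuous f -> continuous g -> (forall x, f x <= g x) ->
  gint f <= gint g.
Proof.
by move=> cf cg fg; rewrite !gintE; apply: le_Rintegral => //; exact: cont_integrable.
Qed.

Lemma gint_ge0 f : (forall x, 0 <= f x) -> 0 <= gint f.
Proof. by move=> f0; rewrite gintE; apply: Rintegral_ge0. Qed.

Lemma le_norm_gint f : continuous f -> `|gint f| <= gint (fun x => `|f x|).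
Proof. by move=> cf; rewrite !gintE; apply: le_normr_Rintegral => //; exact: cont_integrable. Qed.

Lemma shift_continuous (x : G) : continuous (fun y : G => x + y).
Proof.
move=> y; apply: (@continuous_comp _ _ _ (fun y => (x, y)) (fun z : G * G => z.1 + z.2)).
  by apply: cvg_pair => /=; [exact: cvg_cst|exact: cvg_id].
exact: add_continuous.
Qed.

Lemma shift_measurable (x : G) :
  measurable_fun [set: borel G] ((fun y : G => x + y) : borel G -> borel G).
Proof.
apply: (@measurability _ _ (borel G) (borel G) setT _ (@open (pointed_group G))) => //.
move=> _ [U oU <-]; rewrite setTI; apply: open_borel.
exact: (open_comp (fun y _ => @shift_continuous x y) oU).
Qed.

Lemma haar_preimage (x : G) (A : set (borel G)) : measurable A ->
  mu ((fun y : G => x + y) @^-1` A) = mu A.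
Proof.
move=> mA; rewrite -(Gh.1 (- x) A mA); congr (mu _).
apply/seteqP; split=> [y /= Ay|_ [y Ay <-]/=].
  by exists (x + y) => //; rewrite addKr.
by rewrite addNKr.
Qed.

Lemma gint_shift f x : continuous f -> gint (fun y => f (x + y)) = gint f.
Proof.
move=> cf; rewrite !gintE /Rintegral; congr fine.
have cfx : continuous (fun y => f (x + y)).
  by move=> y; exact: (continuous_comp (@shift_continuous x y) (cf _)).
have := @integral_pushforward _ _ (borel G) (borel G) R _ (shift_measurable x) mu
  setT (fun y : borel G => (f y)%:E) _ _ (measurableT).
rewrite preimage_setT => <-.
- apply: eq_measure_integral; first exact: shift_measurable.
  by move=> ? A mA _; exact: haar_preimage.
- by apply/measurable_EFinP; exact: cont_measurable.
- exact: (cont_integrable cfx).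
Qed.

(** By compactness finitely many translates of U cover the group; if U were null, so would be the
    whole group. *)
Lemma haar_open_gt0 U : open U -> U !=set0 -> (0 < mu (U : set (borel G)))%E.
Proof.
move=> oU [u Uu]; rewrite lt0e measure_ge0 andbT; apply/eqP => mU0.
have oV x : open ((fun y : G => x + y) @^-1` U).
  exact: (open_comp (fun y _ => @shift_continuous x y) oU).
have [F _ cov] : finite_subset_cover setT (fun x : G => (fun y => x + y) @^-1` U) setT.
  have cG : @cover_compact (pointed_group G) [set: G] :=
    eq_ind _ (fun P : set (set G) => P [set: G]) Gc _ (compact_cover (pointed_group G)).
  apply: cG => // y _.
  by exists (u - y) => //=; rewrite subrK.
pose Z (A : set (borel G)) := measurable A /\ (mu A <= 0)%E.
have ZU : Z (\big[setU/set0]_(x <- finmap.enum_fset F) ((fun y : G => x + y) @^-1` U)).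
  apply: big_ind; first by split => //; rewrite measure0.
    move=> A B [mA A0] [mB B0]; split; first exact: measurableU.
    apply: (le_trans (measureU2 _ mA mB)); rewrite -[leRHS]adde0.
    by apply: leeD; [exact: A0|exact: B0].
  move=> x _; split; first exact: open_borel.
  by rewrite haar_preimage ?mU0//; exact: open_borel.
have : (mu [set: borel G] <= 0)%E.
  apply: le_trans ZU.2; apply: le_measure; rewrite ?inE; [exact: measurableT|exact: ZU.1|].
  by move: cov; rewrite /cover bigcup_fset.
rewrite (_ : mu _ = 1%E); last exact: probability_setT.
by rewrite lee_fin ler10.
Qed.

End HaarIntegral.

Local Notation RE := complex.Re.
Local Notation IM := complex.Im.

Section ComplexModulus.
Context {R : realType}.
Implicit Types (z w : R[i]) (x y : R).

Lemma cabsE z : cabs z = Num.sqrt (RE z ^+ 2 + IM z ^+ 2).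
Proof. by case: z. Qed.

Lemma cabs_ge0 z : 0 <= cabs z. Proof. by rewrite cabsE sqrtr_ge0. Qed.

Lemma cabs_sqr z : cabs z ^+ 2 = RE z ^+ 2 + IM z ^+ 2.
Proof. by rewrite cabsE sqr_sqrtr// addr_ge0// sqr_ge0. Qed.

Lemma cabsM z w : cabs (z * w) = cabs z * cabs w.
Proof. exact: Normc.normcM. Qed.

Lemma cabsD z w : cabs (z + w) <= cabs z + cabs w.
Proof. exact: le_normcD. Qed.

Lemma cabs0 : cabs (0 : R[i]) = 0. Proof. exact: Normc.normc0. Qed.

Lemma cabs1 : cabs (1 : R[i]) = 1. Proof. exact: Normc.normc1. Qed.

Lemma cabsN z : cabs (- z) = cabs z.
Proof. by case: z => a b; rewrite !cabsE /= !sqrrN. Qed.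

Lemma conjCE z : z^* = conjc z. Proof. by []. Qed.

Lemma cabsJ z : cabs z^* = cabs z.
Proof. by rewrite conjCE; case: z => a b; rewrite !cabsE /= sqrrN. Qed.

Lemma cabs_real x : cabs x%:C%C = `|x|.
Proof. by rewrite cabsE /= expr0n /= addr0 sqrtr_sqr. Qed.

Lemma cabsB z w : cabs (z - w) = cabs (w - z).
Proof. by rewrite -cabsN opprB. Qed.

Lemma le_cabs_sub z w : cabs z - cabs w <= cabs (z - w).
Proof. by rewrite lerBlDr -{1}(subrK w z) cabsD. Qed.

Lemma dist_cabs z w : `|cabs z - cabs w| <= cabs (z - w).
Proof. by rewrite ler_norml le_cabs_sub lerNl opprB cabsB le_cabs_sub. Qed.

Lemma cabs_sum I (s : seq I) (P : pred I) (F : I -> R[i]) :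
  cabs (\sum_(i <- s | P i) F i) <= \sum_(i <- s | P i) cabs (F i).
Proof.
elim/big_ind2 : _ => //; first by rewrite cabs0.
by move=> z x w y zx wy; rewrite (le_trans (cabsD _ _))// lerD.
Qed.

Lemma Re_le_cabs z : `|RE z| <= cabs z.
Proof. by rewrite cabsE -sqrtr_sqr ler_wsqrtr// lerDl sqr_ge0. Qed.

Lemma Im_le_cabs z : `|IM z| <= cabs z.
Proof. by rewrite cabsE -sqrtr_sqr ler_wsqrtr// lerDr sqr_ge0. Qed.

Lemma cabs_le z : cabs z <= `|RE z| + `|IM z|.
Proof.
rewrite -[leRHS]ger0_norm ?addr_ge0// -[leRHS]sqrtr_sqr cabsE ler_wsqrtr//.
rewrite sqrrD !real_normK ?num_real// -addrA lerD2l lerDr.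
by rewrite mulrn_wge0// mulr_ge0.
Qed.

Lemma complexP z w : RE z = RE w -> IM z = IM w -> z = w.
Proof. by case: z w => a b [c d] /= -> ->. Qed.

Lemma cReD z w : RE (z + w) = RE z + RE w. Proof. by case: z w => a b []. Qed.
Lemma cImD z w : IM (z + w) = IM z + IM w. Proof. by case: z w => a b []. Qed.
Lemma cReN z : RE (- z) = - RE z. Proof. by case: z. Qed.
Lemma cImN z : IM (- z) = - IM z. Proof. by case: z. Qed.
Lemma cReB z w : RE (z - w) = RE z - RE w. Proof. by rewrite cReD cReN. Qed.
Lemma cImB z w : IM (z - w) = IM z - IM w. Proof. by rewrite cImD cImN. Qed.
Lemma cReM z w : RE (z * w) = RE z * RE w - IM z * IM w.
Proof. by case: z w => a b []. Qed.
Lemma cImM z w : IM (z * w) = RE z * IM w + IM z * RE w.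
Proof. by case: z w => a b []. Qed.
Lemma cReJ z : RE z^* = RE z. Proof. by rewrite conjCE; case: z. Qed.
Lemma cImJ z : IM z^* = - IM z. Proof. by rewrite conjCE; case: z. Qed.

Lemma cRe_sum I (s : seq I) (P : pred I) (F : I -> R[i]) :
  RE (\sum_(i <- s | P i) F i) = \sum_(i <- s | P i) RE (F i).
Proof. by elim/big_rec2: _ => // i x z _ <-; rewrite cReD. Qed.

Lemma cIm_sum I (s : seq I) (P : pred I) (F : I -> R[i]) :
  IM (\sum_(i <- s | P i) F i) = \sum_(i <- s | P i) IM (F i).
Proof. by elim/big_rec2: _ => // i x z _ <-; rewrite cImD. Qed.

Lemma mulJ z : z * z^* = (cabs z ^+ 2)%:C%C.
Proof.
rewrite cabs_sqr; apply: complexP; rewrite ?cReM ?cImM cReJ cImJ /=; ring.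
Qed.

Lemma cconjM z w : (z * w)^* = z^* * w^*.
Proof. by apply: complexP; rewrite ?(cReJ, cImJ, cReM, cImM); ring. Qed.

Lemma cconj_sum I (s : seq I) (P : pred I) (F : I -> R[i]) :
  (\sum_(i <- s | P i) F i)^* = \sum_(i <- s | P i) (F i)^*.
Proof.
by apply: complexP; rewrite ?(cReJ, cImJ) ?(cRe_sum, cIm_sum) -?sumrN;
  apply: eq_bigr => i _; rewrite ?(cReJ, cImJ).
Qed.

Lemma cis0 : cis (0 : R) = 1.
Proof. by rewrite /cis cos0 sin0. Qed.

Lemma cisD x y : cis (x + y) = cis x * cis y.
Proof. by apply: complexP; rewrite ?cReM ?cImM /= ?cosD ?sinD; ring. Qed.

Lemma cisJ x : (cis x)^* = cis (- x).
Proof. by rewrite conjCE /cis cosN sinN. Qed.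

Lemma conjK z : (z^*)^* = z. Proof. by apply: complexP; rewrite !(cReJ, cImJ) ?opprK. Qed.

Lemma conj_real x : (x%:C%C)^* = x%:C%C.
Proof. by apply: complexP; rewrite ?cReJ ?cImJ //= oppr0. Qed.

Lemma conj0 : (0 : R[i])^* = 0.
Proof. exact: conj_real 0. Qed.

End ComplexModulus.

Section ComplexIntegral.
Context {R : realType} {G : topologicalZmodType} (mu : probability (borel G) R).
Hypothesis Gc : compact [set: G].
Hypothesis Gh : haar mu.
Implicit Types (F H : G -> R[i]) (chi psi : G -> R[i]).

Definition ccont F := continuous (fun x => RE (F x)) /\ continuous (fun x => IM (F x)).

Definition cint F : R[i] :=
  (gint mu (fun x => RE (F x)) +i* gint mu (fun x => IM (F x)))%C.

Lemma ccont_cst (c : R[i]) : ccont (fun=> c).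
Proof. by split => x; exact: cvg_cst. Qed.

Lemma ccontD F H : ccont F -> ccont H -> ccont (fun x => F x + H x).
Proof.
move=> [F1 F2] [H1 H2]; split.
  rewrite (_ : (fun _ => _) = fun x => RE (F x) + RE (H x)).
    by move=> x; apply: cvgD; [exact: F1|exact: H1].
  by apply/funext => x /=; rewrite cReD.
rewrite (_ : (fun _ => _) = fun x => IM (F x) + IM (H x)).
  by move=> x; apply: cvgD; [exact: F2|exact: H2].
by apply/funext => x /=; rewrite cImD.
Qed.

Lemma ccontM F H : ccont F -> ccont H -> ccont (fun x => F x * H x).
Proof.
move=> [F1 F2] [H1 H2]; split.
  rewrite (_ : (fun _ => _) = fun x => RE (F x) * RE (H x) - IM (F x) * IM (H x)).
    by move=> x; apply: cvgB; apply: cvgM; [exact: F1|exact: H1|exact: F2|exact: H2].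
  by apply/funext => x /=; rewrite cReM.
rewrite (_ : (fun _ => _) = fun x => RE (F x) * IM (H x) + IM (F x) * RE (H x)).
  by move=> x; apply: cvgD; apply: cvgM; [exact: F1|exact: H2|exact: F2|exact: H1].
by apply/funext => x /=; rewrite cImM.
Qed.

Lemma ccontJ F : ccont F -> ccont (fun x => (F x)^*).
Proof.
move=> [F1 F2]; split.
  by rewrite (_ : (fun _ => _) = fun x => RE (F x))//; apply/funext => x /=; rewrite cReJ.
rewrite (_ : (fun _ => _) = fun x => - IM (F x)); first by move=> x; apply: cvgN; exact: F2.
by apply/funext => x /=; rewrite cImJ.
Qed.

Lemma ccont_sum n (F : 'I_n -> G -> R[i]) : (forall i, ccont (F i)) ->
  ccont (fun x => \sum_i F i x).
Proof.
move=> cF; split.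
  rewrite (_ : (fun _ => _) = fun x => \sum_i RE (F i x)).
    by apply: cont_sum => i; case: (cF i).
  by apply/funext => x /=; rewrite cRe_sum.
rewrite (_ : (fun _ => _) = fun x => \sum_i IM (F i x)).
  by apply: cont_sum => i; case: (cF i).
by apply/funext => x /=; rewrite cIm_sum.
Qed.

Lemma cont_cabs F : ccont F -> continuous (fun x => cabs (F x)).
Proof.
move=> [F1 F2] x.
rewrite (_ : (fun _ => _) = Num.sqrt \o (fun x => RE (F x) * RE (F x) + IM (F x) * IM (F x))).
  apply: continuous_comp; last exact: sqrt_continuous.
  by apply: cvgD; apply: cvgM; [exact: F1|exact: F1|exact: F2|exact: F2].
by apply/funext => y /=; rewrite cabsE !expr2.
Qed.

Lemma cintD F H : ccont F -> ccont H -> cint (fun x => F x + H x) = cint F + cint H.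
Proof.
move=> [F1 F2] [H1 H2]; apply: complexP; rewrite ?cReD ?cImD /= -gintD//;
by apply: eq_gint => x; rewrite ?cReD ?cImD.
Qed.

Lemma cintZ F (c : R[i]) : ccont F -> cint (fun x => c * F x) = c * cint F.
Proof.
move=> [F1 F2].
have cZ (a : R) (f : G -> R) : continuous f -> continuous (fun x => a * f x).
  by move=> cf x; apply: cvgM; [exact: cvg_cst|exact: cf].
apply: complexP; rewrite ?cReM ?cImM /= -!gintZ//.
  rewrite -gintB//; [|exact: cZ|exact: cZ].
  by apply: eq_gint => x; rewrite cReM.
rewrite -gintD//; [|exact: cZ|exact: cZ].
by apply: eq_gint => x; rewrite cImM.
Qed.

Lemma cint_cst (c : R[i]) : cint (fun=> c) = c.
Proof. by rewrite /cint !gint_cst; case: c. Qed.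

Lemma eq_cint F H : F =1 H -> cint F = cint H.
Proof. by move=> FH; congr cint; exact/funext. Qed.

Lemma cint_sum n (F : 'I_n -> G -> R[i]) : (forall i, ccont (F i)) ->
  cint (fun x => \sum_i F i x) = \sum_i cint (F i).
Proof.
move=> cF; apply: complexP; rewrite ?cRe_sum ?cIm_sum /= -gint_sum//;
  do ?[by move=> i; case: (cF i)];
  by apply: eq_gint => x; rewrite ?cRe_sum ?cIm_sum.
Qed.

Lemma cint_shift F x : ccont F -> cint (fun y => F (x + y)) = cint F.
Proof.
by move=> [F1 F2]; rewrite /cint (@gint_shift _ _ _ Gc Gh _ _ F1)
  (@gint_shift _ _ _ Gc Gh _ _ F2).
Qed.

Lemma cabs_cint F : ccont F -> cabs (cint F) <= gint mu (fun x => cabs (F x)).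
Proof.
move=> cF; have [->|I0] := eqVneq (cabs (cint F)) 0.
  by apply: gint_ge0 => x; exact: cabs_ge0.
have I1 : 0 < cabs (cint F) by rewrite lt0r I0 cabs_ge0.
rewrite -(ler_pM2l I1) -expr2.
have -> : cabs (cint F) ^+ 2 = RE ((cint F)^* * cint F) by rewrite mulrC mulJ.
rewrite -cintZ// -gintZ//; last exact: cont_cabs.
have cc : ccont (fun x => (cint F)^* * F x) by apply: ccontM => //; exact: ccont_cst.
apply: le_gint => //; first by case: cc.
  by move=> x; apply: cvgM; [exact: cvg_cst|exact: cont_cabs].
move=> x; rewrite -(cabsJ (cint F)) -cabsM.
exact: (le_trans (ler_norm _) (Re_le_cabs _)).
Qed.

Lemma char_ccont chi : character chi -> ccont chi.
Proof. by case. Qed.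

Lemma char0 chi : character chi -> chi 0 = 1.
Proof.
move=> [c1 cM _ _]; have := cM 0 0; rewrite addr0 => h.
have n0 : chi 0 != 0.
  by apply/eqP => e; move: (c1 0); rewrite e cabs0 => /eqP; rewrite eq_sym oner_eq0.
by apply: (mulfI n0); rewrite mulr1 -h.
Qed.

Lemma char_mulJ chi x : character chi -> chi x * (chi x)^* = 1.
Proof. by move=> [c1 _ _ _]; rewrite mulJ c1 expr1n. Qed.

Lemma charN chi x : character chi -> chi (- x) = (chi x)^*.
Proof.
move=> cc; have [c1 cM _ _] := cc.
have := cM x (- x); rewrite subrr char0// => h.
by rewrite -[RHS]mulr1 h mulrA [_^* * _]mulrC char_mulJ// mul1r.
Qed.

Lemma char_one : character (fun _ : G => 1 : R[i]).
Proof.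
split=> [x|x y||]; rewrite ?cabs1 ?mulr1//; move=> x; exact: cvg_cst.
Qed.

Lemma charMc chi psi : character chi -> character psi ->
  character (fun x => chi x * psi x).
Proof.
move=> cc cp; have [c1 cM _ _] := cc; have [p1 pM _ _] := cp.
have [h1 h2] := ccontM (char_ccont cc) (char_ccont cp); split=> // [x|x y].
  by rewrite cabsM c1 p1 mulr1.
by rewrite cM pM mulrACA.
Qed.

Lemma charJ chi : character chi -> character (fun x => (chi x)^*).
Proof.
move=> cc; have [c1 cM _ _] := cc.
have [h1 h2] := ccontJ (char_ccont cc); split=> // [x|x y].
  by rewrite cabsJ c1.
by rewrite cM cconjM.
Qed.

Lemma cint_char chi : character chi -> (exists x, chi x != 1) -> cint chi = 0.
Proof.
move=> cc [x nx]; have [c1 cM _ _] := cc.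
have := cint_shift x (char_ccont cc).
rewrite (eq_cint (H := fun y => chi x * chi y)) ?cintZ//; last exact: char_ccont.
move=> e; apply/eqP; have : (chi x - 1) * cint chi == 0.
  by rewrite mulrBl mul1r e subrr.
by rewrite mulf_eq0 subr_eq0 (negbTE nx).
Qed.

Lemma cint_charM chi psi : character chi -> character psi ->
  cint (fun x => chi x * (psi x)^*) = (chi == psi :> (G -> R[i]))%:R.
Proof.
move=> cc cp; have [->|neq] := eqVneq.
  by rewrite (eq_cint (H := fun=> 1)) ?cint_cst// => x; rewrite char_mulJ.
apply: cint_char; first by apply: charMc => //; exact: charJ.
apply: contrapT => /forallNP h; move/negP: neq; apply; apply/eqP/funext => x.
have /negP/negPn/eqP hx := h x.
by rewrite -[LHS]mulr1 -(char_mulJ x cp) mulrCA hx mulr1.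
Qed.

End ComplexIntegral.

(** * Mean values along superharmonic functions *)

Section MeanConcavity.
Context {R : realType}.

(** The increments d grow by at most eps per step, so d k <= d j + N eps for j < n <= k < N. Summing
    over all such pairs compares the mean slopes to the left and to the right of n. *)
Lemma almost_concave_seq (s : nat -> R) (eps : R) (n N : nat) : 0 <= eps ->
  (forall k, s k.+2 + s k - 2 * s k.+1 <= eps) -> (n <= N)%N ->
  n%:R * s N + (N - n)%:R * s 0%N <= N%:R * s n + n%:R * (N - n)%:R * N%:R * eps.
Proof.
move=> eps0 hs nN; pose d k := s k.+1 - s k.
have dS k j : d (j + k)%N <= d j + k%:R * eps.
  elim: k => [|k IH]; first by rewrite addn0 mul0r addr0.
  have := hs (j + k)%N; move: IH; rewrite addnS /d -natr1; lra.
have dle j k : (j <= k)%N -> (k < N)%N -> d k <= d j + N%:R * eps.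
  move=> jk kN; have := dS (k - j)%N j; rewrite subnKC// => /le_trans; apply.
  by rewrite lerD2l ler_wpM2r// ler_nat; apply: leq_trans (leq_subr _ _) (ltnW kN).
have s1 : \sum_(n <= k < N) d k = s N - s n by rewrite telescope_sumr.
have s0 : \sum_(0 <= j < n) d j = s n - s 0%N by rewrite telescope_sumr.
have key : \sum_(0 <= j < n) \sum_(n <= k < N) d k <=
    \sum_(0 <= j < n) \sum_(n <= k < N) (d j + N%:R * eps).
  rewrite !big_nat; apply: ler_sum => j /andP[_ jn].
  rewrite !big_nat; apply: ler_sum => k /andP[nk kN].
  by apply: dle => //; apply: leq_trans nk; exact: ltnW.
move: key; rewrite sumr_const_nat subn0 s1.
under eq_bigr do rewrite sumr_const_nat.
rewrite sumrMnl big_split /= sumr_const_nat subn0 s0.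
rewrite -(mulr_natl (s N - s n)) -(mulr_natl (N%:R * eps)) -(mulr_natl (_ + _)).
rewrite natrB// => key; lra.
Qed.

(** A bounded concave function on a half line is nondecreasing. The error C h^3 per second
    difference is of smaller order than h^2, so it disappears as the step h = y / n tends to 0. *)
Lemma almost_concave_le (m : R -> R) (C K : R) : 0 <= C ->
  (forall y h, 0 < h <= 1 -> h <= y -> m (y + h) + m (y - h) - 2 * m y <= C * h ^+ 3) ->
  (forall y, 0 <= y -> `|m y| <= K) ->
  forall y, 0 <= y -> m 0 <= m y.
Proof.
move=> C0 hm mK y; rewrite le_eqVlt => /predU1P[<-//|y0].
apply/ler_addgt0Pr => e e0.
have K0 : 0 <= K by apply: le_trans (mK 0 (lexx _)).
(* L y is the far end point of the chord that starts at 0: boundedness by K makes the contribution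
   of the far end at most 2 K / L <= e / 2. *)
pose L := (Num.trunc (4 * K / e)).+1.
have Lpos : (0 : R) < L%:R by rewrite ltr0n.
have hL : 2 * K / L%:R <= e / 2.
  rewrite ler_pdivrMr//; have := truncnS_gt (4 * K / e).
  rewrite -/L ltr_pdivrMr// => h; lra.
(* Chosen after L, because the accumulated error is of size C y^3 L / n; the summand y ensures that
   the step y / n is at most 1. *)
pose n := (Num.trunc (y + 2 * C * y ^+ 3 * L%:R / e)).+1.
have npos : (0 : R) < n%:R by rewrite ltr0n.
have hn := truncnS_gt (y + 2 * C * y ^+ 3 * L%:R / e).
rewrite -/n in hn.
have yn : y <= n%:R.
  by apply: ltW; apply: le_lt_trans hn; rewrite lerDl !mulr_ge0 ?invr_ge0 ?exprn_ge0// ltW.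
have hC : C * y ^+ 3 * L%:R / n%:R <= e / 2.
  rewrite ler_pdivrMr//.
  have : 2 * C * y ^+ 3 * L%:R / e < n%:R by apply: le_lt_trans hn; rewrite lerDr ltW.
  by rewrite ltr_pdivrMr// => h; lra.
pose h := y / n%:R.
have h0 : 0 < h by rewrite divr_gt0.
have h1 : h <= 1 by rewrite ler_pdivrMr// mul1r.
have [N NE] : {N : nat | N = (n * L)%N} by exists (n * L)%N.
have nN : (n <= N)%N by rewrite NE leq_pmulr.
have := @almost_concave_seq (fun k => m (k%:R * h)) (C * h ^+ 3) n N _ _ nN.
rewrite mul0r => H.
have {H} : n%:R * m (N%:R * h) + (N - n)%:R * m 0 <=
    N%:R * m (n%:R * h) + n%:R * (N - n)%:R * N%:R * (C * h ^+ 3).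
  apply: H; first by rewrite mulr_ge0// exprn_ge0// ltW.
  move=> k; have h01 : 0 < h <= 1 by rewrite h0 h1.
  have hk : h <= k.+1%:R * h by rewrite ler_peMl ?ler1n// ltW.
  have := hm _ _ h01 hk.
  have -> : k.+1%:R * h + h = k.+2%:R * h by rewrite -!natr1; ring.
  by have -> : k.+1%:R * h - h = k%:R * h by rewrite -!natr1; ring.
have -> : n%:R * h = y by rewrite /h mulrC divfK// gt_eqF.
have NR : N%:R = n%:R * L%:R :> R by rewrite NE natrM.
rewrite natrB// NR.
have mN := mK (n%:R * L%:R * h).
have {}mN : `|m (n%:R * L%:R * h)| <= K by apply: mN; rewrite !mulr_ge0// ltW.
have m0 := mK 0 (lexx _).
set M := m (n%:R * L%:R * h) in mN *.
have -> : n%:R * (n%:R * L%:R - n%:R) * (n%:R * L%:R) * (C * h ^+ 3) =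
   n%:R * (L%:R * (L%:R - 1) * C * y ^+ 3 / n%:R).
  by rewrite /h; field; rewrite gt_eqF.
have -> : n%:R * M + (n%:R * L%:R - n%:R) * m 0 = n%:R * (M + (L%:R - 1) * m 0) by ring.
have -> : n%:R * L%:R * m y + n%:R * (L%:R * (L%:R - 1) * C * y ^+ 3 / n%:R) =
  n%:R * (L%:R * m y + L%:R * (L%:R - 1) * C * y ^+ 3 / n%:R) by ring.
rewrite ler_pM2l// => H.
have hK : m 0 - M <= 2 * K.
  by move: mN m0; rewrite !ler_norml => /andP[? ?] /andP[? ?]; lra.
have h2 : L%:R * (L%:R - 1) * C * y ^+ 3 / n%:R <= L%:R * (e / 2).
  have -> : L%:R * (L%:R - 1) * C * y ^+ 3 / n%:R =
     (L%:R - 1) * (C * y ^+ 3 * L%:R / n%:R) by ring.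
  apply: (@le_trans _ _ (L%:R * (C * y ^+ 3 * L%:R / n%:R))); last by rewrite ler_pM2l.
  apply: ler_wpM2r; last by lra.
  by rewrite !mulr_ge0 ?invr_ge0 ?exprn_ge0// ltW.
have h3 : 2 * K <= L%:R * (e / 2) by move: hL; rewrite ler_pdivrMr// [e / 2 * _]mulrC.
rewrite -(ler_pM2l Lpos); lra.
Qed.

(* Discrete superharmonicity: along [F] analytic, the four-point second
   difference of [Gf \o F] is at most [O(h^3)]. *)
Definition supermean (Gf : R -> R -> R) := forall n (e A : 'I_n -> R),
  exists2 C, 0 <= C & forall (r s : 'I_n -> R) (h : R), 0 < h <= 1 ->
    (forall i, `|r i| <= A i) -> (forall i, `|s i| <= A i) ->
    let P t y := Gf (re_sum e r s t y) (im_sum e r s t y) in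
    P h 0 + P (- h) 0 + P 0 h + P 0 (- h) - 4 * P 0 0 <= C * h ^+ 3.

(** Joint continuity, tested on pairs of continuous functions: the form in which it is applied on
    the group. *)
Definition jcont (Gf : R -> R -> R) := forall (T : topologicalType) (f g : T -> R),
  continuous f -> continuous g -> continuous (fun x => Gf (f x) (g x)).

Lemma jcont_psi (al ka nu : R) : 0 <= ka -> 0 <= nu -> jcont (psi al ka nu).
Proof.
move=> ka0 nu0 T f g cf cg x; rewrite /psi.
have pos (u v : R) : 0 < 1 + (ka * u ^+ 2 + nu * v ^+ 2).
  by rewrite ltr_pwDl// addr_ge0// mulr_ge0// sqr_ge0.
have cQ : {for x, continuous (fun x => 1 + (ka * (f x * f x) + nu * (g x * g x)))}.
  apply: cvgD; first exact: cvg_cst.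
  apply: cvgD; apply: cvgM; try exact: cvg_cst.
    by apply: cvgM; exact: cf.
  by apply: cvgM; exact: cg.
rewrite (_ : (fun _ => _) = (fun z : R => z `^ al) \o
    (fun x => 1 + (ka * (f x * f x) + nu * (g x * g x)))).
  apply: continuous_comp => //; apply: differentiable_continuous.
  have := is_derive1_powR al (pos (f x) (g x)).
  by rewrite !expr2 => h; apply/derivable1_diffP; case: h.
by apply/funext => y /=; rewrite !expr2.
Qed.

(** In the four-point expansion the main term is h^2 |F'|^2 times the combination of Laplacians,
    which is nonpositive by hypothesis; only the cubic errors remain. Three summands are what the
    combination for p = 1 needs. *)
Lemma supermean_psi3 (c al ka nu : 'I_3 -> R) :
  (forall j, 0 <= ka j) -> (forall j, 0 <= nu j) ->
  (forall u v, \sum_j c j * Lap (al j) (ka j) (nu j) u v <= 0) ->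
  supermean (fun u v => \sum_j c j * psi (al j) (ka j) (nu j) u v).
Proof.
move=> ka0 nu0 Lap0 n e A.
have /choice[C HC] : forall j : 'I_3, exists C, 0 <= C /\ forall (r s : 'I_n -> R) (h : R),
    0 < h <= 1 -> (forall i, `|r i| <= A i) -> (forall i, `|s i| <= A i) ->
    let P t y := psi (al j) (ka j) (nu j) (re_sum e r s t y) (im_sum e r s t y) in
    `|P h 0 + P (- h) 0 + P 0 h + P 0 (- h) - 4 * P 0 0 -
      h ^+ 2 * ((\sum_i e i * r i) ^+ 2 + (\sum_i e i * s i) ^+ 2) *
      Lap (al j) (ka j) (nu j) (re_sum e r s 0 0) (im_sum e r s 0 0)| <= C * h ^+ 3.
  by move=> j; have [C C0 H] := four_point_sum e A (al j) (ka0 j) (nu0 j); exists C.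
exists (\sum_j `|c j| * C j).
  by apply: sumr_ge0 => j _; rewrite mulr_ge0//; case: (HC j).
move=> r s h h01 rA sA.
pose P t y := \sum_j c j * psi (al j) (ka j) (nu j) (re_sum e r s t y) (im_sum e r s t y).
suff : P h 0 + P (- h) 0 + P 0 h + P 0 (- h) - 4 * P 0 0 <=
  (\sum_j `|c j| * C j) * h ^+ 3 by [].
set Q := h ^+ 2 * ((\sum_i e i * r i) ^+ 2 + (\sum_i e i * s i) ^+ 2).
have Q0 : 0 <= Q by rewrite mulr_ge0 ?addr_ge0 ?sqr_ge0.
pose Pj j t y := psi (al j) (ka j) (nu j) (re_sum e r s t y) (im_sum e r s t y).
pose L j := Lap (al j) (ka j) (nu j) (re_sum e r s 0 0) (im_sum e r s 0 0).
have -> : P h 0 + P (- h) 0 + P 0 h + P 0 (- h) - 4 * P 0 0 =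
   \sum_j c j * (Pj j h 0 + Pj j (- h) 0 + Pj j 0 h + Pj j 0 (- h) - 4 * Pj j 0 0 - Q * L j)
   + Q * \sum_j c j * L j.
  rewrite /P /Pj !mulr_sumr -!big_split /= -sumrB.
  have alg (k x1 x2 x3 x4 x0 y z : R) : k * x1 + k * x2 + k * x3 + k * x4 - 4 * (k * x0) =
      k * (x1 + x2 + x3 + x4 - 4 * x0 - y * z) + y * (k * z) by ring.
  by apply: eq_bigr => j _; exact: alg.
have h2 : Q * \sum_j c j * L j <= 0 by rewrite mulr_ge0_le0// Lap0.
rewrite -[leRHS]addr0; apply: lerD => //; rewrite mulr_suml; apply: ler_sum => j _.
apply: (le_trans (ler_norm _)); rewrite normrM -mulrA ler_wpM2l//.
by have [_ H] := HC j; exact: H.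
Qed.

End MeanConcavity.

Definition lbdd {R : realType} (Gf : R -> R -> R) := forall M, exists K, forall u v,
  `|u| <= M -> `|v| <= M -> `|Gf u v| <= K.

Lemma lbdd_psi {R : realType} (al ka nu : R) : 0 <= ka -> 0 <= nu ->
  lbdd (psi al ka nu).
Proof.
move=> ka0 nu0 M; exists ((1 + (ka * M ^+ 2 + nu * M ^+ 2)) `^ `|al|) => u v uM vM.
have sq (x : R) : `|x| <= M -> x ^+ 2 <= M ^+ 2.
  by move=> xM; rewrite -(@real_normK _ x) ?num_real// lerXn2r ?nnegrE// (le_trans _ xM).
have pos (x y : R) : 0 <= ka * x ^+ 2 + nu * y ^+ 2.
  by rewrite addr_ge0// mulr_ge0// sqr_ge0.
rewrite /psi ger0_norm ?powR_ge0//.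
apply: (@le_trans _ _ ((1 + (ka * u ^+ 2 + nu * v ^+ 2)) `^ `|al|)).
  by apply: ler_powR; [rewrite lerDl|exact: ler_norm].
apply: ge0_ler_powR; [by []|by rewrite nnegrE addr_ge0|by rewrite nnegrE addr_ge0|].
rewrite lerD2l; by apply: lerD; apply: ler_wpM2l => //; exact: sq.
Qed.

(* Locked, as otherwise comparing two values at different heights unfolds the
   exponential. *)
HB.lock Definition apoly {R : realType} {G : Type} n (a : 'I_n -> R[i]) (e : 'I_n -> R)
    (chi : 'I_n -> G -> R[i]) (y : R) (x : G) : R[i] :=
  \sum_i a i * (expR (- (e i * y)))%:C%C * chi i x.

Arguments apoly {R G n} a e chi y x.

Lemma apolyE {R : realType} {G : Type} n (a : 'I_n -> R[i]) (e : 'I_n -> R)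
    (chi : 'I_n -> G -> R[i]) (y : R) (x : G) :
  apoly a e chi y x = \sum_i a i * (expR (- (e i * y)))%:C%C * chi i x.
Proof. by rewrite unlock. Qed.

Section AnalyticPolynomial.
Context {R : realType} {G : topologicalZmodType} (mu : probability (borel G) R).
Hypothesis Gc : compact [set: G].
Hypothesis Gh : haar mu.
Variables (beta : R -> G) (n : nat).
Variables (a : 'I_n -> R[i]) (e : 'I_n -> R) (chi : 'I_n -> G -> R[i]).
Hypothesis e0 : forall i, 0 <= e i.
Hypothesis chi_cont : forall i, ccont (chi i).
Hypothesis chi1 : forall i x, cabs (chi i x) = 1.
Hypothesis chi_shift : forall i x t, chi i (x + beta t) = cis (- (e i * t)) * chi i x.

Local Notation apoly := (apoly a e chi).

Let c y x i := a i * (expR (- (e i * y)))%:C%C * chi i x.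

Lemma apoly_cont y : ccont (apoly y).
Proof.
rewrite (_ : apoly y = fun x => \sum_i a i * (expR (- (e i * y)))%:C%C * chi i x).
  by apply: ccont_sum => i; apply: ccontM => //; exact: ccont_cst.
by apply/funext => x; rewrite apolyE.
Qed.

Let apoly_parts y x t y' :
  complex.Re (apoly (y + y') (x + beta t)) =
    re_sum e (fun i => complex.Re (c y x i)) (fun i => complex.Im (c y x i)) t y' /\
  complex.Im (apoly (y + y') (x + beta t)) =
    im_sum e (fun i => complex.Re (c y x i)) (fun i => complex.Im (c y x i)) t y'.
Proof.
rewrite !apolyE cRe_sum cIm_sum; split; apply: eq_bigr => i _;
  rewrite chi_shift mulrDr opprD expRD /c !(cReM, cImM) /= cosN sinN; ring.
Qed.

Lemma cabs_apoly_le y x : 0 <= y -> cabs (apoly y x) <= \sum_i cabs (a i).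
Proof.
move=> y0; rewrite apolyE; apply: (le_trans (cabs_sum _ _ _)); apply: ler_sum => i _.
rewrite !cabsM chi1 mulr1 cabs_real ger0_norm ?expR_ge0//.
by rewrite ler_piMr ?cabs_ge0// -expR0 ler_expR oppr_le0 mulr_ge0.
Qed.

Section Mean.
Variable Gf : R -> R -> R.
Hypothesis Gf_cont : jcont Gf.
Hypothesis Gf_bdd : lbdd Gf.
Hypothesis Gf_super : supermean Gf.

Let g y x := Gf (complex.Re (apoly y x)) (complex.Im (apoly y x)).

Let g_cont y : continuous (g y).
Proof. by have [c1 c2] := apoly_cont y; exact: Gf_cont. Qed.

(** In the four-point inequality the displacements by [beta h] and [beta (- h)] leave the Haar mean
    unchanged. Integration turns it into a bound on the second difference in the height y, and
    boundedness gives monotonicity. *)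
Lemma mean_apoly_le y : 0 <= y -> gint mu (g 0) <= gint mu (g y).
Proof.
move: y; have [C C0 HC] := Gf_super e (fun i => cabs (a i)).
have [K HK] := Gf_bdd (\sum_i cabs (a i)).
apply: (@almost_concave_le _ (fun y => gint mu (g y)) C K C0).
  move=> y h /[dup] h01 /andP[h0 h1] hy.
  have y0 : 0 <= y by apply: le_trans hy; exact: ltW.
  (* Around the point x at height y the polynomial is a finite exponential sum with coefficients
     [c y x], to which [supermean] applies. *)
  have csum x t y' : Gf (re_sum e (fun i => complex.Re (c y x i)) (fun i => complex.Im (c y x i)) t y')
    (im_sum e (fun i => complex.Re (c y x i)) (fun i => complex.Im (c y x i)) t y') =
      g (y + y') (x + beta t).
    by have [h2 h3] := apoly_parts y x t y'; rewrite /g h2 h3.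
  (* The bound is the same at all points and all nonnegative heights, hence so is the constant C. *)
  have cA x i : cabs (c y x i) <= cabs (a i).
    rewrite !cabsM chi1 mulr1 cabs_real ger0_norm ?expR_ge0//.
    by rewrite ler_piMr ?cabs_ge0// -expR0 ler_expR oppr_le0 mulr_ge0.
  have beta0 z x : g z (x + beta 0) = g z x.
    rewrite /g !apolyE; congr (Gf (complex.Re _) (complex.Im _));
    apply: eq_bigr => i _; by rewrite chi_shift mulr0 oppr0 cis0 mul1r.
  have pw x : g y (beta h + x) + g y (beta (- h) + x) + g (y + h) x + g (y - h) x
      <= 4 * g y x + C * h ^+ 3.
    have := HC (fun i => complex.Re (c y x i)) (fun i => complex.Im (c y x i)) h h01
      (fun i => le_trans (Re_le_cabs _) (cA x i)) (fun i => le_trans (Im_le_cabs _) (cA x i)).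
    cbv beta zeta; by rewrite !csum !addr0 !beta0 -lerBlDl !(addrC (beta _)).
  have cs t : continuous (fun x => g y (beta t + x)).
    by move=> x; exact: (continuous_comp (@shift_continuous _ (beta t) x) (@g_cont y _)).
  have cD (f1 f2 : G -> R) : continuous f1 -> continuous f2 ->
      continuous (fun x => f1 x + f2 x).
    by move=> c1 c2 x; apply: cvgD; [exact: c1|exact: c2].
  have c4 : continuous (fun x => 4 * g y x).
    by move=> x; apply: cvgM; [exact: cvg_cst|exact: g_cont].
  have cc : continuous (fun _ : G => C * h ^+ 3) by move=> x; exact: cvg_cst.
  have c2 := cD _ _ (cs h) (cs (- h)).
  have c3 := cD _ _ c2 (@g_cont (y + h)).
  have := le_gint mu Gc (cD _ _ c3 (@g_cont (y - h))) (cD _ _ c4 cc) pw.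
  rewrite !gintD//.
  rewrite gintZ// gint_cst !(gint_shift Gc Gh)//; lra.
move=> {}y y0; have h1 := le_norm_gint mu Gc (@g_cont y).
have h2 : gint mu (fun x => `|g y x|) <= gint mu (fun=> K).
apply: le_gint => //.
- by move=> x; apply: cvg_norm; exact: g_cont.
- by move=> x; exact: cvg_cst.
- move=> x; apply: HK; apply: le_trans (cabs_apoly_le x y0).
    exact: Re_le_cabs.
  exact: Im_le_cabs.
by apply: (le_trans h1); rewrite (le_trans h2)// gint_cst.
Qed.

End Mean.
End AnalyticPolynomial.

(** * Norms and contraction *)

Section Norms.
Context {R : realType} {G : topologicalZmodType} (mu : probability (borel G) R).
Hypothesis Gc : compact [set: G].
Hypothesis Gh : haar mu.
Implicit Types (f g : G -> R) (F H : G -> R[i]) (q : \bar R) (r : R).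

Definition rnrm q f : R := match q with
  | r%:E => (gint mu (fun x => `|f x| `^ r)) `^ r^-1
  | _ => sup (range (fun x => `|f x|))
  end.

Lemma powR_cont r f : 0 < r -> continuous f -> continuous (fun x => `|f x| `^ r).
Proof.
move=> r0 cf x.
have cn : {for x, continuous (fun x => `|f x|)} by apply: cvg_norm; exact: cf.
have [fx0|fx0] := eqVneq (f x) 0; last first.
  rewrite (_ : (fun _ => _) = (fun z : R => z `^ r) \o (fun x => `|f x|))//.
  apply: continuous_comp => //; apply: differentiable_continuous.
  have fx : 0 < `|f x| by rewrite normr_gt0.
  by have h := is_derive1_powR r fx; apply/derivable1_diffP; case: h.
rewrite /continuous_at fx0 normr0 powR0 ?gt_eqF//.
apply/cvgrPdist_lt => e e0; near=> z.
have zs : `|f z| < e `^ r^-1.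
  near: z; move/cvgrPdist_lt : (cf x) => /(_ (e `^ r^-1)); rewrite powR_gt0// => /(_ isT).
  by apply: filterS => z; rewrite fx0 sub0r normrN.
rewrite sub0r normrN ger0_norm ?powR_ge0//.
have := gt0_ltr_powR r0 _ _ zs; rewrite !nnegrE normr_ge0 powR_ge0 => /(_ isT isT).
by rewrite -powRrM mulVf ?gt_eqF// powRr1// ltW.
Unshelve. all: by end_near. Qed.

Lemma abs_le_sup f x : continuous f -> `|f x| <= sup (range (fun x => `|f x|)).
Proof.
move=> cf; have [M M0 HM] := cont_bounded Gc cf.
by apply: ub_le_sup; [exists M => _ [y _ <-]|exists x].
Qed.

Lemma sup_abs_le f M : (forall x, `|f x| <= M) -> sup (range (fun x => `|f x|)) <= M.
Proof.
by move=> HM; apply: ge_sup; [exists `|f 0|; exists 0|move=> _ [y _ <-]].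
Qed.

Lemma probT_gt0 : (0 < mu [set: borel G])%E.
Proof. by have e : mu [set: borel G] = 1%E := probability_setT mu; rewrite e lte01. Qed.

(** For q infinite the essential supremum of a continuous function is its supremum: the set where
    |f| exceeds a smaller value is open and nonempty, so it has positive Haar measure. *)
Lemma Lnorm_rnrm q f : (1 <= q)%E -> continuous f ->
  Lnorm mu q (fun x : borel G => (f x)%:E) = (rnrm q f)%:E.
Proof.
rewrite unlock; case: q => [r|_|//] /=.
  rewrite lee_fin => r1 cf; have r0 : 0 < r by apply: lt_le_trans r1.
  rewrite -poweR_EFin; congr (_ `^ _)%E.
  rewrite gintE /Rintegral fineK//.
  exact: integrable_fin_num (cont_integrable mu Gc (powR_cont r0 cf)).
move=> cf.
rewrite ifT; last exact: probT_gt0.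
set g := (_ \o _); have gE x : g x = (`|f x|)%:E by [].
have ca : continuous (fun x => `|f x|) by move=> x; apply: cvg_norm; exact: cf.
have mg : measurable_fun [set: borel G] (g : borel G -> \bar R).
  by apply/measurable_EFinP; exact: cont_measurable.
set S := sup _.
have leS : (ess_sup mu g <= S%:E)%E.
  by apply/ess_supP; apply: nearW => x; rewrite gE lee_fin abs_le_sup.
apply/eqP; rewrite eq_le leS/=; rewrite leNgt; apply/negP => ltS.
have ge0 : (0 <= ess_sup mu g)%E.
  by apply: ess_sup_gee; [exact: probT_gt0|apply: nearW => x; rewrite gE lee_fin].
case E : (ess_sup mu g) ltS ge0 => [y| |] //; rewrite lte_fin lee_fin => yS y0.
have [x yx] : exists x, y < `|f x|.
  have [|_ [x _ <-] yx] := @sup_gt R (range (fun x => `|f x|)) y _ yS.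
    by exists `|f 0|; exists 0.
  by exists x.
pose U := [set x : G | y < `|f x|].
have oU : open U by exact: (open_comp (fun x _ => ca x) (@open_gt _ y)).
have := haar_open_gt0 Gc Gh oU (ex_intro _ x yx).
have := (@ae_le_measureP _ (borel G) R mu g y%:E mg).1.
have Ey : (ess_sup mu g <= y%:E)%E by rewrite E.
move/ess_supP : Ey => Ey /(_ Ey).
rewrite (_ : g @^-1` _ = U) => [->|]; first by rewrite ltxx.
by apply/seteqP; split => z; rewrite /= in_itv/= andbT gE lte_fin.
Qed.

Lemma rnrm_ge0 q f : continuous f -> 0 <= rnrm q f.
Proof.
by move=> cf; case: q => [r| |]; rewrite /rnrm ?powR_ge0//;
  apply: le_trans (abs_le_sup 0 cf).
Qed.

Lemma rnrm_pow r f : 0 < r -> rnrm r%:E f `^ r = gint mu (fun x => `|f x| `^ r).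
Proof.
move=> r0; rewrite /rnrm -powRrM mulVf ?gt_eqF// powRr1//.
by apply: gint_ge0 => x; rewrite powR_ge0.
Qed.

Lemma le_rnrm q f g : (1 <= q)%E -> continuous f -> continuous g ->
  (forall x, `|f x| <= `|g x|) -> rnrm q f <= rnrm q g.
Proof.
case: q => [r|_|//] /=; last first.
  by move=> cf cg fg; apply: sup_abs_le => x; apply: (le_trans (fg x)); exact: abs_le_sup.
rewrite lee_fin => r1 cf cg fg; have r0 : 0 < r by apply: lt_le_trans r1.
have pos h : 0 <= gint mu (fun x => `|h x| `^ r).
  by apply: gint_ge0 => x; rewrite powR_ge0.
apply: ge0_ler_powR; rewrite ?nnegrE ?invr_ge0 ?pos ?(ltW r0)//.
apply: le_gint => //; [exact: powR_cont|exact: powR_cont|] => x.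
by apply: ge0_ler_powR; rewrite ?nnegrE// ltW.
Qed.

Lemma rnrmD q f g : (1 <= q)%E -> continuous f -> continuous g ->
  rnrm q (fun x => f x + g x) <= rnrm q f + rnrm q g.
Proof.
move=> q1 cf cg; have cfg : continuous (fun x => f x + g x).
  by move=> x; apply: cvgD; [exact: cf|exact: cg].
have := @eminkowski _ (borel G) R mu f g q (cont_measurable cf) (cont_measurable cg) q1.
rewrite (Lnorm_rnrm q1 cf) (Lnorm_rnrm q1 cg).
by rewrite (_ : Lnorm mu q _ = (rnrm q (fun x => f x + g x))%:E) ?lee_fin// -Lnorm_rnrm.
Qed.

Lemma rnrmZ q f c : (1 <= q)%E -> continuous f ->
  rnrm q (fun x => c * f x) = `|c| * rnrm q f.
Proof.
move=> q1 cf; have q0 : (0 <= q)%E by apply: le_trans q1.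
case: q q1 {q0} => [r|_|//] /=.
  rewrite lee_fin => r1; have r0 : 0 < r by apply: lt_le_trans r1.
  rewrite (@eq_gint _ _ mu _ (fun x => `|c| `^ r * `|f x| `^ r)); last first.
    by move=> x; rewrite normrM powRM.
  rewrite gintZ//; last exact: powR_cont.
  rewrite powRM ?powR_ge0//; last by apply: gint_ge0 => x; rewrite powR_ge0.
  by rewrite -powRrM divff ?gt_eqF// powRr1.
have cZ d g : continuous g -> continuous (fun x => d * g x).
  by move=> cg x; apply: cvgM; [exact: cvg_cst|exact: cg].
have [->|c0] := eqVneq c 0.
  rewrite normr0 mul0r; apply/eqP; rewrite eq_le (rnrm_ge0 +oo (cZ _ _ cf)) andbT.
  by apply: sup_abs_le => x; rewrite mul0r normr0.
apply/eqP; rewrite eq_le; apply/andP; split.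
  by apply: sup_abs_le => x; rewrite normrM ler_wpM2l// abs_le_sup.
rewrite -ler_pdivlMl ?normr_gt0//; apply: sup_abs_le => x.
by rewrite ler_pdivlMl ?normr_gt0// -normrM; exact: (abs_le_sup x (cZ _ _ cf)).
Qed.

Lemma rnrm_cst q c : (1 <= q)%E -> rnrm q (fun=> c) = `|c|.
Proof.
case: q => [r|_|//] /=.
  rewrite lee_fin => r1; have r0 : 0 < r by apply: lt_le_trans r1.
  by rewrite gint_cst -powRrM divff ?gt_eqF// powRr1.
apply/eqP; rewrite eq_le; apply/andP; split; first by apply: sup_abs_le.
by apply: (@abs_le_sup (fun=> c) 0) => x; exact: cvg_cst.
Qed.

Lemma rnrm_le q f B : (1 <= q)%E -> continuous f -> 0 <= B ->
  (forall x, `|f x| <= B) -> rnrm q f <= B.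
Proof.
move=> q1 cf B0 fB; rewrite -(ger0_norm B0) -(rnrm_cst B q1).
apply: le_rnrm => //; first by move=> x; exact: cvg_cst.
by move=> x; rewrite (ger0_norm B0).
Qed.

Lemma gint_gt0 f x : continuous f -> (forall y, 0 <= f y) -> 0 < f x -> 0 < gint mu f.
Proof.
move=> cf f0 fx; rewrite lt0r gint_ge0// andbT; apply/eqP => I0.
pose U := [set y : G | 0 < f y].
have oU : open U by exact: (open_comp (fun y _ => cf y) (@open_gt _ 0)).
have := haar_open_gt0 Gc Gh oU (ex_intro _ x fx).
have mf : measurable_fun [set: borel G] (fun y : borel G => (f y)%:E).
  by apply/measurable_EFinP; exact: cont_measurable.
have := (@ae_eq_integral_abs _ (borel G) R mu setT measurableT _ mf).1.
have -> : (\int[mu]_(y in [set: borel G]) `|(f y)%:E| = 0)%E.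
  under eq_integral => y _ do rewrite gee0_abs ?lee_fin ?f0//.
  rewrite -[LHS]fineK; last exact: integrable_fin_num (cont_integrable mu Gc cf).
  by congr (_%:E); rewrite -[RHS]I0 gintE.
move=> /(_ erefl) [N [mN N0 UN]].
have : (mu (U : set (borel G)) <= mu N)%E.
  apply: le_measure; rewrite ?inE//; first exact: open_borel.
  by move=> y Uy; apply: UN => /= /(_ I) /eqP; rewrite eqe gt_eqF.
by rewrite N0 leNgt => /negP.
Qed.

(** If |f| exceeded some c > B at a point, its n-th moment would be at least d c^n with a fixed d >
    0. It is at most B^n, which is impossible for large n. *)
Lemma rnrm_large f B : continuous f -> 0 <= B ->
  (forall n, rnrm n.+1%:R%:E f <= B) -> rnrm +oo f <= B.
Proof.
move=> cf B0 HB; apply: sup_abs_le => x; rewrite leNgt; apply/negP => Bx.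
pose c := (B + `|f x|) / 2.
have Bc : B < c by rewrite /c; lra.
have cx : c < `|f x| by rewrite /c; lra.
have c0 : 0 < c by apply: le_lt_trans Bc.
have ca : continuous (fun y => `|f y|) by move=> y; apply: cvg_norm; exact: cf.
(* The positive part of |f| - c, a continuous stand-in for the indicator of the set where |f| >
   c. *)
pose w y := (`|f y| - c + `| `|f y| - c |) / 2.
have cw : continuous w.
  move=> y; apply: cvgM; last exact: cvg_cst.
  have h : `|f z| - c @[z --> y] --> `|f y| - c by apply: cvgB; [exact: ca|exact: cvg_cst].
  by apply: cvgD => //; exact: cvg_norm.
have wE y : w y = if `|f y| <= c then 0 else `|f y| - c.
  rewrite /w; case: ifP => [fc|/negbT].
    have h : `|f y| - c <= 0 by lra.
    by rewrite (ler0_norm h); lra.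
  rewrite -ltNge => fc; have h : 0 <= `|f y| - c by lra.
  by rewrite (ger0_norm h); lra.
have w0 y : 0 <= w y.
  by rewrite wE; case: ifP => [_|/negbT]; rewrite ?lexx -?ltNge => // h; lra.
have wx : 0 < w x by rewrite wE leNgt cx/=; lra.
have [K K0 HK] := cont_bounded Gc cw.
pose d := gint mu w / (K + 1).
have d0 : 0 < d by rewrite divr_gt0 ?(gint_gt0 cw w0 wx)//; lra.
have key n : d <= (B / c) ^+ n.+1.
  have r0 : (0 : R) < n.+1%:R by rewrite ltr0n.
  have h1 : gint mu (fun y => `|f y| `^ n.+1%:R) <= B ^+ n.+1.
    rewrite -rnrm_pow// powR_mulrn; last exact: rnrm_ge0.
    by rewrite lerXn2r// ?nnegrE ?rnrm_ge0.
  rewrite expr_div_n ler_pdivlMr ?exprn_gt0//.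
  have <- : gint mu (fun y => c ^+ n.+1 / (K + 1) * w y) = d * c ^+ n.+1.
    by rewrite gintZ// /d; ring.
  apply: le_trans h1; apply: le_gint => //.
    - by move=> y; apply: cvgM; [exact: cvg_cst|exact: cw].
    - exact: powR_cont.
    - move=> y; rewrite powR_mulrn// wE; case: ifP => [_|nfc].
        by rewrite mulr0 exprn_ge0.
      have fc : c < `|f y| by rewrite ltNge nfc.
      have := HK y; rewrite wE nfc => h2.
      rewrite -mulrA -[leRHS]mulr1; apply: ler_pM.
      + by rewrite exprn_ge0// ltW.
      + by rewrite mulr_ge0 ?invr_ge0; lra.
      + by rewrite lerXn2r// ?nnegrE// ltW.
      + rewrite mulrC ler_pdivrMr; last by lra.
        by move: h2; rewrite ger0_norm; lra.
have Bc1 : `|B / c| < 1.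
  have Bc0 : 0 <= B / c by rewrite divr_ge0// ltW.
  by rewrite (ger0_norm Bc0) ltr_pdivrMr// mul1r.
have /cvgrPdist_lt /(_ d d0) [m _ Hm] := cvg_expr Bc1.
have := Hm m.+1 (leqnSn m); rewrite sub0r normrN ger0_norm ?exprn_ge0 ?divr_ge0 ?(ltW c0)//.
  by rewrite ltNge key.
by rewrite addr_ge0.
Qed.

Definition nrm q F := rnrm q (fun x => cabs (F x)).

Lemma Lnorm_nrm q F : (1 <= q)%E -> ccont F ->
  Lnorm mu q (fun x : borel G => (cabs (F x))%:E) = (nrm q F)%:E.
Proof. by move=> q1 cF; apply: Lnorm_rnrm => //; exact: cont_cabs. Qed.

Lemma nrm_ge0 q F : ccont F -> 0 <= nrm q F.
Proof. by move=> cF; apply: rnrm_ge0; exact: cont_cabs. Qed.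

Lemma eq_nrm q F H : (forall x, cabs (F x) = cabs (H x)) -> nrm q F = nrm q H.
Proof. by move=> FH; congr rnrm; apply/funext. Qed.

Lemma nrmD q F H : (1 <= q)%E -> ccont F -> ccont H ->
  nrm q (fun x => F x + H x) <= nrm q F + nrm q H.
Proof.
move=> q1 cF cH; apply: (@le_trans _ _ (rnrm q (fun x => cabs (F x) + cabs (H x)))).
  apply: le_rnrm => //; first by apply: cont_cabs; exact: ccontD.
    by move=> x; apply: cvgD; exact: cont_cabs.
  by move=> x; rewrite !ger0_norm ?addr_ge0 ?cabs_ge0// cabsD.
by apply: rnrmD => //; exact: cont_cabs.
Qed.

Lemma nrmZ q F (c : R[i]) : (1 <= q)%E -> ccont F ->
  nrm q (fun x => c * F x) = cabs c * nrm q F.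
Proof.
move=> q1 cF; rewrite /nrm -[in RHS](ger0_norm (cabs_ge0 c)) -rnrmZ//; last exact: cont_cabs.
by congr rnrm; apply/funext => x; rewrite cabsM.
Qed.

Lemma nrmB q F H : (1 <= q)%E -> ccont F -> ccont H ->
  nrm q (fun x => F x - H x) <= nrm q F + nrm q H.
Proof.
move=> q1 cF cH; have cN : ccont (fun x => - H x).
  rewrite (_ : (fun _ => _) = fun x => - 1 * H x); last by apply/funext => x; rewrite mulN1r.
  by apply: ccontM => //; exact: ccont_cst.
apply: (le_trans (nrmD q1 cF cN)); rewrite lerD2l.
by rewrite (_ : nrm q (fun x => - H x) = nrm q H)//; apply: eq_nrm => x; rewrite cabsN.
Qed.

Lemma nrm_le q F B : (1 <= q)%E -> ccont F -> (forall x, cabs (F x) <= B) -> nrm q F <= B.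
Proof.
move=> q1 cF FB; apply: rnrm_le => //; first exact: cont_cabs.
  exact: le_trans (cabs_ge0 _) (FB 0).
by move=> x; rewrite ger0_norm ?cabs_ge0.
Qed.

Lemma nrm_sum q n (F : 'I_n -> G -> R[i]) : (1 <= q)%E -> (forall i, ccont (F i)) ->
  nrm q (fun x => \sum_i F i x) <= \sum_i nrm q (F i).
Proof.
move=> q1; elim: n F => [|n IH] F cF.
  rewrite big_ord0; apply: nrm_le => //.
    rewrite (_ : (fun _ => _) = fun=> 0); first exact: ccont_cst.
    by apply/funext => x; rewrite big_ord0.
  by move=> x; rewrite big_ord0 cabs0.
rewrite big_ord_recr; rewrite (_ : (fun _ => _) =
    fun x => \sum_(i < n) F (widen_ord (leqnSn n) i) x + F ord_max x); last first.
  by apply/funext => x; rewrite big_ord_recr.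
apply: (le_trans (nrmD q1 _ _)) => //; first by apply: ccont_sum.
by rewrite lerD2r IH.
Qed.

Lemma nrm_pow r F : 0 < r -> nrm r%:E F `^ r = gint mu (fun x => cabs (F x) `^ r).
Proof.
move=> r0; rewrite rnrm_pow//; apply: eq_gint => x; by rewrite ger0_norm// cabs_ge0.
Qed.

Lemma cabs_le_nrmy F x : ccont F -> cabs (F x) <= nrm +oo F.
Proof.
move=> cF; have := abs_le_sup x (cont_cabs cF); by rewrite ger0_norm ?cabs_ge0.
Qed.

End Norms.

(** * Riesz projections *)

Section Laplacians.
Context {R : realType}.
Implicit Types (al u v x K r p : R).

Lemma powR_pred x al : 0 < x -> x `^ (al - 1) = x * x `^ (al - 2).
Proof.
move=> x0; rewrite (_ : al - 1 = 1 + (al - 2)); last by ring.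
have h : (1 + (al - 2) == 0) ==> (x != 0) by apply/implyP => _; rewrite gt_eqF.
by rewrite (powRD h) powRr1// ltW.
Qed.

Lemma Lap11E al u v : Lap al 1 1 u v =
  4 * al * (1 + al * (u ^+ 2 + v ^+ 2)) * (1 + (u ^+ 2 + v ^+ 2)) `^ (al - 2).
Proof.
have Q0 : 0 < 1 + (u ^+ 2 + v ^+ 2) by rewrite ltr_pwDl// addr_ge0 ?sqr_ge0.
by rewrite /Lap !expr1n !mul1r powR_pred//; ring.
Qed.

Lemma Lap10E al u v : Lap al 1 0 u v =
  2 * al * (1 + (2 * al - 1) * u ^+ 2) * (1 + u ^+ 2) `^ (al - 2).
Proof.
have Q0 : 0 < 1 + u ^+ 2 by rewrite ltr_pwDl// sqr_ge0.
by rewrite /Lap !expr1n expr0n /= !mul1r !mul0r !addr0 powR_pred//; ring.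
Qed.

Lemma Lap11_ge0 al u v : 0 <= al -> 0 <= Lap al 1 1 u v.
Proof.
move=> al0; rewrite Lap11E mulr_ge0 ?powR_ge0// mulr_ge0 ?mulr_ge0//.
by rewrite addr_ge0// mulr_ge0// addr_ge0 ?sqr_ge0.
Qed.

Lemma Lap11_le al b u v : 0 <= al -> 1 <= b -> al <= b ->
  Lap al 1 1 u v <= 4 * al * b * (1 + (u ^+ 2 + v ^+ 2)) `^ (al - 1).
Proof.
move=> al0 b1 alb; have Q0 : 0 <= u ^+ 2 + v ^+ 2 by rewrite addr_ge0 ?sqr_ge0.
rewrite Lap11E powR_pred; last by rewrite ltr_pwDl.
rewrite mulrA ler_wpM2r ?powR_ge0// -[leRHS]mulrA ler_wpM2l ?mulr_ge0//.
by rewrite [b * _]mulrDr mulr1 lerD// ler_wpM2r.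
Qed.

Lemma le_powR_base_le0 (x y c : R) : 0 < x -> x <= y -> c <= 0 -> y `^ c <= x `^ c.
Proof.
move=> x0 xy c0; have y0 : 0 < y by apply: lt_le_trans xy.
rewrite -(opprK c) (powRN y) (powRN x) lef_pV2 ?posrE ?powR_gt0//.
by apply: ge0_ler_powR; rewrite ?nnegrE ?oppr_ge0// ltW.
Qed.

(* The function whose Laplacian dominates that of [|w|^r], [r < 1], while
   growing only linearly in [|Re w|]. *)
Lemma Lap_weak r u v : 0 < r -> r < 1 ->
  Lap (r / 2) 1 1 u v - 2 / (1 - r) * (r * (2 - r)) * Lap (1 / 2) 1 0 u v
   + 2 / (1 - r) * Lap (r / 2) 1 0 u v <= 0.
Proof.
move=> r0 r1; set al := r / 2; have al0 : 0 <= al by rewrite divr_ge0// ltW.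
have U0 : 0 <= u ^+ 2 by rewrite sqr_ge0.
have V0 : 0 <= v ^+ 2 by rewrite sqr_ge0.
have U1 : 0 < 1 + u ^+ 2 by lra.
have h1 : Lap al 1 1 u v <= 2 * r * (1 + u ^+ 2) `^ (al - 1).
  apply: (le_trans (@Lap11_le al 1 u v al0 (lexx _) _)); first by rewrite /al; lra.
  rewrite mulr1 (_ : 4 * al = 2 * r); last by rewrite /al; field.
  by rewrite ler_wpM2l; [|lra|apply: le_powR_base_le0; rewrite /al; lra].
rewrite !Lap10E.
rewrite (_ : 2 * (1 / 2) - 1 = 0 :> R); last by field.
rewrite (_ : 2 * al = r); last by rewrite /al; field.
rewrite (_ : 2 * (1 / 2) = 1 :> R); last by field.
rewrite mul0r addr0 !mul1r.
have h2 : (1 + u ^+ 2) `^ (al - 2) <= (1 + u ^+ 2) `^ (2^-1 - 2).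
  by apply: ler_powR; [lra|rewrite /al; lra].
have h3 := @powR_pred (1 + u ^+ 2) al U1.
set X := (_ `^ (al - 2)) in h2 h3 *; set Y := (_ `^ (2^-1 - 2)) in h2 *.
rewrite h3 in h1.
have c0 : 0 < 2 / (1 - r) by rewrite divr_gt0//; lra.
(* Origin of the factor 2 / (1 - r): write 1 + (r - 1) u^2 as (2 - r) - (1 - r)(1 + u^2). The second
   part cancels the bound [h1] on the first Laplacian, and the first part is dominated by the
   Laplacian for the exponent 1 / 2 because r < 1. *)
have h4 : 2 / (1 - r) * (r * (1 + (r - 1) * u ^+ 2) * X) =
   2 / (1 - r) * (r * (2 - r) * X) - 2 * r * ((1 + u ^+ 2) * X).
  by field; lra.
rewrite h4 -[X in _ - X]mulrA.
have h5 : 2 / (1 - r) * (r * (2 - r) * X) <= 2 / (1 - r) * (r * (2 - r) * Y).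
  by rewrite ler_pM2l// ler_wpM2l// mulr_ge0; lra.
lra.
Qed.

(** Giving (Re w)^2 the weight 1 + K raises the Laplacian above twice that of (1 + |w|^2)^(p / 2),
    while the price is paid in Re w only. The factor 2 leaves room to absorb a multiple 3 / 2 of the
    mean later. *)
Lemma Lap_strong p : 1 < p -> exists2 K, 0 < K & forall u v,
  2 * Lap (p / 2) 1 1 u v - Lap (p / 2) (1 + K) 1 u v <= 0.
Proof.
move=> p1; set al := p / 2.
have al0 : 0 <= al by rewrite /al; lra.
have LapE K u v : 0 <= K -> Lap al (1 + K) 1 u v = 2 * al *
   ((K + 2) * (1 + ((1 + K) * u ^+ 2 + v ^+ 2)) +
     2 * (al - 1) * ((1 + K) ^+ 2 * u ^+ 2 + v ^+ 2)) *
   (1 + ((1 + K) * u ^+ 2 + v ^+ 2)) `^ (al - 2).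
  move=> K0; have Q0 : 0 < 1 + ((1 + K) * u ^+ 2 + v ^+ 2).
    by rewrite ltr_pwDl// addr_ge0 ?sqr_ge0// mulr_ge0 ?sqr_ge0// addr_ge0.
  by rewrite /Lap !expr1n !mul1r powR_pred//; ring.
have [al1|al1] := leP 1 al.
  (* For p >= 2 the power [al - 1] is nonnegative, so Q may be enlarged to Q'; it suffices that K +
     2 exceeds 4 al. *)
  exists (4 * al); first lra.
  move=> u v; rewrite LapE; last lra.
  have U0 := sqr_ge0 u; have V0 := sqr_ge0 v.
  set Q' := 1 + ((1 + 4 * al) * u ^+ 2 + v ^+ 2).
  have Q'0 : 1 + (u ^+ 2 + v ^+ 2) <= Q'.
    by rewrite /Q' lerD2l lerD2r ler_peMl//; lra.
  have Q'1 : 0 < Q' by lra.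
  have h1 := @Lap11_le al al u v al0 al1 (lexx _).
  have h2 : (1 + (u ^+ 2 + v ^+ 2)) `^ (al - 1) <= Q' `^ (al - 1).
    by apply: ge0_ler_powR; rewrite ?nnegrE; lra.
  have h3 : (4 * al + 2) * Q' `^ (al - 1) <= ((4 * al + 2) * Q' +
     2 * (al - 1) * ((1 + 4 * al) ^+ 2 * u ^+ 2 + v ^+ 2)) * Q' `^ (al - 2).
    rewrite powR_pred// mulrA ler_wpM2r ?powR_ge0// lerDl mulr_ge0//; first lra.
    by rewrite addr_ge0// mulr_ge0// sqr_ge0.
  have h4 := ler_wpM2l (_ : 0 <= 2 * al) h3.
  have {}h4 := h4 (mulr_ge0 (ler0n _ 2) al0).
  have h5 : 4 * al * al * (1 + (u ^+ 2 + v ^+ 2)) `^ (al - 1) <= 4 * al * al * Q' `^ (al - 1).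
    by rewrite ler_wpM2l// mulr_ge0// mulr_ge0.
  have h6 : 0 <= al * Q' `^ (al - 1) by rewrite mulr_ge0 ?powR_ge0.
  lra.
pose th := p - 1; have th0 : 0 < th by rewrite /th; lra.
have th1 : th < 1 by rewrite /th; move: al1; rewrite /al; lra.
have alth : 2 * (al - 1) = th - 1 by rewrite /al /th; field.
(* For p < 2 the exponent [al - 1] is negative, and passing from Q' <= (1 + K) Q to Q costs (1 +
   K)^(al - 1). What is left is th (1 + K)^al, which is at least th (1 + K)^(1 / 2) = 4 as al >= 1 /
   2. *)
pose K := 16 / th ^+ 2 - 1.
have th2 : th ^+ 2 < 1 by rewrite expr_lt1// ltW.
have K1 : 1 + K = 16 / th ^+ 2 by rewrite /K; ring.
have K16 : 16 < 1 + K.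
  by rewrite K1 ltr_pdivlMr ?exprn_gt0//; lra.
exists K; first lra.
move=> u v; rewrite LapE; last lra.
have U0 := sqr_ge0 u; have V0 := sqr_ge0 v.
set Q' := 1 + ((1 + K) * u ^+ 2 + v ^+ 2).
set Q := 1 + (u ^+ 2 + v ^+ 2).
have Q0 : 0 < Q by rewrite /Q; lra.
have Q'0 : 0 < Q' by rewrite /Q' ltr_pwDl// addr_ge0// mulr_ge0//; lra.
have h1 := @Lap11_le al 1 u v al0 (lexx _) (ltW al1).
rewrite -/Q in h1.
have h2 : (1 + K) `^ (al - 1) * Q `^ (al - 1) <= Q' `^ (al - 1).
  rewrite -powRM; [|lra|exact: ltW]; apply: le_powR_base_le0 => //; last lra.
  by rewrite /Q' /Q !mulrDr mulr1 lerD ?lerD//; [lra|rewrite ler_peMl//; lra].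
have h3 : th * (1 + K) * Q' `^ (al - 1) <= ((K + 2) * Q' +
     2 * (al - 1) * ((1 + K) ^+ 2 * u ^+ 2 + v ^+ 2)) * Q' `^ (al - 2).
  rewrite powR_pred// mulrA ler_wpM2r ?powR_ge0// alth.
  have e : (K + 2) * Q' + (th - 1) * ((1 + K) ^+ 2 * u ^+ 2 + v ^+ 2) - th * (1 + K) * Q'
     = (1 + (1 + K) * (1 - th)) + (1 + K) * u ^+ 2 + (1 + K - (1 + K) * th + th) * v ^+ 2.
    by rewrite /Q'; ring.
  rewrite -subr_ge0 e; have a1 : 0 <= (1 + K) * (1 - th) by rewrite mulr_ge0; lra.
  have a2 : 0 <= (1 + K) * u ^+ 2 by rewrite mulr_ge0; lra.
  have a3 : 0 <= (1 + K - (1 + K) * th + th) * v ^+ 2 by rewrite mulr_ge0//; lra.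
  lra.
have h4 : 4 <= th * (1 + K) `^ al.
  have s : (4 / th) = (1 + K) `^ (1 / 2).
    rewrite K1 (_ : 16 / th ^+ 2 = (4 / th) ^+ 2); last by field; rewrite gt_eqF.
    rewrite -powR_mulrn ?divr_ge0 ?(ltW th0)// -powRrM (_ : 2%:R * (1 / 2) = 1 :> R).
      by rewrite powRr1// divr_ge0// ltW.
    by field.
  rewrite mulrC -ler_pdivrMr// s; apply: ler_powR; first lra.
  by rewrite /al; lra.
have h5 : th * (1 + K) * ((1 + K) `^ (al - 1) * Q `^ (al - 1)) =
   th * (1 + K) `^ al * Q `^ (al - 1).
  have -> : (1 + K) `^ al = (1 + K) * (1 + K) `^ (al - 1).
    have := @powR_pred (1 + K) (al + 1) _; rewrite (_ : al + 1 - 1 = al); last by ring.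
    by rewrite (_ : al + 1 - 2 = al - 1); [apply; lra|ring].
  by ring.
have h6 : 4 * Q `^ (al - 1) <= th * (1 + K) * Q' `^ (al - 1).
  apply: (@le_trans _ _ (th * (1 + K) `^ al * Q `^ (al - 1))).
    by rewrite ler_wpM2r ?powR_ge0.
  by rewrite -h5 ler_wpM2l// mulr_ge0; lra.
have h7 := le_trans h6 h3.
have := ler_wpM2l (mulr_ge0 (ler0n R 2) al0) h7.
lra.
Qed.

End Laplacians.

HB.lock Definition psi_mean {R : realType} {G : topologicalZmodType}
    (mu : probability (borel G) R) (al ka nu : R) (F : G -> R[i]) : R :=
  gint mu (fun x => psi al ka nu (complex.Re (F x)) (complex.Im (F x))).
Arguments psi_mean {R G} mu al ka nu F.

Lemma powR_le_inv {R : realType} (r x y : R) : 0 < r -> 0 <= x -> 0 <= y ->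
  x `^ r <= y `^ r -> x <= y.
Proof.
move=> r0 x0 y0 xy; rewrite leNgt; apply/negP => yx.
by have := gt0_ltr_powR r0 y0 x0 yx; rewrite ltNge xy.
Qed.

Section AnalyticBounds.
Context {R : realType} {G : topologicalZmodType} (mu : probability (borel G) R).
Hypothesis Gc : compact [set: G].
Hypothesis Gh : haar mu.
Variable beta : R -> G.
Local Notation RE := (@complex.Re _).
Local Notation IM := (@complex.Im _).

(** By the shift rule the polynomial at height y and at x + beta t depends on y + i t through the
    exponentials exp (- e_i (y + i t)). Nonnegative e_i keep it bounded in the half plane y >= 0. *)
Definition analytic_family n (e : 'I_n -> R) (chi : 'I_n -> G -> R[i]) :=
  [/\ forall i, 0 <= e i, forall i, ccont (chi i),
      forall i x, cabs (chi i x) = 1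
    & forall i x t, chi i (x + beta t) = cis (- (e i * t)) * chi i x].

Local Notation psi_mean := (psi_mean mu).

Lemma psi_meanE (al ka nu : R) (F : G -> R[i]) :
  psi_mean al ka nu F = gint mu (fun x => psi al ka nu (RE (F x)) (IM (F x))).
Proof. by rewrite unlock. Qed.

Lemma psi_ge0 (al ka nu u v : R) : 0 <= psi al ka nu u v.
Proof. exact: powR_ge0. Qed.

Lemma psi_mean_ge0 al ka nu F : 0 <= psi_mean al ka nu F.
Proof. by rewrite psi_meanE; apply: gint_ge0 => x; exact: psi_ge0. Qed.

Lemma psi_cont (al ka nu : R) (F : G -> R[i]) : 0 <= ka -> 0 <= nu -> ccont F ->
  continuous (fun x => psi al ka nu (RE (F x)) (IM (F x))).
Proof. by move=> ka0 nu0 [F1 F2]; exact: jcont_psi. Qed.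

Lemma psi_mean_apoly n (e : 'I_n -> R) (chi : 'I_n -> G -> R[i]) (a : 'I_n -> R[i])
  (c1 c2 c3 al1 al2 al3 ka1 ka2 ka3 nu1 nu2 nu3 y : R) :
  analytic_family e chi -> 0 <= y ->
  [/\ 0 <= ka1, 0 <= ka2 & 0 <= ka3] -> [/\ 0 <= nu1, 0 <= nu2 & 0 <= nu3] ->
  (forall u v, c1 * Lap al1 ka1 nu1 u v + c2 * Lap al2 ka2 nu2 u v
     + c3 * Lap al3 ka3 nu3 u v <= 0) ->
  c1 * psi_mean al1 ka1 nu1 (apoly a e chi 0) +
  c2 * psi_mean al2 ka2 nu2 (apoly a e chi 0) +
  c3 * psi_mean al3 ka3 nu3 (apoly a e chi 0) <=
  c1 * psi_mean al1 ka1 nu1 (apoly a e chi y) +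
  c2 * psi_mean al2 ka2 nu2 (apoly a e chi y) +
  c3 * psi_mean al3 ka3 nu3 (apoly a e chi y).
Proof.
move=> [e0 cchi chi1 chis] y0 [ka10 ka20 ka30] [nu10 nu20 nu30] L0.
pose S F := c1 * psi_mean al1 ka1 nu1 F + c2 * psi_mean al2 ka2 nu2 F
  + c3 * psi_mean al3 ka3 nu3 F.
pose c (j : 'I_3) := [:: c1; c2; c3]`_j.
pose al (j : 'I_3) := [:: al1; al2; al3]`_j.
pose ka (j : 'I_3) := [:: ka1; ka2; ka3]`_j.
pose nu (j : 'I_3) := [:: nu1; nu2; nu3]`_j.
have sum3 (f : R -> R -> R -> R) : \sum_(j < 3) c j * f (al j) (ka j) (nu j) =
    c1 * f al1 ka1 nu1 + c2 * f al2 ka2 nu2 + c3 * f al3 ka3 nu3.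
  by rewrite !big_ord_recl big_ord0 /= addr0 !addrA.
have ka0 j : 0 <= ka j by case: j => -[|[|[|//]]].
have nu0 j : 0 <= nu j by case: j => -[|[|[|//]]].
pose Gf u v := \sum_j c j * psi (al j) (ka j) (nu j) u v.
have cZ (b : R) (T : topologicalType) (f : T -> R) : continuous f -> continuous (fun x => b * f x).
  by move=> cf x; apply: cvgM; [exact: cvg_cst|exact: cf].
have jG : jcont Gf.
  move=> T f g cf cg; apply: cont_sum => j; apply: cZ; exact: jcont_psi.
have lG : lbdd Gf.
  move=> M; have /choice[K HK] : forall j, exists K, forall u v, `|u| <= M -> `|v| <= M ->
     `|psi (al j) (ka j) (nu j) u v| <= K by move=> j; exact: lbdd_psi.
  exists (\sum_j `|c j| * K j) => u v uM vM; apply: (le_trans (ler_norm_sum _ _ _)).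
  by apply: ler_sum => j _; rewrite normrM ler_wpM2l// HK.
have sG : supermean Gf.
  by apply: supermean_psi3 => // u v; rewrite (sum3 (fun a b d => Lap a b d u v)).
have E F : ccont F -> gint mu (fun x => Gf (RE (F x)) (IM (F x))) = S F.
  move=> cF; have cp j := @psi_cont (al j) (ka j) (nu j) F (ka0 j) (nu0 j) cF.
  rewrite /Gf gint_sum//; last by move=> j; exact: cZ.
  rewrite /S -(sum3 (fun a b d => psi_mean a b d F)).
  by apply: eq_bigr => j _; rewrite psi_meanE gintZ.
have h := mean_apoly_le Gc Gh a e0 cchi chi1 chis jG lG sG y0.
have cA z : ccont (apoly a e chi z) by exact: apoly_cont.
exact: (eq_ind _ (fun z => z <= _) (eq_ind _ (fun z => _ <= z) h _ (E _ (cA y))) _ (E _ (cA 0))).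
Qed.

Lemma psi11E al (F : G -> R[i]) x : psi al 1 1 (RE (F x)) (IM (F x)) =
  (1 + cabs (F x) ^+ 2) `^ al.
Proof. by rewrite /psi !mul1r cabs_sqr. Qed.

Lemma apoly_scale n (e : 'I_n -> R) (chi : 'I_n -> G -> R[i]) a (k : R[i]) y x :
  apoly (fun i => k * a i) e chi y x = k * apoly a e chi y x.
Proof. by rewrite !apolyE mulr_sumr; apply: eq_bigr => i _; rewrite !mulrA. Qed.

(** The function (1 + |w|^2)^(r / 2) is subharmonic, so its negative is superharmonic and its mean
    decreases with the height. The scale k is kept free in order to remove the summand 1
    afterwards. *)
Lemma apoly_contract_pow n (e : 'I_n -> R) (chi : 'I_n -> G -> R[i]) a (k r y : R) :
  analytic_family e chi -> 0 <= r -> 0 <= y -> 0 <= k ->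
  gint mu (fun x => (1 + (k * cabs (apoly a e chi y x)) ^+ 2) `^ (r / 2)) <=
  gint mu (fun x => (1 + (k * cabs (apoly a e chi 0 x)) ^+ 2) `^ (r / 2)).
Proof.
move=> fam r0 y0 k0.
have E z : psi_mean (r / 2) 1 1 (apoly (fun i => k%:C%C * a i) e chi z) =
   gint mu (fun x => (1 + (k * cabs (apoly a e chi z x)) ^+ 2) `^ (r / 2)).
  by rewrite psi_meanE; apply: eq_gint => x; rewrite psi11E apoly_scale cabsM cabs_real ger0_norm.
have h : forall u v, -1 * Lap (r / 2) 1 1 u v + 0 * Lap (r / 2) 1 1 u v +
    0 * Lap (r / 2) 1 1 u v <= 0.
  by move=> u v; rewrite !mul0r !addr0 mulN1r oppr_le0 Lap11_ge0// divr_ge0.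
have := @psi_mean_apoly n e chi (fun i => k%:C%C * a i) _ _ _ _ _ _ _ _ _ _ _ _ y fam y0
  (And3 ler01 ler01 ler01) (And3 ler01 ler01 ler01) h.
move: (E 0) (E y); move: (apoly _ e chi 0) (apoly _ e chi y) => F0 Fy <- <-.
move: (psi_mean _ _ _ F0) (psi_mean _ _ _ Fy) => A B; lra.
Qed.

(** With k = 1 / eta the two integrals are, up to the factor eta^(- r), r-th moments of sqrt (eta^2
    + |F|^2) and sqrt (eta^2 + |H|^2). These functions differ from the moduli by at most eta, which
    then tends to 0. *)
Lemma nrm_le_of_pow r (F H : G -> R[i]) : 1 <= r -> ccont F -> ccont H ->
  (forall k, 0 <= k -> gint mu (fun x => (1 + (k * cabs (F x)) ^+ 2) `^ (r / 2)) <=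
     gint mu (fun x => (1 + (k * cabs (H x)) ^+ 2) `^ (r / 2))) ->
  nrm mu r%:E F <= nrm mu r%:E H.
Proof.
move=> r1 cF cH FH; have r0 : 0 < r by apply: lt_le_trans r1.
have r1' : (1 <= r%:E)%E by rewrite lee_fin.
apply/ler_addgt0Pr => eta eta0.
pose s (F : G -> R[i]) x := Num.sqrt (eta ^+ 2 + cabs (F x) ^+ 2).
have cs K : ccont K -> continuous (s K).
  move=> cK x; rewrite /s; apply: (@cvg_comp _ _ _ (fun x => eta ^+ 2 + cabs (K x) ^+ 2) Num.sqrt);
    last exact: sqrt_continuous.
  apply: cvgD; first exact: cvg_cst.
  by rewrite expr2; apply: cvgM; exact: cont_cabs.
have s0 K x : 0 <= s K x by rewrite sqrtr_ge0.
have ge_s K x : cabs (K x) <= s K x.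
  by rewrite /s -[leLHS]ger0_norm ?cabs_ge0// -sqrtr_sqr ler_wsqrtr// lerDr sqr_ge0.
have le_s K x : s K x <= cabs (K x) + eta.
  have h : 0 <= cabs (K x) + eta by rewrite addr_ge0 ?cabs_ge0// ltW.
  rewrite /s -[leRHS]ger0_norm// -sqrtr_sqr ler_wsqrtr//.
  rewrite sqrrD addrAC [eta ^+ 2 + _]addrC lerDl mulrn_wge0// mulr_ge0 ?cabs_ge0//.
  exact: ltW.
have eta1 : 0 <= eta^-1 by rewrite invr_ge0 ltW.
have sE K x : (1 + (eta^-1 * cabs (K x)) ^+ 2) `^ (r / 2) = `|eta^-1 * s K x| `^ r.
  have p0 : 0 <= eta^-1 * s K x by rewrite mulr_ge0.
  rewrite (ger0_norm p0).
  have -> : 1 + (eta^-1 * cabs (K x)) ^+ 2 = (eta^-1 * s K x) ^+ 2.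
    rewrite [RHS]exprMn sqr_sqrtr ?addr_ge0 ?sqr_ge0//; field; rewrite gt_eqF//.
  rewrite -powR_mulrn// -powRrM; by congr (_ `^ _); field.
have := FH _ eta1.
rewrite (eq_gint _ (sE F)) (eq_gint _ (sE H)).
have csZ K : ccont K -> continuous (fun x => eta^-1 * s K x).
  by move=> cK x; apply: cvgM; [exact: cvg_cst|exact: cs].
rewrite -!(rnrm_pow mu _ r0) => L.
have {L} := powR_le_inv r0 (rnrm_ge0 mu Gc _ (csZ _ cF)) (rnrm_ge0 mu Gc _ (csZ _ cH)) L.
rewrite !(rnrmZ mu Gc)//; [|exact: cs|exact: cs].
rewrite ger0_norm// ler_pM2l ?invr_gt0// => L.
apply: (@le_trans _ _ (rnrm mu r%:E (s F))).
  apply: le_rnrm => //; [exact: cont_cabs|exact: cs|].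
  by move=> x; rewrite !ger0_norm ?cabs_ge0.
apply: (le_trans L).
have cN : continuous (fun _ : G => eta) by move=> x; exact: cvg_cst.
have etaE : rnrm mu r%:E (fun _ : G => eta) = eta by rewrite rnrm_cst// gtr0_norm.
apply: (@le_trans _ _ (nrm mu r%:E H + rnrm mu r%:E (fun _ : G => eta))); last by rewrite etaE.
apply: le_trans (rnrmD Gc Gh r1' (cont_cabs cH) cN).
apply: le_rnrm => //; [exact: cs|by move=> x; apply: cvgD; [exact: cont_cabs|exact: cvg_cst]|].
by move=> x; rewrite !ger0_norm ?addr_ge0 ?cabs_ge0// ltW.
Qed.

(** The supremum norm is reached from the integer exponents k: there the norm at height 0 is at most
    the supremum norm, and a common bound on all L_k-norms bounds the supremum. *)
Lemma apoly_contract q n (e : 'I_n -> R) (chi : 'I_n -> G -> R[i]) a (y : R) :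
  (1 <= q)%E -> analytic_family e chi -> 0 <= y ->
  nrm mu q (apoly a e chi y) <= nrm mu q (apoly a e chi 0).
Proof.
move=> q1 fam y0; have cA z : ccont (apoly a e chi z).
  by apply: apoly_cont; case: fam.
have fin r : 1 <= r -> nrm mu r%:E (apoly a e chi y) <= nrm mu r%:E (apoly a e chi 0).
  move=> r1; apply: (nrm_le_of_pow r1 (cA y) (cA 0)) => k k0.
  by apply: (apoly_contract_pow a fam _ y0 k0); apply: le_trans r1.
move: (cA 0) (cA y) fin; move: (apoly a e chi 0) (apoly a e chi y) => F0 Fy c0 cy fin.
case: q q1 => [r|_|//]; first by rewrite lee_fin => r1; exact: fin.
apply: rnrm_large => //; [exact: cont_cabs|exact: nrm_ge0|].
move=> k; have k1 : (1 : R) <= k.+1%:R by rewrite ler1n.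
apply: (le_trans (fin _ k1)); apply: nrm_le => //.
by move=> x; exact: cabs_le_nrmy.
Qed.

(* Far up in the half plane only the constant term survives. *)
Lemma apoly_far n (e : 'I_n -> R) (chi : 'I_n -> G -> R[i]) a :
  analytic_family e chi ->
  (forall x, cabs (\sum_(i | e i == 0) a i * chi i x) <= 1) ->
  exists2 y, 0 <= y & forall x, cabs (apoly a e chi y x) <= 2.
Proof.
move=> [e0 cchi chi1 chis] c1.
(* Since exp (- x) <= 1 / x, each nonconstant term is at most |a_i| / (e_i y), and these sum to at
   most 1. *)
pose y := 1 + \sum_(i | e i != 0) cabs (a i) / e i.
have S0 : 0 <= \sum_(i | e i != 0) cabs (a i) / e i.
  by apply: sumr_ge0 => i _; rewrite divr_ge0 ?cabs_ge0.
have y0 : 0 < y by rewrite /y; lra.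
exists y; first exact: ltW.
move=> x; rewrite apolyE (bigID (fun i => e i == 0))/=.
apply: (le_trans (cabsD _ _)); rewrite (_ : 2 = 1 + 1) ?lerD//.
  rewrite (eq_bigr (fun i => a i * chi i x))// => i /eqP ->.
  by rewrite mul0r oppr0 expR0 mulr1.
apply: (le_trans (cabs_sum _ _ _)).
apply: (@le_trans _ _ (\sum_(i | e i != 0) cabs (a i) / e i / y)).
  apply: ler_sum => i ei; have ei0 : 0 < e i by rewrite lt0r ei e0.
  rewrite !cabsM chi1 mulr1 cabs_real -mulrA -invfM ler_wpM2l ?cabs_ge0//.
  rewrite ger0_norm ?expR_ge0// expRN lef_pV2 ?posrE ?expR_gt0 ?mulr_gt0//.
  by have := expR_ge1Dx (e i * y); lra.
by rewrite -mulr_suml ler_pdivrMr// mul1r /y; lra.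
Qed.

Lemma pow_cabs_le (r : R) (z : R[i]) : 0 <= r ->
  cabs z `^ r <= (1 + cabs z ^+ 2) `^ (r / 2).
Proof.
move=> r0; have -> : cabs z `^ r = (cabs z ^+ 2) `^ (r / 2).
  rewrite -powR_mulrn ?cabs_ge0// -powRrM; congr (_ `^ _); by field.
by apply: ge0_ler_powR; rewrite ?nnegrE ?divr_ge0 ?addr_ge0 ?sqr_ge0// lerDr.
Qed.

(** A bound on the whole function by its real part, as for conjugate functions. An imaginary
    constant has real part 0, hence the separate normalisation of the constant term. *)
Definition riesz_bound (p r : R) := exists2 C, 0 <= C &
  forall n (e : 'I_n -> R) (chi : 'I_n -> G -> R[i]) (a : 'I_n -> R[i]),
  analytic_family e chi ->
  (forall x, cabs (\sum_(i | e i == 0) a i * chi i x) <= 1) ->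
  gint mu (fun x => `|RE (apoly a e chi 0 x)| `^ p) <= 1 ->
  gint mu (fun x => cabs (apoly a e chi 0 x) `^ r) <= C.

Lemma psi11_far al (F : G -> R[i]) : 0 <= al -> ccont F -> (forall x, cabs (F x) <= 2) ->
  psi_mean al 1 1 F <= 5 `^ al.
Proof.
move=> al0 cF F2; rewrite psi_meanE -(gint_cst mu (5 `^ al)); apply: le_gint => //.
- exact: psi_cont.
- by move=> x; exact: cvg_cst.
- move=> x; rewrite psi11E; apply: ge0_ler_powR; rewrite ?nnegrE ?addr_ge0 ?sqr_ge0//.
  have := F2 x; have := cabs_ge0 (F x); set z := cabs _ => z0 z2.
  have : z ^+ 2 <= 2 ^+ 2 by rewrite lerXn2r// ?nnegrE.
  lra.
Qed.

Lemma pow_mean_le (r : R) (F : G -> R[i]) : 0 < r -> ccont F ->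
  gint mu (fun x => cabs (F x) `^ r) <= psi_mean (r / 2) 1 1 F.
Proof.
move=> r0 cF; rewrite psi_meanE; apply: le_gint => //.
- rewrite (_ : (fun _ => _) = fun x => `|cabs (F x)| `^ r).
    by apply: powR_cont => //; exact: cont_cabs.
  by apply/funext => x; rewrite ger0_norm// cabs_ge0.
- exact: psi_cont.
- by move=> x; rewrite psi11E; apply: pow_cabs_le; exact: ltW.
Qed.

(** Pointwise, either K u^2 <= eta Q, and the added weight costs the factor (1 + eta)^al = 3 / 2, or
    Q is dominated by a multiple of u^2, and everything is bounded by a multiple of |u|^p. *)
Lemma psi_mean_strong (p K : R) : 1 < p -> 0 < K -> exists2 D, 0 <= D &
  forall F : G -> R[i], ccont F -> gint mu (fun x => `|RE (F x)| `^ p) <= 1 ->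
  psi_mean (p / 2) (1 + K) 1 F <= 3 / 2 * psi_mean (p / 2) 1 1 F + D.
Proof.
move=> p1 K0; set al := p / 2; have al0 : 0 < al by rewrite /al; lra.
pose eta := (3 / 2) `^ al^-1 - 1.
have eta0 : 0 < eta.
  have e1 : (1 : R) = 1 `^ al^-1 by rewrite powR1.
  rewrite subr_gt0 [ltLHS]e1; apply: gt0_ltr_powR; rewrite ?nnegrE ?invr_gt0//; lra.
have etaE : (1 + eta) `^ al = 3 / 2.
  rewrite /eta addrC subrK -powRrM mulVf ?gt_eqF// powRr1//; lra.
have eta1 : 0 < eta^-1 by rewrite invr_gt0.
pose D := ((1 + eta^-1) * K) `^ al.
exists D; first exact: powR_ge0.
move=> F cF Re1.
apply: (@le_trans _ _ (3 / 2 * psi_mean al 1 1 F + D * gint mu (fun x => `|RE (F x)| `^ p))); last first.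
  by rewrite lerD2l -[leRHS]mulr1 ler_wpM2l// powR_ge0.
have c1 : continuous (fun x => psi al 1 1 (RE (F x)) (IM (F x))) by exact: psi_cont.
have c2 : continuous (fun x => `|RE (F x)| `^ p) by apply: powR_cont; [lra|case: cF].
have cZ (b : R) (f : G -> R) : continuous f -> continuous (fun x => b * f x).
  by move=> cf x; apply: cvgM; [exact: cvg_cst|exact: cf].
rewrite !psi_meanE -!gintZ// -gintD; [|by []|exact: cZ|exact: cZ].
apply: le_gint => //; first by apply: psi_cont => //; lra.
  by move=> x; apply: cvgD; [exact: (cZ _ _ c1)|exact: (cZ _ _ c2)].
move=> x; set u := RE _; set v := IM _.
have U0 := sqr_ge0 u; have V0 := sqr_ge0 v.
rewrite /psi !mul1r; set Q := 1 + (u ^+ 2 + v ^+ 2).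
have Q0 : 0 < Q by rewrite /Q; lra.
have -> : 1 + ((1 + K) * u ^+ 2 + v ^+ 2) = Q + K * u ^+ 2 by rewrite /Q; ring.
have KU : 0 <= K * u ^+ 2 by rewrite mulr_ge0// ltW.
have uE : `|u| `^ p = (u ^+ 2) `^ al.
  rewrite -(real_normK (num_real u)) -powR_mulrn// -powRrM /al.
  by congr (_ `^ _); field.
have [le1|lt1] := leP (K * u ^+ 2) (eta * Q).
  apply: (@le_trans _ _ (((1 + eta) * Q) `^ al)).
    apply: ge0_ler_powR; rewrite ?nnegrE; [exact: ltW|lra|by rewrite mulr_ge0; lra|lra].
  by rewrite powRM ?(ltW Q0)//; [rewrite etaE lerDl mulr_ge0// powR_ge0|lra].
apply: (@le_trans _ _ (((1 + eta^-1) * K * u ^+ 2) `^ al)).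
  apply: ge0_ler_powR; rewrite ?nnegrE; [exact: ltW|lra|by rewrite -mulrA mulr_ge0; lra|].
  have : Q <= eta^-1 * (K * u ^+ 2) by rewrite ler_pdivlMl// ltW.
  by rewrite -mulrA mulrDl mul1r; lra.
rewrite powRM//; last by rewrite mulr_ge0; lra.
by rewrite uE lerDr mulr_ge0 ?powR_ge0//; lra.
Qed.

(** The mean inequality bounds 2 m by m' plus the value far up, where m is the mean of (1 +
    |F|^2)^(p / 2) and m' the one with weight 1 + K. As m' <= (3 / 2) m + D, half of m remains on
    the left. *)
Lemma riesz_strong p : 1 < p -> riesz_bound p p.
Proof.
move=> p1; have [K K0 HK] := Lap_strong p1.
have [D D0 HD] := psi_mean_strong p1 K0.
exists (2 * (2 * 5 `^ (p / 2) + D)).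
  by rewrite mulr_ge0// addr_ge0 ?mulr_ge0 ?powR_ge0.
move=> n e chi a fam c0 Re1; have [_ cchi _ _] := fam.
have [y y0 Fy2] := apoly_far fam c0.
have cA z : ccont (apoly a e chi z) by exact: apoly_cont.
have h : forall u v, 2 * Lap (p / 2) 1 1 u v + -1 * Lap (p / 2) (1 + K) 1 u v +
    0 * Lap (p / 2) 1 1 u v <= 0.
  by move=> u v; rewrite mul0r addr0 mulN1r.
have K1 : 0 <= 1 + K by lra.
have := @psi_mean_apoly n e chi a _ _ _ _ _ _ _ _ _ _ _ _ y fam y0
  (And3 ler01 K1 ler01) (And3 ler01 ler01 ler01) h.
move: Re1 Fy2 (cA 0) (cA y).
move: (apoly a e chi 0) (apoly a e chi y) => F0 Fy Re1 Fy2 cF0 cFy /=.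
have al0 : 0 <= p / 2 by lra.
have h1 := psi11_far al0 cFy Fy2; have h2 := psi_mean_ge0 (p / 2) (1 + K) 1 Fy.
have h3 := HD _ cF0 Re1.
have h4 := @pow_mean_le p F0 _ cF0.
have {}h4 : gint mu (fun x => cabs (F0 x) `^ p) <= psi_mean (p / 2) 1 1 F0 by apply: h4; lra.
lra.
Qed.

Lemma psi_mean_half (F : G -> R[i]) : ccont F ->
  gint mu (fun x => `|RE (F x)| `^ 1) <= 1 -> psi_mean (1 / 2) 1 0 F <= 2.
Proof.
move=> cF Re1.
have cu : continuous (fun x => `|RE (F x)| `^ 1) by apply: powR_cont => //; case: cF.
have c1 : continuous (fun _ : G => 1 : R) by move=> x; exact: cvg_cst.
apply: (@le_trans _ _ (gint mu (fun x => 1 + `|RE (F x)| `^ 1))).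
  rewrite psi_meanE; apply: le_gint => //; first exact: psi_cont.
    by move=> x; apply: cvgD; [exact: c1|exact: cu].
  move=> x; set u := RE _; rewrite /psi mul1r mul0r addr0 powRr1//.
  rewrite -(real_normK (num_real u)) div1r powR12_sqrt; last by rewrite addr_ge0// sqr_ge0.
  have u1 : 0 <= 1 + `|u| by rewrite addr_ge0.
  rewrite -[leRHS](ger0_norm u1) -[leRHS]sqrtr_sqr ler_wsqrtr//.
  by rewrite sqrrD expr1n mul1r addrAC lerDl mulrn_wge0.
by rewrite gintD// gint_cst; lra.
Qed.

(** The mean of (1 + (Re F)^2)^(1 / 2) grows linearly in |Re F|, so the L_1 hypothesis bounds it at
    height 0. The other term in Re F is nonnegative at height 0, where it is dropped, and bounded
    far up. *)
Lemma riesz_weak r : 0 < r -> r < 1 -> riesz_bound 1 r.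
Proof.
move=> r0 r1; set al := r / 2; have al0 : 0 < al by rewrite /al divr_gt0.
pose c := 2 / (1 - r); have c0 : 0 < c by rewrite /c divr_gt0//; lra.
pose d := c * (r * (2 - r)); have d0 : 0 < d by rewrite /d mulr_gt0// mulr_gt0//; lra.
exists ((1 + c) * 5 `^ al + d * 2).
  by apply: addr_ge0; apply: mulr_ge0; [lra|exact: powR_ge0|exact: ltW|].
move=> n e chi a fam a0 Re1; have [_ cchi _ _] := fam.
have [y y0 Fy2] := apoly_far fam a0.
have cA z : ccont (apoly a e chi z) by exact: apoly_cont.
have h : forall u v, 1 * Lap al 1 1 u v + - d * Lap (1 / 2) 1 0 u v +
    c * Lap al 1 0 u v <= 0.
  by move=> u v; rewrite mul1r mulNr; exact: Lap_weak.
have := @psi_mean_apoly n e chi a _ _ _ _ _ _ _ _ _ _ _ _ y fam y0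
  (And3 ler01 ler01 ler01) (And3 ler01 (lexx 0) (lexx 0)) h.
move: Re1 Fy2 (cA 0) (cA y).
move: (apoly a e chi 0) (apoly a e chi y) => F0 Fy Re1 Fy2 cF0 cFy /=.
have h0 : psi_mean al 1 0 Fy <= 5 `^ al.
  apply: le_trans (psi11_far (ltW al0) cFy Fy2).
  rewrite !psi_meanE; apply: le_gint => //; [exact: psi_cont|exact: psi_cont|] => x.
  rewrite /psi !mul1r mul0r addr0.
  have u0 := sqr_ge0 (RE (Fy x)); have v0 := sqr_ge0 (IM (Fy x)).
  by apply: ge0_ler_powR; rewrite ?nnegrE; [exact: ltW|lra|lra|lra].
have h1 := psi11_far (ltW al0) cFy Fy2.
have h2 := psi_mean_ge0 (1 / 2) 1 0 Fy.
have h3 := psi_mean_ge0 al 1 0 F0.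
have h4 := psi_mean_half cF0 Re1.
have h5 := pow_mean_le r0 cF0; rewrite -/al in h5.
have h6 : c * psi_mean al 1 0 Fy <= c * 5 `^ al by rewrite ler_pM2l.
have h7 : 0 <= d * psi_mean (1 / 2) 1 0 Fy by rewrite mulr_ge0// ltW.
have h8 : d * psi_mean (1 / 2) 1 0 F0 <= d * 2 by rewrite ler_pM2l.
have h9 : 0 <= c * psi_mean al 1 0 F0 by rewrite mulr_ge0// ltW.
lra.
Qed.

End AnalyticBounds.

(** The graph of t^p lies above its tangent at s, by Young's inequality. Integrated against a
    probability measure with a suitable s, this takes the place of the inequalities of Jensen and
    Hölder. *)
Lemma powR_tangent {R : realType} (p s t : R) : 1 <= p -> 0 <= s -> 0 <= t ->
  p * s `^ (p - 1) * t <= t `^ p + (p - 1) * s `^ p.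
Proof.
rewrite le_eqVlt => /predU1P[<-|p1] s0 t0.
  by rewrite subrr powRr0 mul0r addr0 powRr1// !mul1r.
have p0 : 0 < p by apply: lt_trans p1.
have pm0 : 0 < p - 1 by rewrite subr_gt0.
have := @conjugate_powR R t (s `^ (p - 1)) p (p / (p - 1)) t0 (powR_ge0 _ _) p0.
rewrite divr_gt0// => /(_ isT).
have -> : p^-1 + (p / (p - 1))^-1 = 1 by field; rewrite !gt_eqF.
move=> /(_ erefl).
rewrite -powRrM [(p - 1) * _]mulrC divfK ?gt_eqF// => H.
have := ler_wpM2l (ltW p0) H.
rewrite mulrDr [p * (t `^ p / p)]mulrC divfK ?gt_eqF//.
have -> : p * (s `^ p / (p / (p - 1))) = (p - 1) * s `^ p by field; rewrite !gt_eqF.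
by rewrite [t * _]mulrC mulrA.
Qed.

(** A mean is at most the larger of its two terms. This replaces convexity of the power, which fails
    for r < 1. *)
Lemma powR_half_le {R : realType} (r x y z : R) : 0 <= r -> 0 <= x -> 0 <= y -> 0 <= z ->
  z <= (x + y) / 2 -> z `^ r <= x `^ r + y `^ r.
Proof.
move=> r0 x0 y0 z0 zxy; have [xy|/ltW yx] := leP x y.
  apply: (@le_trans _ _ (y `^ r)); last by rewrite lerDr powR_ge0.
  by apply: ge0_ler_powR; rewrite ?nnegrE//; lra.
apply: (@le_trans _ _ (x `^ r)); last by rewrite lerDl powR_ge0.
by apply: ge0_ler_powR; rewrite ?nnegrE//; lra.
Qed.

Section DirichletPolynomials.
Context {R : realType} {G : topologicalZmodType} (mu : probability (borel G) R).
Variables (lambda : nat -> R) (beta : R -> G) (h : nat -> G -> R[i]).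
Hypothesis dg : dirichlet_group lambda mu beta h.
Hypothesis freq : frequency lambda.
Local Notation RE := (@complex.Re _).
Local Notation IM := (@complex.Im _).
Let Gc := dgroup_compact dg.
Let Gh := dgroup_haar dg.

Lemma hchar n : character (h n). Proof. exact: dgroup_char dg n. Qed.

Lemma hcont n : ccont (h n). Proof. exact: char_ccont (hchar n). Qed.

Lemma cabs_h n x : cabs (h n x) = 1. Proof. by case: (hchar n). Qed.

Lemma h_shift n x t : h n (x + beta t) = cis (- (lambda n * t)) * h n x.
Proof.
by have [_ hM _ _] := hchar n; rewrite hM (dgroup_charE dg) mulrC.
Qed.

Lemma lambda_le m n : (m <= n)%N -> lambda m <= lambda n.
Proof.
have [_ mono _] := freq.
by rewrite leq_eqVlt => /predU1P[->//|/mono/ltW].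
Qed.

Lemma lambda_inj m n : lambda m = lambda n -> m = n.
Proof.
have [_ mono _] := freq => e; case: (ltngtP m n) => // /mono; by rewrite e ltxx.
Qed.

Lemma cis_eq1 (x : R) : (forall t : R, cis (x * t) = 1) -> x = 0.
Proof.
move=> x1; apply/eqP/negPn/negP => x0.
have [] := x1 (pi / x); rewrite mulrC divfK// cospi => e1 _.
by have := lt_trans (ltrN10 R) ltr01; rewrite e1 ltxx.
Qed.

Lemma h_inj m n : h m = h n -> m = n.
Proof.
move=> e; apply: lambda_inj; apply/eqP; rewrite -subr_eq0; apply/eqP/cis_eq1 => t.
by rewrite mulrBl cisD -(dgroup_charE dg) -e (dgroup_charE dg) -cisD subrr cis0.
Qed.

Definition hpoly (a : nat -> R[i]) (N : nat) (x : G) : R[i] :=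
  \sum_(n < N) a n * h n x.

Lemma hpoly_cont a N : ccont (hpoly a N).
Proof.
by apply: ccont_sum => i; apply: ccontM; [exact: ccont_cst|exact: hcont].
Qed.

Lemma eq_hpoly a b N x : (forall n, (n < N)%N -> a n = b n) -> hpoly a N x = hpoly b N x.
Proof. by move=> ab; apply: eq_bigr => i _; rewrite ab. Qed.

Lemma hpolyZ c a N x : hpoly (fun n => c * a n) N x = c * hpoly a N x.
Proof. by rewrite /hpoly mulr_sumr; apply: eq_bigr => i _; rewrite mulrA. Qed.

Lemma hpolyB a b N x : hpoly (fun n => a n - b n) N x = hpoly a N x - hpoly b N x.
Proof. by rewrite /hpoly -sumrB; apply: eq_bigr => i _; rewrite mulrBl. Qed.

Lemma hpolyD a b N x : hpoly (fun n => a n + b n) N x = hpoly a N x + hpoly b N x.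
Proof. by rewrite /hpoly -big_split; apply: eq_bigr => i _; rewrite mulrDl. Qed.

Lemma hpoly_coef a N m : (m < N)%N -> cint mu (fun x => hpoly a N x * (h m x)^*) = a m.
Proof.
move=> mN; rewrite (@eq_cint _ _ mu _ (fun x => \sum_(n < N) a n * (h n x * (h m x)^*))).
  rewrite cint_sum//; last first.
    move=> i; apply: ccontM; first exact: ccont_cst.
    by apply: ccontM; [exact: hcont|apply: ccontJ; exact: hcont].
  rewrite (bigD1 (Ordinal mN))//= cintZ//; last first.
    by apply: ccontM; [exact: hcont|apply: ccontJ; exact: hcont].
  rewrite (cint_charM Gc Gh)//; [|exact: hchar|exact: hchar].
  rewrite eqxx mulr1 big1 ?addr0// => i im.
  rewrite cintZ//; last by apply: ccontM; [exact: hcont|apply: ccontJ; exact: hcont].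
  rewrite (cint_charM Gc Gh)//; [|exact: hchar|exact: hchar].
  case: eqVneq => [e|_]; last by rewrite mulr0.
  by move: im; rewrite -val_eqE /= => /eqP; case; exact: h_inj.
by move=> x; rewrite /hpoly mulr_suml; apply: eq_bigr => i _; rewrite mulrA.
Qed.

(** The quotient of [h n] by [h m], inverted for n < m so that its frequency is nonnegative in all
    cases. *)
Definition ech (m n : nat) (x : G) : R[i] :=
  if (m <= n)%N then h n x * (h m x)^* else h m x * (h n x)^*.

Lemma ech_family m N :
  analytic_family beta (fun n : 'I_N => `|lambda n - lambda m|) (fun n => ech m n).
Proof.
split=> [//|i|i x|i x t]; rewrite /ech.
- by case: (m <= i)%N; apply: ccontM; (exact: hcont || by apply: ccontJ; exact: hcont).
- by case: ifP => _; rewrite cabsM cabsJ !cabs_h mulr1.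
- have [mi|im] := leqP m i; rewrite !h_shift cconjM cisJ opprK.
    rewrite ger0_norm ?subr_ge0 ?lambda_le// mulrACA -cisD; congr (cis _ * _); ring.
  rewrite ler0_norm ?subr_le0 ?lambda_le ?(ltnW im)// mulrACA -cisD; congr (cis _ * _); ring.
Qed.

Lemma hpoly_contract_up q a N m sigma : (1 <= q)%E -> 0 <= sigma ->
  (forall n, (n < m)%N -> a n = 0) ->
  nrm mu q (hpoly (fun n => a n * (expR (- ((lambda n - lambda m) * sigma)))%:C%C) N) <=
  nrm mu q (hpoly a N).
Proof.
move=> q1 s0 am.
have E (y : R) x : cabs (apoly (fun n : 'I_N => a n) (fun n : 'I_N => `|lambda n - lambda m|)
    (fun n : 'I_N => ech m n) y x) =
    cabs (hpoly (fun n => a n * (expR (- ((lambda n - lambda m) * y)))%:C%C) N x).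
  rewrite -[RHS]mulr1 -(cabs_h m x) -(cabsJ (h m x)) -cabsM; congr cabs.
  rewrite apolyE /hpoly mulr_suml; apply: eq_bigr => i _; rewrite /ech.
  case: ifP => [mi|/negbT]; last by rewrite -ltnNge => im; rewrite am// !mul0r.
  by rewrite ger0_norm ?subr_ge0 ?lambda_le// !mulrA.
have := @apoly_contract _ _ mu Gc Gh beta q _ _ _ (fun n : 'I_N => a n) sigma q1
  (ech_family m N) s0.
rewrite (eq_nrm mu q (E sigma)) (eq_nrm mu q (E 0)).
congr (_ <= _); apply: eq_nrm => x; congr cabs; apply: eq_hpoly => n _.
by rewrite mulr0 oppr0 expR0 mulr1.
Qed.

(** Conjugation followed by multiplication with [h m] reflects the spectrum: the top frequency
    becomes 0 and the others lambda_m - lambda_n. Damping these amounts to a translation to the left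
    that is normalised at the top frequency. *)
Lemma hpoly_contract_down q a N m sigma : (1 <= q)%E -> 0 <= sigma ->
  (forall n, (m < n)%N -> a n = 0) ->
  nrm mu q (hpoly (fun n => a n * (expR (- ((lambda m - lambda n) * sigma)))%:C%C) N) <=
  nrm mu q (hpoly a N).
Proof.
move=> q1 s0 am.
have E (y : R) x : cabs (apoly (fun n : 'I_N => (a n)^*) (fun n : 'I_N => `|lambda n - lambda m|)
    (fun n : 'I_N => ech m n) y x) =
    cabs (hpoly (fun n => a n * (expR (- ((lambda m - lambda n) * y)))%:C%C) N x).
  rewrite -[RHS]cabsJ -[RHS]mul1r -(cabs_h m x) -cabsM; congr cabs.
  rewrite apolyE /hpoly cconj_sum mulr_sumr; apply: eq_bigr => i _; rewrite /ech.
  case: ifP => [|/negbT]; last first.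
    rewrite -ltnNge => im; rewrite ler0_norm ?subr_le0 ?lambda_le ?(ltnW im)//.
    rewrite opprB !cconjM conj_real; ring.
  rewrite leq_eqVlt => /predU1P[<-|mi]; last by rewrite am// conj0 mul0r cconjM cconjM conj0; ring.
  by rewrite subrr normr0 !cconjM conj_real; ring.
have := @apoly_contract _ _ mu Gc Gh beta q _ _ _ (fun n : 'I_N => (a n)^*) sigma q1
  (ech_family m N) s0.
rewrite (eq_nrm mu q (E sigma)) (eq_nrm mu q (E 0)).
congr (_ <= _); apply: eq_nrm => x; congr cabs; apply: eq_hpoly => n _.
by rewrite mulr0 oppr0 expR0 mulr1.
Qed.

Lemma gint_abs_le1 (p : R) F : 1 <= p -> ccont F ->
  gint mu (fun x => cabs (F x) `^ p) <= 1 -> gint mu (fun x => cabs (F x)) <= 1.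
Proof.
move=> p1 cF F1; have p0 : 0 < p by apply: lt_le_trans p1.
have cp : continuous (fun x => cabs (F x) `^ p).
  rewrite (_ : (fun _ => _) = fun x => `|cabs (F x)| `^ p).
    by apply: powR_cont => //; exact: cont_cabs.
  by apply/funext => x; rewrite ger0_norm// cabs_ge0.
have cc : continuous (fun _ : G => p - 1) by move=> x; exact: cvg_cst.
have : gint mu (fun x => p * cabs (F x)) <= gint mu (fun x => cabs (F x) `^ p + (p - 1)).
  apply: le_gint => //.
  - by move=> x; apply: cvgM; [exact: cvg_cst|exact: cont_cabs].
  - by move=> x; apply: cvgD; [exact: cp|exact: cc].
  - move=> x; have := powR_tangent p1 ler01 (cabs_ge0 (F x)).
    by rewrite !powR1 !mulr1.
rewrite gintZ//; last exact: cont_cabs.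
rewrite gintD// gint_cst => H; rewrite -(ler_pM2l p0); lra.
Qed.

Definition upper (a : nat -> R[i]) (m n : nat) : R[i] := if (m <= n)%N then a n else 0.

(** Divide P by [h m], let F1 be the part of frequency >= 0 and F2 the conjugate of the rest. Then
    F1 + F2 and - i (F1 - F2) are analytic, and their real parts are the real and the imaginary part
    of P divided by [h m]. Both are bounded by |P|, and |F1| is at most the mean of the two
    moduli. *)
Lemma riesz_upper (p r : R) : 1 <= p -> 0 < r -> riesz_bound mu beta p r ->
  exists2 C, 0 <= C & forall a N m, gint mu (fun x => cabs (hpoly a N x) `^ p) <= 1 ->
    gint mu (fun x => cabs (hpoly (upper a m) N x) `^ r) <= C.
Proof.
move=> p1 r0 [C C0 HC]; exists (C + C); first by rewrite addr_ge0.
move=> a N m a1; have p0 : 0 < p by apply: lt_le_trans p1.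
pose A (n : 'I_N) := if (m <= n)%N then a n else (a n)^*.
pose B (n : 'I_N) := - (0 +i* 1)%C * (if (m <= n)%N then a n else - (a n)^*).
pose e (n : 'I_N) := `|lambda n - lambda m|.
pose chi (n : 'I_N) := ech m n.
have fam : analytic_family beta e chi := ech_family m N.
pose F1 x := \sum_(n < N | (m <= n)%N) a n * chi n x.
pose F2 x := \sum_(n < N | ~~ (m <= n)%N) (a n)^* * chi n x.
have AE x : apoly A e chi 0 x = F1 x + F2 x.
  rewrite apolyE (bigID (fun n : 'I_N => (m <= n)%N))/=; congr (_ + _).
    by apply: eq_bigr => n mn; rewrite /A mn mulr0 oppr0 expR0 mulr1.
  by apply: eq_bigr => n /negbTE mn; rewrite /A mn mulr0 oppr0 expR0 mulr1.
have BE x : apoly B e chi 0 x = - (0 +i* 1)%C * (F1 x - F2 x).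
  rewrite apolyE (bigID (fun n : 'I_N => (m <= n)%N))/= mulrBr /F1 /F2 !mulr_sumr.
  rewrite -sumrN; congr (_ + _).
    by apply: eq_bigr => n mn; rewrite /B mn mulr0 oppr0 expR0 mulr1 mulrA.
  by apply: eq_bigr => n /negbTE mn; rewrite /B mn mulr0 oppr0 expR0 mulr1; ring.
have FE x : hpoly a N x * (h m x)^* = F1 x + (F2 x)^*.
  rewrite /hpoly mulr_suml (bigID (fun n : 'I_N => (m <= n)%N))/= /F2 cconj_sum.
  congr (_ + _); apply: eq_bigr => n mn; rewrite /chi /ech.
    by rewrite mn mulrA.
  by rewrite (negbTE mn) !cconjM !conjK; ring.
have hF x : cabs (hpoly a N x) = cabs (F1 x + (F2 x)^*).
  by rewrite -FE cabsM cabsJ cabs_h mulr1.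
have UE x : cabs (hpoly (upper a m) N x) = cabs (F1 x).
  rewrite -[LHS]mulr1 -(cabs_h m x) -(cabsJ (h m x)) -cabsM; congr cabs.
  rewrite /hpoly /F1 mulr_suml [RHS]big_mkcond; apply: eq_bigr => n _.
  by rewrite /upper /chi /ech; case: ifP => _; rewrite ?mul0r// mulrA.
(* By injectivity of [lambda] the constant term is the single coefficient with index m, a Fourier
   coefficient of P, and so at most the L_1-norm of P. *)
have Ecoef (D : 'I_N -> R[i]) : (forall n : 'I_N, cabs (D n) = cabs (a n)) ->
    forall x, cabs (\sum_(i | e i == 0) D i * chi i x) <= 1.
  move=> Da x.
  have e0 (n : 'I_N) : (e n == 0) = (n == m :> nat).
    rewrite normr_eq0 subr_eq0; apply/eqP/eqP => [/lambda_inj//|->//].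
  have [mN|Nm] := ltnP m N; last first.
    rewrite big_pred0 ?cabs0// => n; rewrite e0; apply/negbTE.
    by rewrite neq_ltn (leq_trans (ltn_ord n) Nm).
  rewrite (big_pred1 (Ordinal mN)); last by move=> n; exact: e0.
  rewrite cabsM Da /= (_ : cabs (chi _ x) = 1) ?mulr1; last by case: fam.
  rewrite -(hpoly_coef a mN); apply: (le_trans (cabs_cint mu Gc _)).
    by apply: ccontM; [exact: hpoly_cont|apply: ccontJ; exact: hcont].
  rewrite (@eq_gint _ _ mu _ (fun x => cabs (hpoly a N x))); last first.
    by move=> y; rewrite cabsM cabsJ cabs_h mulr1.
  by apply: gint_abs_le1 a1 => //; exact: hpoly_cont.
have cp (f : G -> R) : continuous f -> continuous (fun x => `|f x| `^ p) by exact: powR_cont.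
have cA D : ccont (apoly D e chi 0) by apply: apoly_cont; case: fam.
have part D (f : G -> R[i]) : ccont f -> (forall n : 'I_N, cabs (D n) = cabs (a n)) ->
    (forall x, `|RE (apoly D e chi 0 x)| <= cabs (hpoly a N x)) ->
    gint mu (fun x => cabs (apoly D e chi 0 x) `^ r) <= C.
  move=> cf Da Dle; apply: HC => //; first exact: Ecoef.
  apply: le_trans a1; apply: le_gint => //; first by apply: cp; case: (cA D).
    rewrite (_ : (fun _ => _) = fun x => `|cabs (hpoly a N x)| `^ p).
      by apply: cp; apply: cont_cabs; exact: hpoly_cont.
    by apply/funext => x; rewrite ger0_norm// cabs_ge0.
  by move=> x; apply: ge0_ler_powR; rewrite ?nnegrE ?cabs_ge0// ltW.
have hA : gint mu (fun x => cabs (apoly A e chi 0 x) `^ r) <= C.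
  apply: (part A (hpoly a N)); first exact: hpoly_cont.
    by move=> n; rewrite /A; case: ifP => _ //; rewrite cabsJ.
  move=> x; rewrite AE hF.
  by rewrite -(_ : RE (F1 x + (F2 x)^*) = RE (F1 x + F2 x)) ?Re_le_cabs// !cReD cReJ.
have hB : gint mu (fun x => cabs (apoly B e chi 0 x) `^ r) <= C.
  apply: (part B (hpoly a N)); first exact: hpoly_cont.
    move=> n; rewrite /B cabsM cabsN (_ : cabs (0 +i* 1)%C = 1) ?mul1r; last first.
      by rewrite cabsE /= expr0n expr1n add0r sqrtr1.
    by case: ifP => _ //; rewrite cabsN cabsJ.
  move=> x; rewrite BE hF.
  rewrite (_ : RE (- (0 +i* 1)%C * (F1 x - F2 x)) = IM (F1 x + (F2 x)^*)) ?Im_le_cabs//.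
  by rewrite cReM !(cImD, cImJ, cImN) /=; ring.
have cr D : continuous (fun x => cabs (apoly D e chi 0 x) `^ r).
  rewrite (_ : (fun _ => _) = fun x => `|cabs (apoly D e chi 0 x)| `^ r).
    by apply: powR_cont => //; apply: cont_cabs.
  by apply/funext => x; rewrite ger0_norm// cabs_ge0.
apply: (@le_trans _ _ (gint mu (fun x => cabs (apoly A e chi 0 x) `^ r +
    cabs (apoly B e chi 0 x) `^ r))); last by rewrite gintD// lerD.
apply: le_gint => //.
- rewrite (_ : (fun _ => _) = fun x => `|cabs (hpoly (upper a m) N x)| `^ r).
    by apply: powR_cont => //; apply: cont_cabs; exact: hpoly_cont.
  by apply/funext => x; rewrite ger0_norm// cabs_ge0.
- by move=> x; apply: cvgD; exact: cr.
- move=> x; apply: powR_half_le; rewrite ?cabs_ge0 ?(ltW r0)//.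
  rewrite UE AE BE ler_pdivlMr//.
  have -> : cabs (- (0 +i* 1)%C * (F1 x - F2 x)) = cabs (F1 x - F2 x).
    by rewrite cabsM cabsN (_ : cabs (0 +i* 1)%C = 1) ?mul1r// cabsE /= expr0n expr1n add0r sqrtr1.
  have -> : cabs (F1 x) * 2 = cabs ((F1 x + F2 x) + (F1 x - F2 x)).
    rewrite (_ : _ + _ = F1 x * 2%:C%C); last by apply: complexP; rewrite ?cReM ?cImM !(cReD, cImD, cReB, cImB, cReN, cImN) /=; ring.
    by rewrite cabsM cabs_real ger0_norm.
  exact: cabsD.
Qed.

End DirichletPolynomials.

(** * Norms of blocks *)

(* [|t| <= K^{1-r} |t|^r + K^{1-q} |t|^q], integrated, interpolates between the
   exponents [r < 1 < q]. *)
Lemma le_powR_split {R : realType} (r q K t : R) : 0 < r -> r <= 1 -> 1 <= q -> 0 < K -> 0 <= t ->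
  t <= K `^ (1 - r) * t `^ r + K `^ (1 - q) * t `^ q.
Proof.
move=> r0 r1 q1 K0; rewrite le_eqVlt => /predU1P[<-|t0].
  by rewrite addr_ge0// mulr_ge0// powR_ge0.
have pD (x s : R) : 0 < x -> x `^ (1 - s) * x `^ s = x.
  move=> x0; have e : (1 - s + s == 0) ==> (x != 0) by apply/implyP => _; rewrite gt_eqF.
  by rewrite -(powRD e) subrK powRr1// ltW.
have [tK|Kt] := leP t K.
  apply: (@le_trans _ _ (K `^ (1 - r) * t `^ r)).
    rewrite -[leLHS](pD t r t0) ler_wpM2r ?powR_ge0//.
    by apply: ge0_ler_powR; rewrite ?nnegrE; lra.
  by rewrite lerDl mulr_ge0// powR_ge0.
apply: (@le_trans _ _ (K `^ (1 - q) * t `^ q)).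
  rewrite -[leLHS](pD t q t0) ler_wpM2r ?powR_ge0//.
  by apply: le_powR_base_le0 => //; [exact: ltW|lra].
by rewrite lerDr mulr_ge0// powR_ge0.
Qed.

Lemma nrm1E {R : realType} {G : topologicalZmodType} (mu : probability (borel G) R) F :
  compact [set: G] -> ccont F -> nrm mu 1%:E F = gint mu (fun x => cabs (F x)).
Proof.
move=> Gc cF; have := @nrm_pow _ _ mu 1 F ltr01; rewrite powRr1 ?nrm_ge0// => ->.
by apply: eq_gint => x; rewrite powRr1// cabs_ge0.
Qed.

Section BlockBound.
Context {R : realType} {G : topologicalZmodType} (mu : probability (borel G) R).
Variables (lambda : nat -> R) (beta : R -> G) (h : nat -> G -> R[i]).
Hypothesis dg : dirichlet_group lambda mu beta h.
Hypothesis freq : frequency lambda.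
Let Gc := dgroup_compact dg.
Let Gh := dgroup_haar dg.
Local Notation hpoly := (hpoly h).

Definition blk (a : nat -> R[i]) (n1 n2 n : nat) : R[i] :=
  if (n1 <= n < n2)%N then a n else 0.

Lemma blkE a n1 n2 n : (n1 <= n2)%N -> blk a n1 n2 n = upper a n1 n - upper a n2 n.
Proof.
move=> n12; rewrite /blk /upper; case: (leqP n1 n) => [n1n|nn1]/=; last first.
  by rewrite leqNgt (leq_trans nn1 n12) subr0.
by case: (leqP n2 n) => _; rewrite ?subr0 ?subrr.
Qed.

Lemma cpow_cont (r : R) F : 0 < r -> ccont F -> continuous (fun x : G => cabs (F x) `^ r).
Proof.
move=> r0 cF; rewrite (_ : (fun _ => _) = fun x => `|cabs (F x)| `^ r).
  by apply: powR_cont => //; exact: cont_cabs.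
by apply/funext => x; rewrite ger0_norm// cabs_ge0.
Qed.

(** A block is the difference of two upper parts. The factor 2^r comes from writing the difference
    as twice a mean, so that [powR_half_le] applies also for r < 1. *)
Lemma riesz_block (p r : R) : 1 <= p -> 0 < r -> riesz_bound mu beta p r ->
  exists2 C, 0 <= C & forall a N n1 n2, (n1 <= n2)%N ->
    gint mu (fun x => cabs (hpoly a N x) `^ p) <= 1 ->
    gint mu (fun x => cabs (hpoly (blk a n1 n2) N x) `^ r) <= C.
Proof.
move=> p1 r0 rb; have [C C0 HC] := riesz_upper dg freq p1 r0 rb.
exists (2 `^ r * (C + C)); first by rewrite mulr_ge0 ?powR_ge0// addr_ge0.
move=> a N n1 n2 n12 a1.
have cu m := cpow_cont r0 (hpoly_cont dg (upper a m) N).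
have c2 : continuous (fun x => cabs (hpoly (upper a n1) N x) `^ r +
    cabs (hpoly (upper a n2) N x) `^ r) by move=> x; apply: cvgD; exact: cu.
apply: (@le_trans _ _ (gint mu (fun x => 2 `^ r * (cabs (hpoly (upper a n1) N x) `^ r +
    cabs (hpoly (upper a n2) N x) `^ r)))); last first.
  by rewrite gintZ// gintD// ler_wpM2l ?powR_ge0// lerD// HC.
apply: le_gint => //; first exact: cpow_cont r0 (hpoly_cont dg _ N).
  by move=> x; apply: cvgM; [exact: cvg_cst|exact: c2].
move=> x; rewrite -[X in cabs X](_ : 2%:C%C * (2^-1%:C%C * hpoly (blk a n1 n2) N x) = _); last first.
  rewrite mulrA -rmorphM /= divff ?mul1r// pnatr_eq0//.
rewrite cabsM cabs_real ger0_norm// powRM ?cabs_ge0// ler_wpM2l ?powR_ge0//.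
apply: powR_half_le; rewrite ?cabs_ge0 ?(ltW r0)//.
rewrite cabsM cabs_real ger0_norm ?invr_ge0// mulrC ler_wpM2r ?invr_ge0//.
have -> : hpoly (blk a n1 n2) N x = hpoly (upper a n1) N x - hpoly (upper a n2) N x.
  by rewrite -hpolyB; apply: eq_hpoly => n _; exact: blkE.
by apply: (le_trans (cabsD _ _)); rewrite cabsN.
Qed.

Lemma nrm_pow1 (p : R) F : 1 <= p -> ccont F -> nrm mu p%:E F <= 1 ->
  gint mu (fun x => cabs (F x) `^ p) <= 1.
Proof.
move=> p1 cF F1; have p0 : 0 < p by apply: lt_le_trans p1.
have e1 : (1 : R) = 1 `^ p by rewrite powR1.
rewrite -nrm_pow// [leRHS]e1; apply: ge0_ler_powR; rewrite ?nnegrE ?ler01 ?(ltW p0)//.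
exact: nrm_ge0.
Qed.

(** Let X be the L_q-norm. The L_1-norm is split at a level K proportional to X: the part above K is
    absorbed by X itself, the part below K is controlled by the r-th moment. For q infinite the
    level is X, nothing lies above it, and s = 0. *)
Lemma interpolation_bound (q : \bar R) (r C0 : R) : (1 < q)%E -> 0 < r -> r < 1 -> 0 <= C0 ->
  exists2 C1, 0 <= C1 & exists2 s, s = (if q is r'%:E then (r' - 1)^-1 else 0) &
  forall F M, ccont F -> 1 <= M -> nrm mu q F <= M * nrm mu 1%:E F ->
    gint mu (fun x => cabs (F x) `^ r) <= C0 ->
    nrm mu q F `^ r <= C1 * M `^ (1 + (1 - r) * s).
Proof.
case: q => [q| |] // q1 r0 r1 C00; last first.
  exists C0 => //; exists 0 => // F M cF M1 FM Fr.
  have M0 : 0 <= M by lra.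
  set X := nrm mu +oo F in FM *.
  have : 0 <= X by exact: nrm_ge0.
  rewrite le_eqVlt => /predU1P[<-|X0].
    by rewrite powR0 ?gt_eqF// mulr_ge0// powR_ge0.
  rewrite mulr0 addr0 powRr1// mulrC.
  have cr := cpow_cont r0 cF.
  have h1 : nrm mu 1%:E F <= X `^ (1 - r) * C0.
    rewrite nrm1E//; apply: (@le_trans _ _ (X `^ (1 - r) * gint mu (fun x => cabs (F x) `^ r))).
      rewrite -gintZ//; apply: le_gint => //; first exact: cont_cabs.
        by move=> x; apply: cvgM; [exact: cvg_cst|exact: cr].
      move=> x; have : 0 <= cabs (F x) by exact: cabs_ge0.
      rewrite le_eqVlt => /predU1P[<-|f0]; first by rewrite mulr_ge0// powR_ge0.
      have e : (1 - r + r == 0) ==> (cabs (F x) != 0) by apply/implyP => _; rewrite gt_eqF.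
      have E : cabs (F x) `^ (1 - r) * cabs (F x) `^ r = cabs (F x).
        by rewrite -(powRD e) subrK powRr1// ltW.
      rewrite -[leLHS]E ler_wpM2r ?powR_ge0//; apply: ge0_ler_powR; rewrite ?nnegrE; [lra|exact: ltW|exact: ltW|].
      exact: cabs_le_nrmy.
    by rewrite ler_wpM2l// powR_ge0.
  have e : (1 - r + r == 0) ==> (X != 0) by apply/implyP => _; rewrite gt_eqF.
  have E : X `^ (1 - r) * X `^ r = X by rewrite -(powRD e) subrK powRr1// ltW.
  have p0 : 0 < X `^ (1 - r) by rewrite powR_gt0.
  rewrite -(ler_pM2l p0) E; apply: (le_trans FM).
  by rewrite mulrCA ler_wpM2l.
rewrite lte_fin in q1; set s := (q - 1)^-1.
have qm0 : 0 < q - 1 by lra.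
have s0 : 0 < s by rewrite invr_gt0.
exists (2 * C0 * 2 `^ ((1 - r) * s)); first by rewrite !mulr_ge0// powR_ge0.
exists s => // F M cF M1 FM Fr.
have M0 : 0 < M by exact: lt_le_trans M1.
have q1e : (1 <= q%:E)%E by rewrite lee_fin ltW.
set X := nrm mu q%:E F in FM *.
have : 0 <= X by exact: nrm_ge0.
rewrite le_eqVlt => /predU1P[<-|X0].
  by rewrite powR0 ?gt_eqF// !mulr_ge0// powR_ge0.
(* Solves M K^(1 - q) X^q = X / 2: the part above the level takes exactly half of the left-hand
   side. *)
pose K := (2 * M) `^ s * X.
have K0 : 0 < K by rewrite mulr_gt0// powR_gt0// mulr_gt0.
have cr := cpow_cont r0 cF.
have cq : continuous (fun x => cabs (F x) `^ q) by apply: cpow_cont => //; lra.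
have cZ (b : R) (f : G -> R) : continuous f -> continuous (fun x => b * f x).
  by move=> cf x; apply: cvgM; [exact: cvg_cst|exact: cf].
have h1 : nrm mu 1%:E F <= K `^ (1 - r) * C0 + K `^ (1 - q) * X `^ q.
  rewrite nrm1E// /X nrm_pow; last lra.
  apply: (@le_trans _ _ (K `^ (1 - r) * gint mu (fun x => cabs (F x) `^ r) +
      K `^ (1 - q) * gint mu (fun x => cabs (F x) `^ q))); last first.
    by rewrite lerD2r ler_wpM2l// powR_ge0.
  rewrite -!gintZ// -gintD; [|by []|exact: cZ|exact: cZ].
  apply: le_gint => //; first exact: cont_cabs.
    by move=> x; apply: cvgD; [exact: (cZ _ _ cr)|exact: (cZ _ _ cq)].
  by move=> x; apply: le_powR_split; rewrite ?cabs_ge0//; lra.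
have XD (x c d : R) : 0 < x -> x `^ c * x `^ d = x `^ (c + d).
  move=> x0; have e : (c + d == 0) ==> (x != 0) by apply/implyP => _; rewrite gt_eqF.
  by rewrite (powRD e).
have M20 : 0 <= 2 * M by lra.
have E1 : K `^ (1 - q) * X `^ q = X / (2 * M).
  rewrite /K powRM ?powR_ge0 ?(ltW X0)// -powRrM -mulrA XD// subrK powRr1 ?(ltW X0)//.
  rewrite (_ : s * (1 - q) = - 1); last by rewrite /s; field; rewrite gt_eqF.
  by rewrite powRN powRr1// mulrC.
have h2 : X <= 2 * (M * (K `^ (1 - r) * C0)).
  have := ler_wpM2l (ltW M0) h1; rewrite E1 mulrDr.
  have -> : M * (X / (2 * M)) = X / 2 by field; rewrite gt_eqF.
  by lra.
have p0 : 0 < X `^ (1 - r) by rewrite powR_gt0.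
rewrite -(ler_pM2l p0) XD// subrK powRr1 ?(ltW X0)//.
apply: (le_trans h2); rewrite /K powRM ?powR_ge0 ?(ltW X0)// -powRrM powRM ?(ltW M0)//.
rewrite -(XD M 1 ((1 - r) * s))// powRr1 ?(ltW M0)//.
rewrite [s * (1 - r)]mulrC le_eqVlt; apply/orP; left; apply/eqP; ring.
Qed.

(** For p > 1 the projection onto the block is bounded on L_p, and M <= M^(1 + eps). For p = 1 only
    an r-th moment with r < 1 is available, and interpolation gives the exponent (1 + (1 - r) s) /
    r, which tends to 1 with r. *)
Lemma block_bound (p : R) (q : \bar R) (eps : R) : 1 <= p -> (p%:E < q)%E -> 0 < eps ->
  exists2 C, 0 <= C & forall M a N n1 n2, 1 <= M -> (n1 <= n2)%N ->
    (forall b, nrm mu q (hpoly (blk b n1 n2) N) <= M * nrm mu p%:E (hpoly (blk b n1 n2) N)) ->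
    nrm mu p%:E (hpoly a N) <= 1 ->
    nrm mu q (hpoly (blk a n1 n2) N) <= C * M `^ (1 + eps).
Proof.
move=> p1 pq eps0.
have q1 : (1 < q)%E by apply: le_lt_trans pq; rewrite lee_fin.
move: p1; rewrite le_eqVlt => /predU1P[p1|p1]; last first.
  have p0 : 0 < p by lra.
  have [C C0 HC] := riesz_block (ltW p1) p0 (riesz_strong Gc Gh beta p1).
  exists (C `^ p^-1); first exact: powR_ge0.
  move=> M a N n1 n2 M1 n12 Mb a1.
  have M0 : 0 <= M by lra.
  apply: (le_trans (Mb a)); rewrite mulrC; apply: ler_pM => //.
  - by apply: nrm_ge0 => //; exact: hpoly_cont dg _ _.
  - have := HC a N n1 n2 n12 (nrm_pow1 (ltW p1) (hpoly_cont dg a N) a1).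
    rewrite -nrm_pow// => H.
    have h0 := nrm_ge0 mu Gc p%:E (hpoly_cont dg (blk a n1 n2) N).
    rewrite -[leLHS]powRr1// -(divff (lt0r_neq0 p0)) ?powRrM.
    by apply: ge0_ler_powR; rewrite ?nnegrE ?invr_ge0 ?powR_ge0// ltW.
  - rewrite -[leLHS]powRr1//; apply: ler_powR => //; lra.
rewrite -p1 in pq *.
pose s := if q is r'%:E then (r' - 1)^-1 else 0.
have s0 : 0 <= s.
  rewrite /s; move: q1; case: (q) => [q'| |]//; rewrite lte_fin => q'1.
  by rewrite invr_ge0; lra.
(* The solution of 1 + d s = (1 + eps)(1 - d), which makes the final exponent equal to 1 + eps. *)
pose d := eps / (s + 1 + eps); pose r := 1 - d.
have d0 : 0 < d by rewrite divr_gt0//; lra.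
have d1 : d < 1 by rewrite ltr_pdivrMr; lra.
have r0 : 0 < r by rewrite /r; lra.
have r1 : r < 1 by rewrite /r; lra.
have [C0 C00 HC0] := riesz_block (lexx 1) r0 (riesz_weak Gc Gh beta r0 r1).
have [C1 C10 [s' s'E HC1]] := interpolation_bound q1 r0 r1 C00.
have {}s'E : s' = s by rewrite s'E.
exists (C1 `^ r^-1); first exact: powR_ge0.
move=> M a N n1 n2 M1 n12 Mb a1.
have M0 : 0 <= M by lra.
have cB := hpoly_cont dg (blk a n1 n2) N.
have a1' := nrm_pow1 (lexx 1) (hpoly_cont dg a N) a1.
have := HC1 _ M cB M1 (Mb a) (HC0 a N n1 n2 n12 a1').
rewrite s'E => H.
have X0 := nrm_ge0 mu Gc q cB.
have r0' : r != 0 by rewrite gt_eqF.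
have E1 : nrm mu q (hpoly (blk a n1 n2) N) = (nrm mu q (hpoly (blk a n1 n2) N) `^ r) `^ r^-1.
  by rewrite -powRrM divff// powRr1.
rewrite E1.
apply: (@le_trans _ _ ((C1 * M `^ (1 + (1 - r) * s)) `^ r^-1)).
  by apply: ge0_ler_powR; rewrite ?nnegrE ?invr_ge0 ?powR_ge0 ?mulr_ge0 ?powR_ge0 ?(ltW r0).
rewrite powRM ?powR_ge0// ler_wpM2l ?powR_ge0// -powRrM.
apply: ler_powR => //; rewrite ler_pdivrMr// /r.
have -> : 1 - (1 - d) = d by ring.
have e : d * (s + 1 + eps) = eps by rewrite /d divfK// gt_eqF//; lra.

have E2 (x y z : R) : (1 + x) * (1 - y) = 1 + x - y * (z + 1 + x) + y * z by ring.
by rewrite (E2 _ _ s) e; lra.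
Qed.

End BlockBound.

(** * Trigonometric kernels *)

Section ComplexIntegral.
Context {R : realType} {G : topologicalZmodType} (mu : probability (borel G) R).
Hypothesis Gc : compact [set: G].
Local Notation RE := (@complex.Re _).
Local Notation IM := (@complex.Im _).

Definition rinteg (f : G -> R) := mu.-integrable [set: borel G] (EFin \o (f : borel G -> R)).

Definition cinteg (F : G -> R[i]) :=
  rinteg (fun x => RE (F x)) /\ rinteg (fun x => IM (F x)).

Lemma cont_rinteg f : continuous f -> rinteg f.
Proof. by move=> cf; exact: cont_integrable. Qed.

Lemma ccont_cinteg F : ccont F -> cinteg F.
Proof. by move=> [c1 c2]; split; exact: cont_rinteg. Qed.

Lemma eq_rinteg f g : f =1 g -> rinteg f -> rinteg g.
Proof. by move=> /funext ->. Qed.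

Lemma rintegD f g : rinteg f -> rinteg g -> rinteg (fun x => f x + g x).
Proof. by move=> rf rg; exact: (integrableD measurableT rf rg). Qed.

Lemma rintegZ f c : rinteg f -> rinteg (fun x => c * f x).
Proof. by move=> rf; exact: (integrableZl measurableT c rf). Qed.

Lemma rintegM f g : rinteg f -> continuous g -> rinteg (fun x => f x * g x).
Proof.
move=> rf cg; have [M M0 HM] := cont_bounded Gc cg.
have b : [bounded (g : borel G -> R) x | x in [set: borel G]].
  by exists M; split; rewrite ?num_real// => x Mx y _ /=; rewrite (le_trans (HM y)) ?ltW.
have H := integrableMl measurableT rf (cont_measurable cg) b.
exact: H.
Qed.

Lemma ler_rinteg f g : measurable_fun [set: borel G] (f : borel G -> R) ->
  rinteg g -> (forall x, `|f x| <= g x) -> rinteg f.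
Proof.
move=> mf rg fg; apply: le_integrable rg => //; first exact/measurable_EFinP.
by move=> x _; rewrite lee_fin (le_trans (fg x))// ler_norm.
Qed.

Lemma rgintD f g : rinteg f -> rinteg g ->
  gint mu (fun x => f x + g x) = gint mu f + gint mu g.
Proof. by move=> rf rg; rewrite !gintE RintegralD. Qed.

Lemma rgintZ f c : rinteg f -> gint mu (fun x => c * f x) = c * gint mu f.
Proof. by move=> rf; rewrite !gintE RintegralZl. Qed.

Lemma le_rgint f g : rinteg f -> rinteg g -> (forall x, f x <= g x) ->
  gint mu f <= gint mu g.
Proof. by move=> rf rg fg; rewrite !gintE; apply: le_Rintegral. Qed.

Lemma cintegM F H : cinteg F -> ccont H -> cinteg (fun x => F x * H x).
Proof.
move=> [F1 F2] [H1 H2]; split.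
  apply: (eq_rinteg _ (rintegD (rintegM F1 H1) (rintegZ (- 1) (rintegM F2 H2)))) => x.
  by rewrite cReM mulN1r.
by apply: (eq_rinteg _ (rintegD (rintegM F1 H2) (rintegM F2 H1))) => x; rewrite cImM.
Qed.

Lemma cintegZ F c : cinteg F -> cinteg (fun x => c * F x).
Proof.
move=> cF; have := cintegM cF (ccont_cst c); congr cinteg.
by apply/funext => x; rewrite mulrC.
Qed.

Lemma rcintD F H : cinteg F -> cinteg H ->
  cint mu (fun x => F x + H x) = cint mu F + cint mu H.
Proof.
move=> [F1 F2] [H1 H2]; apply: complexP; rewrite ?cReD ?cImD /= -rgintD//;
by apply: eq_gint => x; rewrite ?cReD ?cImD.
Qed.

Lemma rcintZ F (c : R[i]) : cinteg F -> cint mu (fun x => c * F x) = c * cint mu F.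
Proof.
move=> [F1 F2]; apply: complexP; rewrite ?cReM ?cImM /=.
  rewrite -mulNr -!rgintZ// -rgintD//; [|exact: rintegZ|exact: rintegZ].
  by apply: eq_gint => x; rewrite cReM mulNr.
rewrite -!rgintZ// -rgintD//; [|exact: rintegZ|exact: rintegZ].
by apply: eq_gint => x; rewrite cImM.
Qed.

Lemma cabs_measurable (F : G -> R[i]) : measurable_fun [set: borel G] ((fun x => RE (F x)) : borel G -> R) ->
  measurable_fun [set: borel G] ((fun x => IM (F x)) : borel G -> R) ->
  measurable_fun [set: borel G] ((fun x => cabs (F x)) : borel G -> R).
Proof.
move=> m1 m2.
rewrite (_ : (fun _ => _) = Num.sqrt \o (fun x : borel G => RE (F x) * RE (F x) + IM (F x) * IM (F x))); last first.
  by apply/funext => x /=; rewrite cabsE !expr2.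
apply: measurableT_comp; last by apply: measurable_funD; apply: measurable_funM.
by apply: continuous_measurable_fun; exact: sqrt_continuous.
Qed.

Lemma cinteg_measurable F : cinteg F ->
  measurable_fun [set: borel G] ((fun x => RE (F x)) : borel G -> R) /\
  measurable_fun [set: borel G] ((fun x => IM (F x)) : borel G -> R).
Proof.
by move=> [i1 i2]; split; apply/measurable_EFinP; apply: measurable_int;
  [exact: i1|exact: i2].
Qed.

Lemma cabs_rinteg F : cinteg F -> rinteg (fun x => cabs (F x)).
Proof.
move=> cF; have [m1 m2] := cinteg_measurable cF; have [i1 i2] := cF.
have n f : rinteg f -> rinteg (fun x => `|f x|) by exact: integrable_norm.
apply: (ler_rinteg _ (rintegD (n _ i1) (n _ i2))); first exact: cabs_measurable.
by move=> x; rewrite ger0_norm ?cabs_ge0// cabs_le.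
Qed.

Lemma cabs_rcint F : cinteg F -> cabs (cint mu F) <= gint mu (fun x => cabs (F x)).
Proof.
move=> cF; have [->|I0] := eqVneq (cabs (cint mu F)) 0.
  by apply: gint_ge0 => x; exact: cabs_ge0.
have I1 : 0 < cabs (cint mu F) by rewrite lt0r I0 cabs_ge0.
rewrite -(ler_pM2l I1) -expr2.
have -> : cabs (cint mu F) ^+ 2 = RE ((cint mu F)^* * cint mu F) by rewrite mulrC mulJ.
rewrite -rcintZ// -rgintZ//; last exact: cabs_rinteg.
apply: le_rgint; [by case: (cintegZ (cint mu F)^* cF)|by apply: rintegZ; exact: cabs_rinteg|].
move=> x; rewrite -(cabsJ (cint mu F)) -cabsM.
exact: (le_trans (ler_norm _) (Re_le_cabs _)).
Qed.

Lemma fourierE F chi : fourier mu F chi = cint mu (fun x => F x * (chi x)^*).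
Proof. by rewrite /fourier /cint !gintE. Qed.

Lemma in_Lp_cinteg q F : (1 <= q)%E -> in_Lp mu q F -> cinteg F.
Proof.
move=> q1 [m1 m2 Lq]; have mc := cabs_measurable m1 m2.
have cL : (fun x : borel G => cabs (F x)) \in Lfun mu 1%:E.
  apply: (@Lfun_subset _ _ _ mu 1 q (lexx _) q1) => //.
    exact: fin_num_measure.
  by rewrite inE; apply/andP; split; rewrite inE.
have ic : rinteg (fun x => cabs (F x)).
  have [H _] := Lfun1_integrable mu (fun x : borel G => cabs (F x)); exact: H.
split; apply: (ler_rinteg _ ic) => // x; [exact: Re_le_cabs|exact: Im_le_cabs].
Qed.

End ComplexIntegral.

Section TrigonometricKernels.
Context {R : realType} {G : topologicalZmodType} (mu : probability (borel G) R).
Variables (lambda : nat -> R) (beta : R -> G) (h : nat -> G -> R[i]).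
Hypothesis dg : dirichlet_group lambda mu beta h.
Hypothesis freq : frequency lambda.
Let Gc := dgroup_compact dg.
Let Gh := dgroup_haar dg.
Local Notation RE := (@complex.Re _).
Local Notation IM := (@complex.Im _).
Local Notation hpoly := (hpoly h).

(* Only the characters whose pullback along [beta] is an explicit [cis] are
   used: this avoids classifying the continuous characters of the line. *)
Definition tchar (chi : G -> R[i]) :=
  character chi /\ exists x : R, forall t : R, chi (beta t) = cis (x * t).

Inductive trig : (G -> R[i]) -> Prop :=
| trig_nil : trig (fun=> 0)
| trig_cons (c : R[i]) chi F : tchar chi -> trig F -> trig (fun x => c * chi x + F x).

Lemma eq_trig F H : F =1 H -> trig F -> trig H.
Proof. by move=> /funext ->. Qed.

Lemma trig_cont F : trig F -> ccont F.
Proof.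
elim=> [|c chi {}F [cchi _] _ cF]; first exact: ccont_cst.
by apply: ccontD => //; apply: ccontM; [exact: ccont_cst|exact: char_ccont].
Qed.

Lemma trigD F H : trig F -> trig H -> trig (fun x => F x + H x).
Proof.
move=> tF tH; elim: tF => [|c chi {}F tc _ IH].
  by apply: eq_trig tH => x; rewrite add0r.
by apply: (eq_trig _ (trig_cons c tc IH)) => x; rewrite addrA.
Qed.

Lemma trigZ F a : trig F -> trig (fun x => a * F x).
Proof.
elim=> [|c chi {}F tc _ IH]; first by apply: (eq_trig _ trig_nil) => x; rewrite mulr0.
by apply: (eq_trig _ (trig_cons (a * c) tc IH)) => x; rewrite mulrDr mulrA.
Qed.

Lemma trig_char chi : tchar chi -> trig chi.
Proof.
by move=> tc; apply: (eq_trig _ (trig_cons 1 tc trig_nil)) => x; rewrite mul1r addr0.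
Qed.

Lemma tcharM chi psi : tchar chi -> tchar psi -> tchar (fun x => chi x * psi x).
Proof.
move=> [c1 [x1 e1]] [c2 [x2 e2]]; split; first exact: charMc.
by exists (x1 + x2) => t; rewrite e1 e2 -cisD mulrDl.
Qed.

Lemma trigM F H : trig F -> trig H -> trig (fun x => F x * H x).
Proof.
move=> tF tH; elim: tF => [|c chi {}F tc _ IH].
  by apply: (eq_trig _ trig_nil) => x; rewrite mul0r.
have : trig (fun x => chi x * H x).
  elim: tH {IH} => [|d psi {}H tp _ IH].
    by apply: (eq_trig _ trig_nil) => x; rewrite mulr0.
  by apply: (eq_trig _ (trig_cons d (tcharM tc tp) IH)) => x; ring.
move=> /(trigZ c) tcH; apply: (eq_trig _ (trigD tcH IH)) => x; ring.
Qed.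

Lemma tchar_h n : tchar (h n).
Proof.
split; first exact: hchar dg n.
by exists (- lambda n) => t; rewrite (dgroup_charE dg) mulNr.
Qed.

Lemma tchar_hJ n : tchar (fun x => (h n x)^*).
Proof.
split; first exact: charJ (hchar dg n).
by exists (lambda n) => t; rewrite (dgroup_charE dg) cisJ opprK.
Qed.

Lemma tchar1 : tchar (fun=> 1).
Proof. by split; [exact: char_one|exists 0 => t; rewrite mul0r cis0]. Qed.

Lemma trig_cst c : trig (fun=> c).
Proof. by apply: (eq_trig _ (trigZ c (trig_char tchar1))) => x; rewrite mulr1. Qed.

Lemma trigX F m : trig F -> trig (fun x => F x ^+ m).
Proof.
move=> tF; elim: m => [|m IH]; first by apply: (eq_trig _ (trig_cst 1)) => x; rewrite expr0.
by apply: (eq_trig _ (trigM tF IH)) => x; rewrite exprS.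
Qed.

Definition conv (f F : G -> R[i]) (x : G) : R[i] := cint mu (fun y => f y * F (x - y)).

Lemma conv_nil f x : conv f (fun=> 0) x = 0.
Proof.
rewrite /conv -[RHS](cint_cst mu 0); apply: eq_cint => y; rewrite mulr0//.
Qed.

Lemma ccont_reflect (F : G -> R[i]) x : ccont F -> ccont (fun y => F (x - y)).
Proof.
have cr : continuous (fun y : G => x - y).
  by move=> y; apply: (continuous_comp (@opp_continuous _ y) (@shift_continuous _ x _)).
move=> [F1 F2]; split => y.
  exact: (continuous_comp (cr y) (F1 _)).
exact: (continuous_comp (cr y) (F2 _)).
Qed.

Lemma conv_cons f c chi F x : cinteg mu f -> character chi -> ccont F ->
  conv f (fun y => c * chi y + F y) x = c * fourier mu f chi * chi x + conv f F x.
Proof.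
move=> fi cchi cF; rewrite /conv fourierE.
have cJ : ccont (fun y => (chi y)^*) by apply: ccontJ; exact: char_ccont.
rewrite (_ : c * cint mu _ * chi x = (c * chi x) * cint mu (fun y => f y * (chi y)^*)); last ring.
rewrite -rcintZ; last exact: cintegM.
rewrite -rcintD; [|by apply: cintegZ => //; exact: cintegM|by apply: cintegM => //; exact: ccont_reflect].
apply: eq_cint => y; have [_ cM _ _] := cchi.
by rewrite cM (charN _ cchi); ring.
Qed.

(** Induction over the characters of F replaces an interchange of integrals: only the constant
    character contributes to either mean, and there both sides agree. *)
Lemma conv_trig f F : cinteg mu f -> trig F ->
  trig (conv f F) /\ cint mu (conv f F) = cint mu f * cint mu F.
Proof.
move=> fi; elim=> [|c chi {}F tc tF [tcF IH]].
  split; first by apply: (eq_trig _ trig_nil) => x; rewrite conv_nil.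
  rewrite (eq_cint mu (conv_nil f)) (cint_cst mu 0); by rewrite mulr0.
have [cchi _] := tc.
have E := fun x => conv_cons c x fi cchi (trig_cont tF).
split; first by apply: (eq_trig _ (trig_cons _ tc tcF)) => x; rewrite E.
have cc := char_ccont cchi.
rewrite (eq_cint mu E) cintD//; [|by apply: ccontM => //; exact: ccont_cst|exact: trig_cont].
rewrite [in RHS]cintD//; [|by apply: ccontM => //; exact: ccont_cst|exact: trig_cont].
rewrite IH mulrDr !cintZ//; congr (_ + _).
have [[x chix]|nchi] := pselect (exists x, chi x != 1).
  by rewrite (cint_char Gc Gh cchi) ?mulr0//; exists x.
have chi1 x : chi x = 1 by apply/eqP/negPn/negP => nx; apply: nchi; exists x.
rewrite (eq_cint mu chi1) cint_cst !mulr1 fourierE mulrC; congr (_ * _).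
by apply: eq_cint => x; rewrite chi1 (conj_real 1) mulr1.
Qed.

(** This is the mean of the reflected function y -> F (x - y), obtained from the orthogonality of
    characters rather than from invariance under inversion. *)
Lemma conv_one F x : trig F -> conv (fun=> 1) F x = cint mu F.
Proof.
have i1 : cinteg mu (fun=> 1) by apply: ccont_cinteg => //; exact: ccont_cst.
elim=> [|c chi {}F tc tF IH]; first by rewrite conv_nil cint_cst.
have [cchi _] := tc; have cc := char_ccont cchi.
rewrite conv_cons//; last exact: trig_cont.
rewrite IH cintD//; [|by apply: ccontM => //; exact: ccont_cst|exact: trig_cont].
rewrite cintZ//; congr (_ + _); rewrite fourierE.
have [[y chiy]|nchi] := pselect (exists y, chi y != 1).
  rewrite (cint_char Gc Gh cchi); last by exists y.
  rewrite (@eq_cint _ _ mu _ (fun x => (chi x)^*)); last by move=> z; rewrite mul1r.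
  rewrite (cint_char Gc Gh (charJ cchi)) ?mulr0 ?mul0r//.
  exists y; apply: contraNneq chiy => e; by rewrite -[chi y]conjK e (conj_real 1).
have chi1 y : chi y = 1 by apply/eqP/negPn/negP => ny; apply: nchi; exists y.
rewrite (eq_cint mu chi1) cint_cst chi1 !mulr1.
rewrite (@eq_cint _ _ mu _ (fun=> 1)) ?cint_cst ?mulr1// => z.
by rewrite chi1 (conj_real 1) mulr1.
Qed.

Definition kcoef (F : G -> R[i]) (n : nat) : R[i] := cint mu (fun x => F x * (h n x)^*).

Lemma kcoef_cons c chi F n : character chi -> ccont F ->
  kcoef (fun x => c * chi x + F x) n = c * (chi == h n)%:R + kcoef F n.
Proof.
move=> cchi cF; have cc := char_ccont cchi.
have cJ : ccont (fun y => (h n y)^*) by apply: ccontJ; exact: hcont dg n.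
rewrite /kcoef -(cint_charM Gc Gh cchi (hchar dg n)) -cintZ//; last exact: ccontM.
rewrite -cintD//; [|by apply: ccontM; [exact: ccont_cst|exact: ccontM]|exact: ccontM].
by apply: eq_cint => x; ring.
Qed.

(** A character of F that is not some [h n] meets a vanishing Fourier coefficient of f, so the
    convolution is a Dirichlet polynomial. Its length is bounded by an N that depends on F only. *)
Lemma conv_hpoly F : trig F -> exists N, (forall n, (N <= n)%N -> kcoef F n = 0) /\
  forall f, cinteg mu f ->
    (forall chi, character chi -> fourier mu f chi != 0 -> exists n, chi = h n) ->
    forall M x, (N <= M)%N ->
    conv f F x = hpoly (fun n => kcoef F n * fourier mu f (h n)) M x.
Proof.
elim=> [|c chi {}F [cchi _] tF [N [HN Hf]]].
  have k0 n : kcoef (fun=> 0) n = 0.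
    by rewrite /kcoef -[RHS](cint_cst mu 0); apply: eq_cint => x; rewrite mul0r.
  exists 0%N; split=> [n _|f fi _ M x _]; first exact: k0.
  by rewrite conv_nil /hpoly big1// => i _; rewrite k0 !mul0r.
have E n := kcoef_cons c n cchi (trig_cont tF).
have [[m chim]|nm] := pselect (exists m, chi = h m); last first.
  have k0 n : kcoef (fun x => c * chi x + F x) n = kcoef F n.
    rewrite E; case: eqP => [e|_]; last by rewrite mulr0 add0r.
    by exfalso; apply: nm; exists n.
  exists N; split=> [n Nn|f fi fs M x NM]; first by rewrite k0 HN.
  rewrite conv_cons//; last exact: trig_cont.
  rewrite (Hf f fi fs M x NM).
  have -> : fourier mu f chi = 0.
    by apply/eqP/negPn/negP => /(fs _ cchi) [n e]; apply: nm; exists n.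
  by rewrite mulr0 mul0r add0r; apply: eq_hpoly => n _; rewrite k0.
have E' n : kcoef (fun x => c * chi x + F x) n = c * (n == m)%:R + kcoef F n.
  rewrite E chim; congr (_ * _%:R + _).
  by congr nat_of_bool; apply/eqP/eqP => [/(h_inj dg freq)|] ->.
exists (maxn N m.+1); split=> [n|f fi fs M x]; rewrite geq_max => /andP[Nn mn].
  by rewrite E' HN// addr0 gtn_eqF// mulr0.
rewrite conv_cons//; last exact: trig_cont.
rewrite (Hf f fi fs M x Nn) /hpoly -[X in X + _](_ : \sum_(n < M) c * (n == m :> nat)%:R * fourier mu f (h n) * h n x = _).
  by rewrite -big_split; apply: eq_bigr => i _; rewrite E' /=; ring.
rewrite (bigD1 (Ordinal mn))//= big1 ?addr0 => [|i im].
  by rewrite eqxx mulr1 chim.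
have -> : (i == m :> nat) = false by apply: contraNF im => /eqP e; apply/eqP/val_inj.
by rewrite mulr0 !mul0r.
Qed.

End TrigonometricKernels.

Section Approximation.
Context {R : realType} {G : topologicalZmodType} (mu : probability (borel G) R).
Variables (lambda : nat -> R) (beta : R -> G) (h : nat -> G -> R[i]).
Hypothesis dg : dirichlet_group lambda mu beta h.
Hypothesis freq : frequency lambda.
Let Gc := dgroup_compact dg.
Let Gh := dgroup_haar dg.
Local Notation RE := (@complex.Re _).
Local Notation IM := (@complex.Im _).
Local Notation hpoly := (hpoly h).
Local Notation trig := (trig beta).
Local Notation conv := (conv mu).
Local Notation kcoef := (kcoef mu h).

Lemma gint_EFin (f : G -> R) : rinteg mu f ->
  ((gint mu f)%:E = \int[mu]_(x in [set: borel G]) (f x)%:E)%E.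
Proof. by move=> fi; rewrite gintE fineK//; exact: integrable_fin_num. Qed.

Section Jensen.
Variable k : G -> R.
Hypotheses (tk : trig (fun x => (k x)%:C%C)) (k0 : forall x, 0 <= k x) (k1 : gint mu k = 1).

Lemma kernel_cont : continuous k.
Proof. by case: (trig_cont tk). Qed.

Lemma kernel_reflect_cont x : continuous (fun y => k (x - y)).
Proof. by case: (ccont_reflect x (trig_cont tk)). Qed.

Lemma kernel_reflect x : gint mu (fun y => k (x - y)) = 1.
Proof.
have := congr1 RE (conv_one dg x tk); rewrite /conv /cint /= => e.
rewrite -k1 -e; by apply: eq_gint => y; rewrite ?cReM /= ?mul1r ?mul0r ?subr0.
Qed.

Lemma conv_le f x : cinteg mu f ->
  cabs (conv f (fun x => (k x)%:C%C) x) <= gint mu (fun y => cabs (f y) * k (x - y)).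
Proof.
move=> fi; have H := cabs_rcint Gc (cintegM Gc fi (ccont_reflect x (trig_cont tk))).
rewrite /conv; apply: (le_trans H).
rewrite le_eqVlt; apply/orP; left; apply/eqP/eq_gint => y.
by rewrite cabsM cabs_real ger0_norm.
Qed.

Lemma conv_real g x :
  RE (conv (fun x => (g x)%:C%C) (fun x => (k x)%:C%C) x) = gint mu (fun y => g y * k (x - y)).
Proof. by apply: eq_gint => y; rewrite cReM /= mul0r subr0. Qed.

(** Convolution with a probability density contracts L_q. For finite q Jensen's inequality holds
    pointwise, and the mean over x of the convolution of |f|^q with k is computed by [conv_trig]. *)
Lemma conv_nrm (q : \bar R) f : (1 <= q)%E -> in_Lp mu q f ->
  ((nrm mu q (conv f (fun x => (k x)%:C%C)))%:E <=
    Lnorm mu q (fun x : borel G => (cabs (f x))%:E))%E.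
Proof.
move=> q1 fq; have fi := in_Lp_cinteg q1 fq.
have [tP _] := conv_trig dg fi tk.
have cP := trig_cont tP.
have ci := cabs_rinteg fi.
have cik x : rinteg mu (fun y => cabs (f y) * k (x - y)).
  by apply: rintegM => //; exact: kernel_reflect_cont.
have kri x : rinteg mu (fun y => k (x - y)).
  by apply: cont_rinteg => //; exact: kernel_reflect_cont.
have [m1 m2 Lq] := fq; have mc := cabs_measurable m1 m2.
case: q q1 fq Lq => [q q1 fq Lq|q1 fq Lq|//]; last first.
  move: Lq; have N0 := @Lnorm_ge0 _ _ _ mu +oo%E (fun x : borel G => (cabs (f x))%:E).
  have LE : Lnorm mu +oo (fun x : borel G => (cabs (f x))%:E) =
      ess_sup mu (abse \o (fun x : borel G => (cabs (f x))%:E)).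
    by rewrite unlock /= probT_gt0.
  move: N0; rewrite LE => N0 Lq.
  have ae := @ess_sup_ge _ _ _ mu (abse \o (fun x : borel G => (cabs (f x))%:E)).
  case: (ess_sup _ _) Lq N0 ae => [M _ M0 ae|//|_ //].
  rewrite lee_fin in M0.
  rewrite lee_fin; apply: (nrm_le mu Gc) => // x; apply: (le_trans (conv_le x fi)).
  rewrite -[leRHS]mulr1 -(kernel_reflect x) -rgintZ// -lee_fin !gint_EFin//; last exact: rintegZ.
  apply: ae_ge0_le_integral => //.
  - by move=> y _; rewrite lee_fin mulr_ge0// cabs_ge0.
  - by apply: measurable_int; exact: cik.
  - by move=> y _; rewrite lee_fin mulr_ge0.
  - by apply: measurable_int; exact: rintegZ.
  - apply: filterS ae => y; rewrite /= lee_fin => h1 _; rewrite lee_fin ler_wpM2r//.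
    by move: h1; rewrite ger0_norm ?cabs_ge0.
rewrite lee_fin in q1.
have q0 : 0 < q by apply: lt_le_trans q1.
have gi : rinteg mu (fun y => cabs (f y) `^ q).
  have cL : (fun x : borel G => cabs (f x)) \in Lfun mu q%:E.
    by rewrite inE; apply/andP; split; rewrite inE.
  apply: (eq_rinteg _ (Lfun_integrable q1 cL)) => x /=.
  by rewrite ger0_norm ?cabs_ge0.
have gci : cinteg mu (fun y => (cabs (f y) `^ q)%:C%C).
  by split=> //; apply: cont_rinteg => // x; exact: cvg_cst.
have [tg cg] := conv_trig dg gci tk.
have step x : cabs (conv f (fun x => (k x)%:C%C) x) `^ q <=
    RE (conv (fun y => (cabs (f y) `^ q)%:C%C) (fun x => (k x)%:C%C) x).
  rewrite conv_real; set s := cabs _.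
  have s0 : 0 <= s by exact: cabs_ge0.
  have gik : rinteg mu (fun y => cabs (f y) `^ q * k (x - y)).
    by apply: rintegM => //; exact: kernel_reflect_cont.
  (* The tangent at s, the modulus of the convolution at x, is integrated against the density k (x -
     y) of mean 1; since s is at most the integral of |f| against this density, s^q is left on the
     smaller side. *)
  have : gint mu (fun y => (q * s `^ (q - 1)) * (cabs (f y) * k (x - y))) <=
      gint mu (fun y => cabs (f y) `^ q * k (x - y) + ((q - 1) * s `^ q) * k (x - y)).
    apply: le_rgint; [exact: rintegZ|by apply: rintegD => //; exact: rintegZ|].
    move=> y; rewrite mulrA -mulrDl ler_wpM2r//; apply: powR_tangent => //; exact: cabs_ge0.
  rewrite rgintZ// rgintD//; last exact: rintegZ.
  rewrite rgintZ// kernel_reflect mulr1 => H.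
  have := conv_le x fi; rewrite -/s => sle.
  have : q * s `^ q <= q * s `^ (q - 1) * gint mu (fun y => cabs (f y) * k (x - y)).
    rewrite -mulrA ler_wpM2l ?(ltW q0)//.
    apply: le_trans (ler_wpM2l (powR_ge0 _ _) sle).
    have [->|sn0] := eqVneq s 0; first by rewrite powR0 ?gt_eqF// mulr0.
    have e : (q - 1 + 1 == 0) ==> (s != 0) by apply/implyP.
    by rewrite -[X in _ `^ _ * X](powRr1 s0) -(powRD e) subrK.
  by move=> H2; have := le_trans H2 H; rewrite mulrBl mul1r; lra.
have : gint mu (fun x => cabs (conv f (fun x => (k x)%:C%C) x) `^ q) <=
    gint mu (fun y => cabs (f y) `^ q).
  have e : gint mu (fun x => RE (conv (fun y => (cabs (f y) `^ q)%:C%C) (fun x => (k x)%:C%C) x)) =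
      gint mu (fun y => cabs (f y) `^ q) * gint mu k - gint mu (fun=> 0) * gint mu (fun=> 0).
    exact: etrans (congr1 RE cg) (cReM _ _).
  have := le_gint mu Gc (cpow_cont q0 cP) (trig_cont tg).1 step.
  by rewrite e k1 mulr1 gint_cst mul0r subr0.
rewrite -nrm_pow// => H.
have E : Lnorm mu q%:E (fun x : borel G => (cabs (f x))%:E) =
    ((gint mu (fun y => cabs (f y) `^ q)) `^ q^-1)%:E.
  rewrite unlock -poweR_EFin (gint_EFin gi); congr (_ `^ _)%E.
  by apply: eq_integral => x _; rewrite /= ger0_norm ?cabs_ge0.
rewrite E lee_fin.
have N0 := nrm_ge0 mu Gc q%:E cP.
rewrite -[leLHS](_ : (nrm mu q%:E (conv f (fun x => (k x)%:C%C)) `^ q) `^ q^-1 = _); last first.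
  by rewrite -powRrM divff ?gt_eqF// powRr1.
by apply: ge0_ler_powR; rewrite ?nnegrE ?invr_ge0 ?powR_ge0 ?(ltW q0)// gint_ge0// => x; rewrite powR_ge0.
Qed.

End Jensen.
Local Notation w N := (fun x => \prod_(n < N) ((1 + RE (h n x)) / 2)).

Lemma cabs_one_sub_h n x : cabs (1 - h n x) ^+ 2 = 2 - 2 * RE (h n x).
Proof.
have := congr1 (fun z : R => z ^+ 2) (cabs_h dg n x).
rewrite cabs_sqr cabs_sqr cReB cImB /= => e; rewrite expr1n in e.
by rewrite (_ : 2 = 1 + 1 :> R)// -{2}e; ring.
Qed.

Lemma half_h_le1 n x : 0 <= (1 + RE (h n x)) / 2 <= 1.
Proof.
have := Re_le_cabs (h n x); rewrite (cabs_h dg) ler_norml => /andP[h1 h2].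
by apply/andP; split; lra.
Qed.

Lemma trig_prod N : trig (fun x => (w N x)%:C%C).
Proof.
elim: N => [|N IH].
  by apply: (eq_trig _ (trig_cst beta 1)) => x; rewrite big_ord0.
have t1 : trig (fun x => ((1 + RE (h N x)) / 2)%:C%C).
  have := trigD (trig_cst beta (2^-1)%:C%C) (trigD (trigZ (4^-1)%:C%C (trig_char (tchar_h dg N)))
    (trigZ (4^-1)%:C%C (trig_char (tchar_hJ dg N)))).
  apply: eq_trig => x; apply: complexP; rewrite !(cReD, cImD, cReM, cImM, cReJ, cImJ, cReN, cImN) /=; by field.
by apply: (eq_trig _ (trigM IH t1)) => x; rewrite -rmorphM big_ord_recr.
Qed.

(** The product W lies in [0, 1], equals 1 at 0 and is bounded away from 1 wherever some [h n] with
    n < N0 is far from 1. Its normalised powers therefore concentrate where all these characters are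
    close to 1; no neighbourhood basis of 0 is involved. *)
Lemma kernel_exists N0 (eps : R) : 0 < eps -> exists k : G -> R,
  [/\ trig (fun x => (k x)%:C%C), forall x, 0 <= k x, forall x, k (- x) = k x, gint mu k = 1 &
     forall n, (n < N0)%N -> gint mu (fun x => k x * cabs (1 - h n x)) <= eps].
Proof.
move=> eps0; pose e := Num.min eps 1.
have e0 : 0 < e by rewrite lt_min eps0/=.
have e1 : e <= 1 by rewrite ge_min lexx orbT.
have ele : e <= eps by rewrite ge_min lexx.
have ee : e ^+ 2 <= 1 by rewrite expr_le1// ltW.
have ee0 : 0 < e ^+ 2 by rewrite exprn_gt0.
pose W := w N0.
have W0 x : 0 <= W x by apply: prodr_ge0 => i _; case/andP: (half_h_le1 i x).
have W1 x : W x <= 1 by apply: prodr_ile1 => i _; exact: half_h_le1.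
have cW : continuous W by case: (trig_cont (trig_prod N0)).
(* As |1 - h_n|^2 = 2 - 2 Re h_n, a distance above e / 2 gives (1 + Re h_n) / 2 <= rho. The larger
   rho' leaves room for a lower bound on the mean of W^m. *)
pose rho := 1 - e ^+ 2 / 16; pose rho' := 1 - e ^+ 2 / 32.
have rho0 : 0 < rho by rewrite /rho; lra.
have rho'0 : 0 < rho' by rewrite /rho'; lra.
have rr : rho < rho' by rewrite /rho /rho'; lra.
(* The positive part of W - rho', positive at 0 and hence of positive mean; rho'^m g is a continuous
   minorant of W^m. *)
pose g x := (`|W x - rho'| + (W x - rho')) / 2.
have cg : continuous g.
  have c1 : continuous (fun x => W x - rho').
    by move=> x; apply: cvgB; [exact: cW|exact: cvg_cst].
  have c2 : continuous (fun x => `|W x - rho'| + (W x - rho')).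
    by move=> x; apply: cvgD; [apply: cvg_norm; exact: c1|exact: c1].
  by move=> x; apply: cvgM; [exact: c2|exact: cvg_cst].
have g0 x : 0 <= g x by rewrite /g; case: (ger0P (W x - rho')) => ?; lra.
have W00 : W 0 = 1.
  rewrite /W big1// => i _; rewrite (char0 (hchar dg i)) /=; lra.
have gg : 0 < gint mu g.
  apply: (gint_gt0 Gc Gh cg g0 (x := 0)).
  by rewrite /g W00 ger0_norm /rho'; lra.
have WX m x : rho' ^+ m * g x <= W x ^+ m.
  have [Wr|rW] := leP (W x) rho'.
    by rewrite /g ler0_norm ?subr_le0// addrC subrr mul0r mulr0 exprn_ge0.
  apply: (@le_trans _ _ (rho' ^+ m)); last by rewrite lerXn2r ?nnegrE ?(ltW rW)// ltW.
  rewrite ler_piMr ?exprn_ge0 ?(ltW rho'0)//.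
  by rewrite /g ger0_norm ?subr_ge0 ?(ltW rW)//; have := W1 x; lra.
have r1 : `|rho / rho'| < 1.
  by rewrite ger0_norm ?divr_ge0 ?(ltW rho0) ?(ltW rho'0)// ltr_pdivrMr// mul1r.
(* Far from 1 the integrand is at most 2 rho^m, while the normalising constant is at least rho'^m
   times the mean of g; m is taken so large that the quotient is below e / 2. *)
have [m Hm] : exists m, 2 * (rho / rho') ^+ m <= e / 2 * gint mu g.
  have c0 : 0 < e / 2 * gint mu g / 2 by rewrite divr_gt0// mulr_gt0// divr_gt0.
  have := cvg_expr r1 => /cvgrPdist_lt /(_ _ c0) [m _ /(_ m (leqnn m))] /=.
  rewrite sub0r normrN ger0_norm ?exprn_ge0 ?divr_ge0 ?(ltW rho0) ?(ltW rho'0)// => Hm.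
  by exists m; lra.
pose Z := gint mu (fun x => W x ^+ m).
have tWm : trig (fun x => (W x ^+ m)%:C%C).
  by apply: (eq_trig _ (trigX m (trig_prod N0))) => x; rewrite rmorphXn.
have cWm : continuous (fun x => W x ^+ m) by case: (trig_cont tWm).
have Zge : rho' ^+ m * gint mu g <= Z.
  rewrite -gintZ//; apply: le_gint => //.
  by move=> x; apply: cvgM; [exact: cvg_cst|exact: cg].
have Z0 : 0 < Z by apply: lt_le_trans Zge; rewrite mulr_gt0// exprn_gt0.
exists (fun x => Z^-1 * W x ^+ m); split.
- by apply: (eq_trig _ (trigZ (Z^-1)%:C%C tWm)) => x; rewrite rmorphM.
- by move=> x; rewrite mulr_ge0 ?invr_ge0 ?(ltW Z0)// exprn_ge0.
- move=> x; congr (_ * _ ^+ _); apply: eq_bigr => i _.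
  by rewrite (charN _ (hchar dg i)) cReJ.
- by rewrite gintZ// mulVf// gt_eqF.
move=> n nN; apply: le_trans ele.
have ch : continuous (fun x => cabs (1 - h n x)).
  apply: cont_cabs; apply: ccontD; first exact: ccont_cst.
  have cN := ccontM (ccont_cst (-1)) (hcont dg n).
  by move: cN; congr ccont; apply/funext => x; rewrite mulN1r.
have pt x : W x ^+ m * cabs (1 - h n x) <= e / 2 * W x ^+ m + 2 * rho ^+ m.
  have [hle|hgt] := leP (cabs (1 - h n x)) (e / 2).
    apply: (@le_trans _ _ (e / 2 * W x ^+ m)).
      by rewrite mulrC ler_wpM2r// exprn_ge0.
    by rewrite lerDl mulr_ge0// exprn_ge0// ltW.
  have hsq := cabs_one_sub_h n x.
  have sqe : (e / 2) ^+ 2 <= cabs (1 - h n x) ^+ 2.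
    by rewrite lerXn2r ?nnegrE ?cabs_ge0 ?(ltW hgt)// divr_ge0// ltW.
  rewrite hsq exprMn in sqe.
  have hr : (1 + RE (h n x)) / 2 <= rho by rewrite /rho; lra.
  have Wr : W x <= rho.
    rewrite /W (bigD1 (Ordinal nN))//=; apply: le_trans hr.
    case/andP: (half_h_le1 n x) => a0 a1; rewrite ler_piMr//.
    by apply: prodr_ile1 => i _; exact: half_h_le1.
  have h2 : cabs (1 - h n x) <= 2.
    by rewrite (le_trans (cabsD _ _))// cabsN cabs1 (cabs_h dg).
  apply: (@le_trans _ _ (rho ^+ m * 2)); last first.
    by rewrite mulrC lerDr mulr_ge0 ?exprn_ge0// divr_ge0// ltW.
  apply: ler_pM; rewrite ?exprn_ge0 ?cabs_ge0//.
  by rewrite lerXn2r ?nnegrE// ltW.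
have cl : continuous (fun x => e / 2 * W x ^+ m).
  by move=> x; apply: cvgM; [exact: cvg_cst|exact: cWm].
have cc : continuous (fun _ : G => 2 * rho ^+ m) by move=> x; exact: cvg_cst.
have cp : continuous (fun x => W x ^+ m * cabs (1 - h n x)).
  by move=> x; apply: cvgM; [exact: cWm|exact: ch].
have -> : gint mu (fun x => Z^-1 * W x ^+ m * cabs (1 - h n x)) =
    Z^-1 * gint mu (fun x => W x ^+ m * cabs (1 - h n x)).
  by rewrite -gintZ//; apply: eq_gint => x; rewrite mulrA.
rewrite mulrC ler_pdivrMr//.
apply: (@le_trans _ _ (e / 2 * Z + 2 * rho ^+ m)).
  rewrite -gintZ// -(gint_cst mu (2 * rho ^+ m)) -gintD//.
  apply: le_gint => //; by move=> x; apply: cvgD; [exact: cl|exact: cc].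
have : 2 * rho ^+ m <= e / 2 * Z.
  apply: (@le_trans _ _ (e / 2 * (rho' ^+ m * gint mu g))); last first.
    by rewrite ler_wpM2l// divr_ge0// ltW.
  rewrite mulrCA; apply: (@le_trans _ _ (rho' ^+ m * (2 * (rho / rho') ^+ m))).
    have p0 : rho' ^+ m != 0 by rewrite expf_neq0// gt_eqF.
    rewrite expr_div_n; move: (rho ^+ m) (rho' ^+ m) p0 => x y y0.
    by rewrite [y * _]mulrC -mulrA divfK.
  by rewrite ler_wpM2l// exprn_ge0// ltW.
by lra.
Qed.

Definition spectral (f : G -> R[i]) :=
  forall chi, character chi -> fourier mu f chi != 0 -> exists n, chi = h n.

(** The multipliers are the Fourier coefficients of the kernel, and |kap n - 1| is at most the mean
    of k |1 - h_n|. Neither [kap] nor N depends on q or f, so one kernel serves a series and its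
    partial sums at the same time. *)
Lemma approximate_identity N0 (eps : R) : 0 < eps -> exists (kap : nat -> R[i]) N,
  [/\ forall n, (N <= n)%N -> kap n = 0, forall n, (n < N0)%N -> cabs (kap n - 1) <= eps &
    forall q f M, (1 <= q)%E -> in_Lp mu q f -> spectral f -> (N <= M)%N ->
      ((nrm mu q (hpoly (fun n => kap n * fourier mu f (h n)) M))%:E <=
       Lnorm mu q (fun x : borel G => (cabs (f x))%:E))%E].
Proof.
move=> eps0; have [k [tk k0 _ k1 Hk]] := kernel_exists N0 eps0.
have [N [HN Hf]] := conv_hpoly dg freq tk.
exists (kcoef (fun x => (k x)%:C%C)), N; split=> //.
  move=> n nN; apply: le_trans (Hk n nN).
  have ck := trig_cont tk.
  have cJ : ccont (fun y => (h n y)^*) by apply: ccontJ; exact: hcont dg n.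
  have K1 : cint mu (fun x => (k x)%:C%C) = 1 by rewrite /cint /= k1 gint_cst.
  have cN : ccont (fun x => - 1 * (k x)%:C%C) by apply: ccontM => //; exact: ccont_cst.
  have E : kcoef (fun x => (k x)%:C%C) n - 1 =
      cint mu (fun x => (k x)%:C%C * (h n x)^* + - 1 * (k x)%:C%C).
    by rewrite cintD//; [rewrite cintZ// K1 mulr1|exact: ccontM].
  rewrite E; apply: (le_trans (cabs_cint mu Gc _)); first by apply: ccontD => //; exact: ccontM.
  rewrite le_eqVlt; apply/orP; left; apply/eqP/eq_gint => x.
  rewrite (_ : _ + _ = (k x)%:C%C * (h n x - 1)^*); last first.
    by apply: complexP; rewrite !(cReD, cImD, cReM, cImM, cReJ, cImJ, cReN, cImN) /=; ring.
  by rewrite cabsM cabsJ cabs_real ger0_norm// cabsB.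
move=> q f M q1 fq sf NM.
rewrite -(eq_nrm mu q (fun x => congr1 cabs (Hf f (in_Lp_cinteg q1 fq) sf M x NM))).
exact: conv_nrm.
Qed.

End Approximation.

(** * Time averages *)

Section TimeAverage.
Context {R : realType}.
Implicit Types (f g : R -> R) (T x : R).

Definition avg T f : R := (2 * T)^-1 * \int[lebesgue_measure]_(t in `[- T, T]) f t.

Lemma itv_integrable f T : continuous f ->
  lebesgue_measure.-integrable `[- T, T] (EFin \o f).
Proof.
move=> cf; apply: continuous_compact_integrable; first exact: segment_compact.
exact: continuous_subspaceT.
Qed.

Lemma avgD T f g : continuous f -> continuous g ->
  avg T (fun t => f t + g t) = avg T f + avg T g.
Proof. by move=> cf cg; rewrite /avg RintegralD ?mulrDr//; exact: itv_integrable. Qed.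

Lemma avgZ T f c : continuous f -> avg T (fun t => c * f t) = c * avg T f.
Proof.
move=> cf; have := @RintegralZl _ _ _ (@lebesgue_measure R) _ _ c (measurable_itv `[- T, T]) (itv_integrable T cf).
by rewrite /avg => ->; rewrite mulrCA.
Qed.

Lemma avg_cst T c : 0 < T -> avg T (fun=> c) = c.
Proof.
move=> T0; rewrite /avg Rintegral_cst//= lebesgue_measure_itv /= lte_fin gtrN// -EFinB /=.
by field; rewrite gt_eqF.
Qed.

Lemma le_avg T f g : 0 < T -> continuous f -> continuous g -> (forall t, f t <= g t) ->
  avg T f <= avg T g.
Proof.
move=> T0 cf cg fg; rewrite ler_wpM2l ?invr_ge0 ?mulr_ge0 ?(ltW T0)//.
by apply: le_Rintegral => //; exact: itv_integrable.
Qed.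

Lemma avg_primitive T f (F : R -> R) : 0 < T -> continuous f ->
  (forall x : R, is_derive x 1 F (f x)) -> avg T f = (2 * T)^-1 * (F T - F (- T)).
Proof.
move=> T0 cf dF; congr (_ * _).
have cF : continuous F.
  by move=> x; apply: differentiable_continuous; apply/derivable1_diffP; case: (dF x).
rewrite /Rintegral (@continuous_FTC2 _ f F) //.
- by rewrite gtrN.
- exact: continuous_subspaceT.
- split; [by move=> x _; case: (dF x)| |].
    by apply: cvg_at_right_filter; exact: cF.
  by apply: cvg_at_left_filter; exact: cF.
- by move=> x _; rewrite derive1E; apply: derive_val.
Qed.

Lemma cos_cont x : continuous (fun t => cos (x * t)).
Proof.
move=> t; apply: (@continuous_comp _ _ _ (fun t => x * t) cos); last exact: continuous_cos.
by apply: cvgM; [exact: cvg_cst|exact: cvg_id].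
Qed.

Lemma sin_cont x : continuous (fun t => sin (x * t)).
Proof.
move=> t; apply: (@continuous_comp _ _ _ (fun t => x * t) sin); last exact: continuous_sin.
by apply: cvgM; [exact: cvg_cst|exact: cvg_id].
Qed.

Lemma is_derive_linear x (t : R) : is_derive t 1 (fun t : R => x * t) x.
Proof.
apply: (is_derive_eq (@is_deriveZ _ _ _ (id : R -> R) x t 1 1 (is_derive_id _ _))).
by rewrite /GRing.scale /= mulr1.
Qed.

Lemma avg_cos T x : 0 < T -> x != 0 -> `|avg T (fun t => cos (x * t))| <= (T * `|x|)^-1.
Proof.
move=> T0 x0.
have dF (t : R) : is_derive t 1 (fun t => x^-1 * sin (x * t)) (cos (x * t)).
  have -> : cos (x * t) = x^-1 * (cos (x * t) * x) by field.
  have d := is_derive_linear x t.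
  have d2 := @is_derive1_comp _ sin (fun t => x * t) t _ _ (is_derive_sin (x * t)) d.
  exact: (@is_deriveZ _ _ _ (fun t => sin (x * t)) x^-1 t 1 _ d2).
rewrite (avg_primitive T0 (cos_cont (x := x)) dF).
rewrite mulrN sinN.
have -> : (2 * T)^-1 * (x^-1 * sin (x * T) - x^-1 * - sin (x * T)) = (T * x)^-1 * sin (x * T).
  by field; rewrite x0 gt_eqF.
rewrite normrM normfV normrM (gtr0_norm T0).
rewrite ler_piMr ?invr_ge0 ?mulr_ge0 ?(ltW T0)//.
by rewrite ler_norml sin_geN1 sin_le1.
Qed.

Lemma avg_sin T x : 0 < T -> avg T (fun t => sin (x * t)) = 0.
Proof.
move=> T0; have [->|x0] := eqVneq x 0.
  rewrite (_ : (fun _ => _) = fun=> 0) ?avg_cst//; by apply/funext => t; rewrite mul0r sin0.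
have dF (t : R) : is_derive t 1 (fun t => - x^-1 * cos (x * t)) (sin (x * t)).
  have -> : sin (x * t) = - x^-1 * (- sin (x * t) * x) by field.
  have d := is_derive_linear x t.
  have d2 := @is_derive1_comp _ cos (fun t => x * t) t _ _ (is_derive_cos (x * t)) d.
  exact: (@is_deriveZ _ _ _ (fun t => cos (x * t)) (- x^-1) t 1 _ d2).
rewrite (avg_primitive T0 (sin_cont (x := x)) dF).
by rewrite mulrN cosN subrr mulr0.
Qed.

Definition avg_to f (L : R) :=
  forall e, 0 < e -> exists2 T0 : R, 0 < T0 & forall T, T0 < T -> `|avg T f - L| <= e.

Lemma avg_toD f g L M : continuous f -> continuous g -> avg_to f L -> avg_to g M ->
  avg_to (fun t => f t + g t) (L + M).
Proof.
move=> cf cg fL gM e e0; have e2 : 0 < e / 2 by rewrite divr_gt0.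
have [T1 T10 H1] := fL _ e2; have [T2 T20 H2] := gM _ e2.
exists (Num.max T1 T2); first by rewrite lt_max T10.
move=> T; rewrite gt_max => /andP[/H1 h1 /H2 h2].
rewrite avgD// opprD addrACA (le_trans (ler_normD _ _))//; lra.
Qed.

Lemma avg_to_cst c : avg_to (fun=> c) c.
Proof.
by move=> e e0; exists 1 => // T T1; rewrite avg_cst ?subrr ?normr0 ?(ltW e0)//; lra.
Qed.

Lemma avg_toZ f L c : continuous f -> avg_to f L -> avg_to (fun t => c * f t) (c * L).
Proof.
move=> cf fL e e0; have c0 : 0 < `|c| + 1 by rewrite ltr_pwDr.
have [T1 T10 H1] := fL _ (divr_gt0 e0 c0).
exists T1 => // T /H1 h1; rewrite avgZ// -mulrBr normrM.
apply: (@le_trans _ _ ((`|c| + 1) * `|avg T f - L|)); first by rewrite ler_wpM2r// lerDl.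
by rewrite mulrC -ler_pdivlMr.
Qed.

Lemma avg_to_cos x : x != 0 -> avg_to (fun t => cos (x * t)) 0.
Proof.
move=> x0 e e0; have nx : 0 < `|x| by rewrite normr_gt0.
exists (e * `|x|)^-1; first by rewrite invr_gt0 mulr_gt0.
move=> T HT; have T0 : 0 < T by apply: lt_trans HT; rewrite invr_gt0 mulr_gt0.
rewrite subr0; apply: (le_trans (avg_cos T0 x0)).
rewrite invf_ple ?posrE ?mulr_gt0//.
move: HT; rewrite invfM ltr_pdivrMr// => /ltW //.
Qed.

Lemma avg_to_sin x : avg_to (fun t => sin (x * t)) 0.
Proof.
by move=> e e0; exists 1 => // T T1; rewrite avg_sin ?subrr ?normr0 ?(ltW e0)//; lra.
Qed.

Lemma avg_to_approx f L : continuous f ->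
  (forall e, 0 < e -> exists g M, [/\ continuous g, avg_to g M, `|M - L| <= e &
    forall t, `|f t - g t| <= e]) -> avg_to f L.
Proof.
move=> cf H e e0; have e3 : 0 < e / 3 by rewrite divr_gt0.
have [g [M [cg gM ML fg]]] := H _ e3; have [T1 T10 H1] := gM _ e3.
exists T1 => // T TT; have T0 : 0 < T by apply: lt_trans TT.
have cc : continuous (fun _ : R => e / 3) by move=> t; exact: cvg_cst.
have cc' : continuous (fun _ : R => - (e / 3)) by move=> t; exact: cvg_cst.
have h1 := H1 _ TT.
have h2 : avg T f <= avg T g + e / 3.
  rewrite -(avg_cst (e / 3) T0) -avgD//; apply: le_avg => //.
    by move=> t; apply: cvgD; [exact: cg|exact: cc].
  by move=> t; have := fg t; rewrite ler_norml => /andP[]; lra.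
have h3 : avg T g + - (e / 3) <= avg T f.
  rewrite -(avg_cst (- (e / 3)) T0) -avgD//; apply: le_avg => //.
    by move=> t; apply: cvgD; [exact: cg|exact: cc'].
  by move=> t; have := fg t; rewrite ler_norml => /andP[]; lra.
move: h1 ML; rewrite !ler_norml => /andP[a1 a2] /andP[b1 b2]; apply/andP; split; lra.
Qed.

Lemma avg_to_cvg f L : avg_to f L -> avg T f @[T --> +oo] --> L.
Proof.
move=> fL; apply/cvgrPdist_le => e e0; have [T0 _ HT] := fL _ e0.
exists T0; split; first exact: num_real.
by move=> T /HT; rewrite distrC.
Qed.

End TimeAverage.

Section MeanNorm.
Context {R : realType} {G : topologicalZmodType} (mu : probability (borel G) R).
Variables (lambda : nat -> R) (beta : R -> G) (h : nat -> G -> R[i]).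
Hypothesis dg : dirichlet_group lambda mu beta h.
Hypothesis freq : frequency lambda.
Let Gc := dgroup_compact dg.
Let Gh := dgroup_haar dg.
Local Notation RE := (@complex.Re _).
Local Notation IM := (@complex.Im _).
Local Notation hpoly := (hpoly h).
Local Notation trig := (trig beta).
Local Notation conv := (conv mu).

Lemma beta_cont (f : G -> R) : continuous f -> continuous (fun t : R => f (beta t)).
Proof.
move=> cf t; apply: (@continuous_comp _ _ _ beta f t); last exact: cf.
exact: (dgroup_continuous dg).
Qed.

Lemma dense_le (f : G -> R) S : continuous f -> (forall t : R, f (beta t) <= S) ->
  forall x, f x <= S.
Proof.
move=> cf fS x; rewrite leNgt; apply/negP => Sx.
have oU : open [set y : G | S < f y] by exact: (open_comp (fun y _ => cf y) (@open_gt _ S)).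
have [z [Sz [t _ tz]]] := dgroup_dense dg (ex_intro _ x Sx) oU.
by move: Sz; rewrite -tz /= ltNge fS.
Qed.

Lemma tchar_avg chi (c : R[i]) : tchar beta chi ->
  avg_to (fun t => RE (c * chi (beta t))) (RE (c * cint mu chi)).
Proof.
move=> [cchi [x xE]].
have E : (fun t => RE (c * chi (beta t))) = (fun t => RE c * cos (x * t) + (- IM c) * sin (x * t)).
  by apply/funext => t; rewrite xE cReM /= mulNr.
rewrite E.
have -> : RE (c * cint mu chi) = RE c * (if x == 0 then 1 else 0) + (- IM c) * 0.
  rewrite mulr0 addr0; case: eqVneq => [x0|x0].
    (* A character that is 1 on the dense range of [beta] is 1 everywhere: its real part is at least
       1 by density, and its modulus is 1. *)
    have r1 y : 1 <= RE (chi y).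
      rewrite -lerN2; apply: (@dense_le (fun y => - RE (chi y))) => [z|t].
        by apply: cvgN; case: cchi => _ _ + _; exact.
      by rewrite xE x0 mul0r cis0.
    have chi1 y : chi y = 1.
      have [c1 _ _ _] := cchi; have := congr1 (fun z : R => z ^+ 2) (c1 y).
      rewrite cabs_sqr expr1n => e; have r := r1 y.
      have i2 := sqr_ge0 (IM (chi y)).
      have rr : RE (chi y) = 1.
        apply/eqP; rewrite eq_le r andbT leNgt; apply/negP => r2.
        have : 1 < RE (chi y) ^+ 2 by rewrite expr_gt1// (le_trans _ r).
        by lra.
      apply: complexP => //=; move: e; rewrite rr expr1n => e.
      by apply/eqP; rewrite -sqrf_eq0; apply/eqP; lra.
    by rewrite (eq_cint mu chi1) cint_cst !mulr1.
  rewrite (cint_char Gc Gh cchi) ?mulr0//.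
  have [//|nex] := pselect (exists y, chi y != 1).
  move/eqP: x0; case; apply: cis_eq1 => t; rewrite -xE.
  by apply/eqP/negPn/negP => ny; apply: nex; exists (beta t).
have cc y : continuous (fun t : R => y * cos (x * t)).
  by move=> t; apply: cvgM; [exact: cvg_cst|exact: cos_cont].
have cs y : continuous (fun t : R => y * sin (x * t)).
  by move=> t; apply: cvgM; [exact: cvg_cst|exact: sin_cont].
apply: avg_toD => //; apply: avg_toZ; [exact: cos_cont| |exact: sin_cont|exact: avg_to_sin].
case: eqVneq => [->|]; last exact: avg_to_cos.
rewrite (_ : (fun _ => _) = fun=> 1); first exact: avg_to_cst.
by apply/funext => t; rewrite mul0r cos0.
Qed.

Lemma trig_avg F : trig F -> avg_to (fun t => RE (F (beta t))) (gint mu (fun x => RE (F x))).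
Proof.
elim=> [|c chi {}F tc tF IH]; first by rewrite gint_cst; exact: avg_to_cst.
have [cchi _] := tc.
have cc := ccontM (ccont_cst c) (char_ccont cchi).
have cF := trig_cont tF.
have -> : gint mu (fun x => RE (c * chi x + F x)) = RE (c * cint mu chi) + gint mu (fun x => RE (F x)).
  rewrite -(cintZ mu Gc c (char_ccont cchi)) /=.
  rewrite -gintD//; [|by case: cc|by case: cF].
  by apply: eq_gint => x; rewrite cReD.
have -> : (fun t => RE (c * chi (beta t) + F (beta t))) =
    (fun t => RE (c * chi (beta t)) + RE (F (beta t))).
  by apply/funext => t; rewrite cReD.
apply: avg_toD => //; [apply: (beta_cont (f := fun x => RE (c * chi x))); by case: cc| |exact: tchar_avg].
by apply: (beta_cont (f := fun x => RE (F x))); case: cF.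
Qed.

Lemma powR_lipschitz (r B u v : R) : 1 <= r -> 0 <= u -> 0 <= v -> u <= B -> v <= B ->
  `|u `^ r - v `^ r| <= r * B `^ (r - 1) * `|u - v|.
Proof.
move=> r1; have r0 : 0 < r by apply: lt_le_trans r1.
wlog vu : u v / v <= u.
  move=> H u0 v0 uB vB; have [/H|/ltW /H] := leP v u; first exact.
  by rewrite distrC [`|v - u|]distrC; exact.
move=> u0 v0 uB vB.
have uv : v `^ r <= u `^ r by apply: ge0_ler_powR; rewrite ?nnegrE// ltW.
rewrite !ger0_norm ?subr_ge0//.
have := powR_tangent r1 u0 v0.
have -> : (r - 1) * u `^ r = r * u `^ (r - 1) * u - u `^ r.
  have [->|un0] := eqVneq u 0; first by rewrite powR0 ?gt_eqF// !mulr0 subr0.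
  have e : (r - 1 + 1 == 0) ==> (u != 0) by apply/implyP.
  by rewrite -mulrA -[X in _ `^ _ * X](powRr1 u0) -(powRD e) subrK; ring.
move=> H; apply: (@le_trans _ _ (r * u `^ (r - 1) * (u - v))); first by rewrite mulrBr; lra.
rewrite ler_wpM2r ?subr_ge0// ler_wpM2l ?(ltW r0)//.
apply: ge0_ler_powR; rewrite ?nnegrE ?subr_ge0//; exact: le_trans uB.
Qed.

Lemma hpoly_lip a N x y :
  cabs (hpoly a N y - hpoly a N x) <= \sum_(n < N) cabs (a n) * cabs (1 - h n (x - y)).
Proof.
rewrite /hpoly -sumrB; apply: (le_trans (cabs_sum _ _ _)); apply: ler_sum => n _.
rewrite -mulrBr cabsM ler_wpM2l ?cabs_ge0//.
have [c1 cM _ _] := hchar dg n.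
have -> : h n y - h n x = h n y * (1 - h n (x - y)).
  by rewrite mulrBr mulr1 -cM; congr (_ - h n _); rewrite addrC subrK.
by rewrite cabsM c1 mul1r.
Qed.

(** The function |P|^r is not a trigonometric polynomial, but its convolution with a kernel
    concentrated where [h n] is close to 1 for n < N is one, and has known time averages. Since
    |P|^r is Lipschitz with respect to these finitely many characters, the convolution is uniformly
    close to it. *)
Lemma nrm_avg (r : R) a N : 1 <= r ->
  avg_to (fun t => cabs (hpoly a N (beta t)) `^ r) (gint mu (fun x => cabs (hpoly a N x) `^ r)).
Proof.
move=> r1; have r0 : 0 < r by apply: lt_le_trans r1.
have cP := hpoly_cont dg a N.
pose Phi x := cabs (hpoly a N x) `^ r.
have cPhi : continuous Phi by exact: cpow_cont.
apply: avg_to_approx; first exact: (beta_cont cPhi).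
move=> e e0.
pose B := nrm mu +oo (hpoly a N).
have PB x : cabs (hpoly a N x) <= B by exact: cabs_le_nrmy.
have B0 : 0 <= B by exact: le_trans (cabs_ge0 _) (PB 0).
pose S := r * B `^ (r - 1) * \sum_(n < N) cabs (a n).
have S0 : 0 <= S.
  rewrite !mulr_ge0 ?powR_ge0 ?(ltW r0)//; apply: sumr_ge0 => n _; exact: cabs_ge0.
have d0 : 0 < e / (S + 1) by rewrite divr_gt0// ltr_pwDr.
have [k [tk k0 kN k1 Hk]] := kernel_exists dg N d0.
have ck : continuous k := kernel_cont tk.
have fi : cinteg mu (fun x => (Phi x)%:C%C).
  by apply: ccont_cinteg => //; split => //= x; exact: cvg_cst.
have [tF _] := conv_trig dg fi tk.
set F := conv _ _ in tF.
have close x : `|RE (F x) - Phi x| <= e.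
  have ckr : continuous (fun y => k (x - y)) by exact: (kernel_reflect_cont tk).
  have cPk : continuous (fun y => Phi y * k (x - y)).
    by move=> y; apply: cvgM; [exact: cPhi|exact: ckr].
  have cxk : continuous (fun y => Phi x * k (x - y)).
    by move=> y; apply: cvgM; [exact: cvg_cst|exact: ckr].
  have ch n : continuous (fun z => cabs (1 - h n z)).
    apply: cont_cabs; apply: ccontD; first exact: ccont_cst.
    have cN := ccontM (ccont_cst (-1)) (hcont dg n).
    by move: cN; congr ccont; apply/funext => z; rewrite mulN1r.
  have chk n : continuous (fun z => k z * cabs (1 - h n z)).
    by move=> z; apply: cvgM; [exact: ck|exact: ch].
  have crefl (f : G -> R) : continuous f -> continuous (fun y => f (x - y)).
    move=> cf; have cff : ccont (fun y => (f y)%:C%C).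
      by split => //= z; exact: cvg_cst.
    by case: (ccont_reflect x cff).
  have -> : RE (F x) - Phi x = gint mu (fun y => (Phi y - Phi x) * k (x - y)).
    rewrite /F conv_real//.
    rewrite -[Phi x in LHS]mulr1 -(kernel_reflect dg tk k1 x) -gintZ// -gintB//.
    by apply: eq_gint => y; rewrite mulrBl.
  have c1 : continuous (fun y => (Phi y - Phi x) * k (x - y)).
    move=> y; apply: cvgM; last exact: ckr.
    by apply: cvgB; [exact: cPhi|exact: cvg_cst].
  apply: (le_trans (le_norm_gint mu Gc c1)).
  have c2 : continuous (fun y => \sum_(n < N) cabs (a n) * (k (x - y) * cabs (1 - h n (x - y)))).
    apply: cont_sum => n y; apply: cvgM; first exact: cvg_cst.
    exact: (crefl _ (chk n)).
  apply: (@le_trans _ _ (gint mu (fun y => r * B `^ (r - 1) *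
      \sum_(n < N) cabs (a n) * (k (x - y) * cabs (1 - h n (x - y)))))).
    apply: le_gint => //.
    - by move=> y; apply: cvg_norm; exact: c1.
    - by move=> y; apply: cvgM; [exact: cvg_cst|exact: c2].
    move=> y; rewrite normrM [`|k _|]ger0_norm//.
    have : `|Phi y - Phi x| <= r * B `^ (r - 1) * \sum_(n < N) cabs (a n) * cabs (1 - h n (x - y)).
      apply: (le_trans (powR_lipschitz r1 (cabs_ge0 _) (cabs_ge0 _) (PB y) (PB x))).
      rewrite ler_wpM2l ?mulr_ge0 ?powR_ge0 ?(ltW r0)//.
      exact: (le_trans (dist_cabs _ _) (hpoly_lip _ _ _ _)).
    move=> /(ler_wpM2r (k0 (x - y))) => HH; apply: (le_trans HH).
    have : 0 <= r * B `^ (r - 1) by rewrite mulr_ge0 ?powR_ge0 ?(ltW r0).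
    move: (r * _) => c c0; rewrite -[leLHS]mulrA ler_wpM2l//.
    by rewrite mulr_suml; apply: ler_sum => n _; rewrite -mulrA [cabs (1 - _) * _]mulrC.
  rewrite gintZ; [|by []|exact: c2].
  rewrite gint_sum//; last first.
    by move=> n y; apply: cvgM; [exact: cvg_cst|exact: (crefl _ (chk n))].
  apply: (@le_trans _ _ (r * B `^ (r - 1) * \sum_(n < N) cabs (a n) * (e / (S + 1)))).
    rewrite ler_wpM2l ?mulr_ge0 ?powR_ge0 ?(ltW r0)//; apply: ler_sum => n _.
    rewrite gintZ; [|by []|exact: (crefl _ (chk n))].
    rewrite ler_wpM2l ?cabs_ge0//; apply: le_trans (Hk n (ltn_ord n)).
    have := gint_shift Gc Gh x (crefl _ (chk n)) => <-.
    rewrite le_eqVlt; apply/orP; left; apply/eqP/eq_gint => y.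
    rewrite opprD addrA subrr add0r kN (charN _ (hchar dg n)).
    by rewrite -[1 in LHS](conj_real 1) -rmorphB cabsJ.
  rewrite -mulr_suml mulrA -/S mulrCA ler_piMr ?(ltW e0)// ler_pdivrMr ?mul1r ?lerDl//.
  by rewrite ltr_pwDr.
exists (fun t => RE (F (beta t))), (gint mu (fun x => RE (F x))); split.
- by apply: (beta_cont (f := fun x => RE (F x))); case: (trig_cont tF).
- exact: trig_avg.
- have cF : continuous (fun x => RE (F x)) by case: (trig_cont tF).
  rewrite -gintB//; apply: (le_trans (le_norm_gint mu Gc _)).
    by move=> x; apply: cvgB; [exact: cF|exact: cPhi].
  rewrite -[leRHS](gint_cst mu); apply: le_gint => //.
    by move=> x; apply: cvg_norm; apply: cvgB; [exact: cF|exact: cPhi].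
  by move=> x; exact: cvg_cst.
- by move=> t; rewrite distrC.
Qed.

Lemma dnorm_hpoly (q : \bar R) a N : (1 <= q)%E ->
  dnorm q (fun t => hpoly a N (beta t)) = nrm mu q (hpoly a N).
Proof.
have cP := hpoly_cont dg a N.
case: q => [r|_|//]; last first.
  apply/eqP; rewrite eq_le; apply/andP; split.
    apply: ge_sup; first by exists (cabs (hpoly a N (beta 0))); exists 0.
    by move=> _ [t _ <-]; exact: cabs_le_nrmy.
  apply: nrm_le => //; first by rewrite leey.
  apply: (@dense_le (fun x => cabs (hpoly a N x))); first exact: cont_cabs.
  move=> t; apply: ub_le_sup; last by exists t.
  by exists (nrm mu +oo (hpoly a N)) => _ [s _ <-]; exact: cabs_le_nrmy.
rewrite lee_fin => r1; have r0 : 0 < r by apply: lt_le_trans r1.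
have ac := avg_to_cvg (nrm_avg a N r1).
set L := gint mu _ in ac.
have L0 : 0 <= L by apply: gint_ge0 => x; rewrite powR_ge0.
have E : nrm mu r%:E (hpoly a N) = `|L| `^ r^-1.
  have n0 := nrm_ge0 mu Gc r%:E cP.
  have LE : L = nrm mu r%:E (hpoly a N) `^ r by exact: esym (nrm_pow mu _ r0).
  rewrite (ger0_norm L0) LE; move: (nrm _ _ _) n0 => x x0.
  by rewrite -powRrM divff ?(gt_eqF r0)// powRr1.
rewrite E /dnorm; apply/cvg_lim => //.
(* The absolute value makes the root continuous on the whole line, in particular at the limit L =
   0. *)
have pc : continuous (fun x : R => `|x| `^ r^-1).
  apply: (@powR_cont R R^o) => //; first by rewrite invr_gt0.
  by move=> x; exact: cvg_id.
have := cvg_comp (avg ^~ _) (fun x : R => `|x| `^ r^-1) ac (pc L).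
apply: cvg_trans; apply: near_eq_cvg; exists 0; split => // T T0.
rewrite /= ger0_norm// mulr_ge0 ?invr_ge0 ?mulr_ge0 ?(ltW T0)//.
by apply: Rintegral_ge0 => t _; rewrite powR_ge0.
Qed.

End MeanNorm.

(** * Unit blocks of frequencies *)

Section Blocks.
Context {R : realType} {G : topologicalZmodType} (mu : probability (borel G) R).
Variables (lambda : nat -> R) (beta : R -> G) (h : nat -> G -> R[i]).
Hypothesis dg : dirichlet_group lambda mu beta h.
Hypothesis freq : frequency lambda.
Let Gc := dgroup_compact dg.
Let Gh := dgroup_haar dg.
Local Notation hpoly := (hpoly h).

Lemma frequency_ge (j : nat) : exists n, j%:R <= lambda n.
Proof.
have [_ _ linf] := freq; have /cvgryPge/(_ j%:R)[n _ /(_ n (leqnn n)) H] := linf.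
by exists n.
Qed.

(** The frequencies in [j, j + 1) are those with index in the interval from [nb j] to [nb j.+1], the
    latter excluded; it may be empty. *)
Definition nb j : nat := ex_minn (frequency_ge j).

Lemma nbP j n : (nb j <= n)%N = (j%:R <= lambda n).
Proof.
rewrite /nb; case: ex_minnP => m jm Hm; apply/idP/idP => [mn|/Hm//].
exact: le_trans jm (lambda_le freq mn).
Qed.

Lemma nb_ltP j n : (n < nb j)%N = (lambda n < j%:R).
Proof. by rewrite ltnNge nbP -ltNge. Qed.

Lemma nb_le j k : (j <= k)%N -> (nb j <= nb k)%N.
Proof. by move=> jk; rewrite nbP (@le_trans _ _ k%:R) ?ler_nat// -nbP. Qed.

Lemma nb0 : nb 0 = 0%N.
Proof. by apply/eqP; rewrite -leqn0 nbP; case: freq. Qed.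

Lemma nb_unbounded N : exists j, (N <= nb j)%N.
Proof.
exists (Num.truncn (lambda N)).+1; apply: ltnW; rewrite nb_ltP truncnS_gt//.
Qed.

Lemma hpoly_widen a N M x : (N <= M)%N -> (forall n, (N <= n)%N -> a n = 0) ->
  hpoly a M x = hpoly a N x.
Proof.
move=> NM a0; rewrite /hpoly -!(big_mkord xpredT (fun n => a n * h n x)).
rewrite (big_cat_nat _ NM)//= [X in _ + X]big_nat_cond [X in _ + X]big1 ?addr0//.
by move=> n /andP[/andP[Nn _] _]; rewrite a0// mul0r.
Qed.

Definition block (b : nat -> R[i]) j : nat -> R[i] := blk b (nb j) (nb j.+1).

Definition bpoly (b : nat -> R[i]) j : G -> R[i] := hpoly (block b j) (nb j.+1).

Lemma bpoly_cont b j : ccont (bpoly b j).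
Proof. exact: hpoly_cont dg _ _. Qed.

Lemma bpolyE b j M x : (nb j.+1 <= M)%N -> hpoly (block b j) M x = bpoly b j x.
Proof.
move=> jM; apply: hpoly_widen => // n jn.
by rewrite /block /blk ltnNge jn andbF.
Qed.

Lemma eq_bpoly a b j x : (forall n, (nb j <= n < nb j.+1)%N -> a n = b n) ->
  bpoly a j x = bpoly b j x.
Proof.
by move=> ab; apply: eq_hpoly => n _; rewrite /block /blk; case: ifP => // /ab.
Qed.

Lemma hpoly_blocks a J x : hpoly a (nb J) x = \sum_(j < J) bpoly a j x.
Proof.
elim: J => [|J IH]; first by rewrite nb0 /hpoly !big_ord0.
rewrite big_ord_recr /= -IH /bpoly /hpoly -!(big_mkord xpredT (fun n => _ n * h n x)).
rewrite !(big_cat_nat (leq0n (nb J)) (nb_le (leqnSn J)))//=; congr (_ + _).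
rewrite [X in _ = X + _]big_nat_cond [X in _ = X + _]big1 ?add0r; last first.
  by move=> n /andP[/andP[_ nJ] _]; rewrite /block /blk leqNgt nJ mul0r.
by apply: eq_big_nat => n nn; rewrite /block /blk nn.
Qed.

Lemma dpolyE (j : nat) a :
  dpoly (range lambda `&` `[j%:R, j.+1%:R[) a =
  (fun t => bpoly (fun n => a (lambda n)) j (beta t)).
Proof.
apply/funext => t; rewrite /dpoly.
rewrite (@reindex_fsbig _ _ _ _ _ lambda [set n | (nb j <= n < nb j.+1)%N]); last first.
  split=> [n /=|n m _ _|_ [[n _ <-] /=]].
  - by rewrite nbP nb_ltP => H; split; [exists n|rewrite /= in_itv].
  - exact: lambda_inj.
  - by rewrite in_itv /= -nbP -nb_ltP => H; exists n.
rewrite (_ : [set n | _] = `I_(nb j.+1) `&` [set n | (nb j <= n < nb j.+1)%N]); last first.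
  by apply/seteqP; split => [n /= /[dup] /andP[_ ->] ->//|n []].
rewrite fsbig_mkcondr -fsbig_ord; apply: eq_bigr => n _.
rewrite /block /blk (dgroup_charE dg).
have -> : (nat_of_ord n \in [set n | (nb j <= n < nb j.+1)%N]) = (nb j <= n < nb j.+1)%N.
  by apply/idP/idP; rewrite inE.
by case: ifP => // _; rewrite mul0r.
Qed.

(** In [dpoly] the coefficients are indexed by real frequencies, elsewhere by their numbers;
    injectivity of [lambda] links the two. *)
Lemma coef_of_block (b : nat -> R[i]) : exists a : R -> R[i], forall n, a (lambda n) = b n.
Proof.
exists (fun x => if pselect (exists n, lambda n = x) is left e then b (projT1 (cid e)) else 0).
move=> n; case: pselect => [e|]; last by case; exists n.
by congr b; apply: (lambda_inj freq); exact: projT2 (cid e).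
Qed.

Variables p q : \bar R.
Hypotheses (p1 : (1 <= p)%E) (q1 : (1 <= q)%E).
Local Notation Lam j := (Lambda q p (range lambda `&` `[j%:R, j.+1%:R[)).

Lemma dnorm_dpoly (r : \bar R) j a : (1 <= r)%E ->
  dnorm r (dpoly (range lambda `&` `[j%:R, j.+1%:R[) a) =
  nrm mu r (bpoly (fun n => a (lambda n)) j).
Proof. by move=> r1; rewrite dpolyE /bpoly (dnorm_hpoly dg). Qed.

Lemma Lambda_ge1 j : (1 <= Lam j)%E.
Proof. by apply: le_ereal_inf_tmp => _ [C [C1 _] <-]; rewrite lee_fin. Qed.

Lemma Lambda_lt j (M : R) : (Lam j < M%:E)%E ->
  1 <= M /\ forall b, nrm mu q (bpoly b j) <= M * nrm mu p (bpoly b j).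
Proof.
move=> /ereal_inf_lt [_ [C [C1 HC] <-]]; rewrite lte_fin => CM; split.
  by rewrite (le_trans C1)// ltW.
move=> b; have [a aE] := coef_of_block b.
have := HC a; rewrite !dnorm_dpoly// (_ : (fun n => a (lambda n)) = b); last exact/funext.
move=> /le_trans; apply; rewrite ler_wpM2r ?(ltW CM)//.
by apply: nrm_ge0 => //; exact: bpoly_cont.
Qed.

Lemma Lambda_gt j (m : R) : 1 <= m -> (m%:E < Lam j)%E ->
  exists b, m * nrm mu p (bpoly b j) < nrm mu q (bpoly b j).
Proof.
move=> m1 mL; apply: contrapT => nb_; move: mL; rewrite ltNge => /negP; apply.
apply: ereal_inf_lbound; exists m => //; split=> // a.
rewrite !dnorm_dpoly// leNgt; apply/negP => H; apply: nb_.
by exists (fun n => a (lambda n)).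
Qed.

End Blocks.

(** * Summable blocks *)

Section BlockSums.
Context {R : realType} {G : topologicalZmodType} (mu : probability (borel G) R).
Hypothesis Gc : compact [set: G].
Hypothesis Gh : haar mu.
Local Notation RE := (@complex.Re _).
Local Notation IM := (@complex.Im _).

Lemma nrm1_le (q : \bar R) F : (1 <= q)%E -> ccont F -> nrm mu 1%:E F <= nrm mu q F.
Proof.
move=> q1 cF; rewrite nrm1E//; case: q q1 => [q|_|//]; last first.
  rewrite -[leRHS](gint_cst mu); apply: le_gint => //; first exact: cont_cabs.
    by move=> x; exact: cvg_cst.
  by move=> x; exact: cabs_le_nrmy.
rewrite lee_fin => q1; have q0 : 0 < q by apply: lt_le_trans q1.
have cq := cpow_cont q0 cF.
have n0 := nrm_ge0 mu Gc q%:E cF.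
(* The tangent inequality is used at the L_q-norm itself; adding e keeps s positive, so that q s^(q
   - 1) can be cancelled. *)
apply/ler_addgt0Pr => e e0; set s := _ + e.
have s0 : 0 < s by rewrite ltr_wpDl.
have sp : 0 < q * s `^ (q - 1) by rewrite mulr_gt0// powR_gt0.
rewrite -(ler_pM2l sp) -gintZ//; last exact: cont_cabs.
apply: (@le_trans _ _ (gint mu (fun x => cabs (F x) `^ q + (q - 1) * s `^ q))).
  apply: le_gint => //.
  - by move=> x; apply: cvgM; [exact: cvg_cst|exact: cont_cabs].
  - by move=> x; apply: cvgD; [exact: cq|exact: cvg_cst].
  - by move=> x; apply: powR_tangent; rewrite ?(ltW s0) ?cabs_ge0.
rewrite gintD//; last by move=> x; exact: cvg_cst.
rewrite gint_cst -nrm_pow//.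
have e1 : (q - 1 + 1 == 0) ==> (s != 0) by rewrite (gt_eqF s0) implybT.
have -> : q * s `^ (q - 1) * s = q * s `^ q.
  by rewrite -mulrA -[X in _ `^ _ * X](powRr1 (ltW s0)) -(powRD e1) subrK.
have : nrm mu q%:E F `^ q <= s `^ q.
  by apply: ge0_ler_powR; rewrite ?nnegrE ?(ltW q0) ?(ltW s0)// /s lerDl ltW.
rewrite mulrBl mul1r; lra.
Qed.

Variables (q : \bar R) (B : nat -> G -> R[i]) (C rho : R).
Hypotheses (q1 : (1 <= q)%E) (cB : forall j, ccont (B j)) (C0 : 0 <= C).
Hypotheses (rho0 : 0 < rho) (rho1 : rho < 1).
Hypothesis nB : forall j, nrm mu q (B j) <= C * rho ^+ j.

Let M := C * (1 - rho)^-1.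
Let S J x := \sum_(j < J) B j x.
Let g x : \bar R := (\sum_(j <oo) (cabs (B j x))%:E)%E.

Let cS J : ccont (S J).
Proof. by apply: ccont_sum. Qed.

Let geo_le J : \sum_(j < J) C * rho ^+ j <= M.
Proof.
have r1 : `|rho| < 1 by rewrite ger0_norm// ltW.
have := geometric_le_lim J C0 rho0 r1.
by rewrite /series /= big_mkord.
Qed.

Let M0 : 0 <= M. Proof. by have := geo_le 0; rewrite big_ord0. Qed.

Let nS J : nrm mu q (S J) <= M.
Proof.
apply: (le_trans (nrm_sum Gc Gh q1 cB)); apply: le_trans (geo_le J).
by apply: ler_sum => j _; exact: nB.
Qed.

Let mcabs j : measurable_fun [set: borel G] ((fun x => (cabs (B j x))%:E) : borel G -> \bar R).
Proof. by apply/measurable_EFinP; apply: cont_measurable; exact: cont_cabs. Qed.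

(** The L_1-norms of the blocks are at most their L_q-norms, hence summable. So the series converges
    absolutely almost everywhere, with g as a common majorant of all partial sums. *)
Let g_integrable : mu.-integrable [set: borel G] (g : borel G -> \bar R).
Proof.
have g0 (x : borel G) : (0 <= g x)%E.
  by apply: nneseries_ge0 => j _ _; rewrite lee_fin cabs_ge0.
apply/integrableP; split.
  rewrite (_ : g = fun x => (\sum_(j <oo | j \in xpredT) (cabs (B j x))%:E)%E)//.
  by apply: ge0_emeasurable_sum => // j x _ _; rewrite lee_fin cabs_ge0.
under eq_integral do rewrite gee0_abs//.
rewrite integral_nneseries//; last by move=> j x _; rewrite lee_fin cabs_ge0.
apply: (@le_lt_trans _ _ M%:E); last exact: ltry.
apply: lime_le.
  by apply: is_cvg_nneseries => j _ _; apply: integral_ge0 => x _; rewrite lee_fin cabs_ge0.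
apply: nearW => J; apply: (@le_trans _ _ (\sum_(0 <= j < J) (C * rho ^+ j)%:E)%E).
  apply: lee_sum => j _; have cc := cont_rinteg mu Gc (cont_cabs (cB j)).
  rewrite -gint_EFin// lee_fin -nrm1E//.
  exact: le_trans (nrm1_le q1 (cB j)) (nB j).
by rewrite sumEFin lee_fin big_mkord.
Qed.

Let S_le J x : ((cabs (S J x))%:E <= g x)%E.
Proof.
apply: (@le_trans _ _ (\sum_(0 <= j < J) (cabs (B j x))%:E)%E).
  by rewrite sumEFin lee_fin big_mkord; exact: cabs_sum.
by apply: nneseries_lim_ge => j _ _; rewrite lee_fin cabs_ge0.
Qed.

(** The upper limit is defined and measurable everywhere, and it is the limit wherever g is
    finite. *)
Let rlim (L : R[i] -> R) x : R := fine (limn_esup (fun J => (L (S J x))%:E)).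

Let f x : R[i] := (rlim RE x +i* rlim IM x)%C.

Let rlim_measurable (L : R[i] -> R) : (forall J, continuous (fun x => L (S J x))) ->
  measurable_fun [set: borel G] ((fun x => rlim L x) : borel G -> R).
Proof.
move=> cL; apply: (@measurableT_comp _ _ _ _ _ _ (@fine R)); first exact: fine_measurable.
by apply: measurable_fun_limn_esup => J; apply/measurable_EFinP; apply: cont_measurable.
Qed.

Let rlim_cvg (L : R[i] -> R) x : (forall z, `|L z| <= cabs z) ->
  (forall J, L (S J x) = \sum_(j < J) L (B j x)) -> g x \is a fin_num ->
  L (S J x) @[J --> \oo] --> rlim L x.
Proof.
move=> Lle Lsum gx.
have c1 : cvgn (series (fun j => cabs (B j x))).
  apply: nnseries_is_cvg; first by move=> j; exact: cabs_ge0.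
  by rewrite ltey_eq gx.
have c2 : cvgn (series (fun j => L (B j x)) : R^o^nat).
  apply: normed_cvg; apply: series_le_cvg c1 => j /=; [exact: normr_ge0|exact: cabs_ge0|exact: Lle].
have E : series (fun j => L (B j x)) = (fun J => L (S J x)).
  by apply/funext => J; rewrite Lsum /series /= big_mkord.
rewrite E in c2; move/cvg_ex : c2 => [l Hl].
have HE : (L (S J x))%:E @[J --> \oo] --> l%:E by apply: cvg_EFin => //; exact: nearW.
by rewrite /rlim (cvg_limn_einf_sup HE).2.
Qed.

Let f_cvg : {ae mu, forall x : borel G, RE (S J x) @[J --> \oo] --> RE (f x) /\
  IM (S J x) @[J --> \oo] --> IM (f x)}.
Proof.
apply: filterS (integrable_ae measurableT g_integrable) => x /(_ I) gx; split.
  apply: rlim_cvg => //; [exact: Re_le_cabs|by move=> J; exact: cRe_sum].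
apply: rlim_cvg => //; [exact: Im_le_cabs|by move=> J; exact: cIm_sum].
Qed.

Let cabs_cvg : {ae mu, forall x : borel G, cabs (S J x) @[J --> \oo] --> cabs (f x)}.
Proof.
apply: filterS f_cvg => x [h1 h2].
rewrite (_ : (fun J => _) = fun J => Num.sqrt (RE (S J x) * RE (S J x) + IM (S J x) * IM (S J x))).
  rewrite cabsE !expr2.
  have Hs : RE (S J x) * RE (S J x) + IM (S J x) * IM (S J x) @[J --> \oo] -->
      RE (f x) * RE (f x) + IM (f x) * IM (f x) by apply: cvgD; apply: cvgM.
  by apply: (cvg_comp _ _ Hs); exact: sqrt_continuous.
by apply/funext => J; rewrite cabsE !expr2.
Qed.

Let mRE : measurable_fun [set: borel G] ((fun x => RE (f x)) : borel G -> R).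
Proof. by apply: rlim_measurable => J; case: (cS J). Qed.

Let mIM : measurable_fun [set: borel G] ((fun x => IM (f x)) : borel G -> R).
Proof. by apply: rlim_measurable => J; case: (cS J). Qed.

(** The partial sums have L_q-norm at most M. For finite q Fatou's lemma passes this bound to the
    limit; for q infinite the bound holds at each point of convergence. *)
Let f_Lp : in_Lp mu q f.
Proof.
split=> //; apply: (@le_lt_trans _ _ M%:E); last exact: ltry.
have mf := cabs_measurable mRE mIM.
move: nS; case: (q) q1 => [r|_|//] => [r1 nS'|nS']; last first.
  rewrite unlock /= probT_gt0; apply/ess_supP; apply: filterS cabs_cvg => x Hx.
  rewrite -[leLHS]/(`|cabs (f x)|%:E) lee_fin ger0_norm ?cabs_ge0//.
  change (cabs (f x) <= M); rewrite -(cvg_lim _ Hx)//; apply: limr_le; first by apply/cvg_ex; exists (cabs (f x)).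
  by apply: nearW => J; exact: le_trans (cabs_le_nrmy mu Gc x (cS J)) (nS' J).
rewrite lee_fin in r1; have r0 : 0 < r by apply: lt_le_trans r1.
rewrite unlock.
have fat : (\int[mu]_(x in [set: borel G]) (`|cabs (f x)| `^ r)%:E <= (M `^ r)%:E)%E.
  have mS J : measurable_fun [set: borel G] ((fun x => (cabs (S J x) `^ r)%:E) : borel G -> \bar R).
    by apply/measurable_EFinP; apply: cont_measurable; exact: cpow_cont.
  have pos J (x : borel G) : [set: borel G] x -> (0 <= (cabs (S J x) `^ r)%:E)%E.
    by rewrite lee_fin powR_ge0.
  have := fatou mu measurableT mS pos.
  rewrite (ae_eq_integral (fun x : borel G => (`|cabs (f x)| `^ r)%:E))//; last 3 first.
  - rewrite (_ : (fun x : borel G => _) =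
        fun x => (- limn_esup (-%E \o (fun J => (cabs (S J x) `^ r)%:E)))%E); last first.
      by apply/funext => x; rewrite limn_esupN oppeK.
    apply: measurableT_comp; first exact: oppe_measurable.
    by apply: measurable_fun_limn_esup => J; apply: measurableT_comp.
  - apply/measurable_EFinP; apply: (measurableT_comp (measurable_powR _)).
    by apply: measurableT_comp.
  - apply: filterS cabs_cvg => x Hx _.
    have pc : continuous (fun x : R => `|x| `^ r).
      by apply: (@powR_cont R R^o) => // y; exact: cvg_id.
    have := cvg_comp (fun J => cabs (S J x)) (fun x : R => `|x| `^ r) Hx (pc _) => H1.
    have H2 : (cabs (S J x) `^ r)%:E @[J --> \oo] --> (`|cabs (f x)| `^ r)%:E.
      apply: cvg_EFin; first exact: nearW.
      by apply: cvg_trans H1; apply: near_eq_cvg; apply: nearW => J /=; rewrite ger0_norm ?cabs_ge0.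
    by rewrite (cvg_limn_einf_sup H2).1.
  move=> /le_trans; apply; rewrite limn_einf_lim; apply: lime_le; first exact: is_cvg_einfs.
  apply: nearW => J; apply: (@le_trans _ _ (\int[mu]_(x in [set: borel G]) (cabs (S J x) `^ r)%:E)%E).
    by apply: ereal_inf_lbound; exists J => /=.
  rewrite -gint_EFin; last by apply: cont_rinteg => //; exact: cpow_cont.
  rewrite lee_fin -nrm_pow//; apply: ge0_ler_powR; rewrite ?nnegrE ?(ltW r0)//.
  exact: nrm_ge0.
rewrite -[X in (_ <= X%:E)%E](_ : (M `^ r) `^ r^-1 = M); last first.
  by rewrite -powRrM divff ?gt_eqF// powRr1.
rewrite -poweR_EFin; apply: gt0_ler_poweR => //.
- by rewrite invr_ge0 ltW.
- by rewrite in_itv /= leey andbT; apply: integral_ge0 => x _; rewrite lee_fin powR_ge0.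
- by rewrite in_itv /= leey andbT lee_fin powR_ge0.
Qed.

Let dominated (u : nat -> G -> R) (v : G -> R) J0 z : (forall J, continuous (u J)) ->
  measurable_fun [set: borel G] (v : borel G -> R) ->
  {ae mu, forall x : borel G, u J x @[J --> \oo] --> v x} ->
  (forall J x, `|u J x| <= cabs (S J x)) ->
  (forall J, (J0 <= J)%N -> gint mu (u J) = z) -> gint mu v = z.
Proof.
move=> cu mv uv ule uz.
have mu_ J : measurable_fun [set: borel G] ((fun x => (u J x)%:E) : borel G -> \bar R).
  by apply/measurable_EFinP; exact: cont_measurable.
have mv_ : measurable_fun [set: borel G] ((fun x => (v x)%:E) : borel G -> \bar R).
  by apply/measurable_EFinP.
have ae1 : {ae mu, forall x : borel G, [set: borel G] x -> (u J x)%:E @[J --> \oo] --> (v x)%:E}.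
  by apply: filterS uv => x Hx _; apply: cvg_EFin => //; exact: nearW.
have ae2 : {ae mu, forall (x : borel G) J, [set: borel G] x -> (`|(u J x)%:E| <= g x)%E}.
  by apply: nearW => x J _; apply: le_trans (S_le J x); rewrite lee_fin.
have [_ _ H] := dominated_convergence measurableT mu_ mv_ ae1 g_integrable ae2.
rewrite gintE /Rintegral.
have Hz : (\int[mu]_(x in [set: borel G]) (u J x)%:E)%E @[J --> \oo] --> z%:E.
  apply: cvg_near_cst; exists J0 => // J J0J.
  by rewrite -gint_EFin ?uz//; exact: (cont_rinteg mu Gc (cu J)).
by rewrite (cvg_unique _ H Hz).
Qed.

(** Fourier coefficients pass to the limit by dominated convergence. The coefficients of the partial
    sums are only required to be constant from some index on, which may depend on the character. *)
Lemma block_sum_in_Lp : exists2 F, in_Lp mu q F &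
  forall chi z J0, character chi ->
    (forall J, (J0 <= J)%N -> fourier mu (fun x => \sum_(j < J) B j x) chi = z) ->
    fourier mu F chi = z.
Proof.
exists f; first exact: f_Lp.
move=> chi z J0 cchi Hz; have cc := ccontJ (char_ccont cchi).
have [m1 m2] := cc; have [c1 _ _ _] := cchi.
have cSc J := ccontM (cS J) cc.
have le1 J x : cabs (S J x * (chi x)^*) <= cabs (S J x) by rewrite cabsM cabsJ c1 mulr1.
have mc (a : G -> R) : continuous a -> measurable_fun [set: borel G] (a : borel G -> R).
  exact: cont_measurable.
rewrite fourierE; apply: complexP => /=.
  apply: (@dominated (fun J x => RE (S J x * (chi x)^*)) _ J0).
  - by move=> J; case: (cSc J).
  - rewrite (_ : (fun x => RE (f x * (chi x)^*)) = (fun x => RE (f x) * RE (chi x)^* - IM (f x) * IM (chi x)^*)); last first.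
      by apply/funext => x; rewrite cReM.
    by apply: measurable_funB; apply: measurable_funM => //; exact: mc.
  - apply: filterS f_cvg => x [h1 h2].
    rewrite cReM (_ : (fun J => _) = (fun J => RE (S J x) * RE (chi x)^* - IM (S J x) * IM (chi x)^*)); last first.
      by apply/funext => J; rewrite cReM.
    by apply: cvgB; apply: cvgM => //; exact: cvg_cst.
  - by move=> J x; exact: le_trans (Re_le_cabs _) (le1 J x).
  - by move=> J /Hz <-; rewrite fourierE.
apply: (@dominated (fun J x => IM (S J x * (chi x)^*)) _ J0).
- by move=> J; case: (cSc J).
- rewrite (_ : (fun x => IM (f x * (chi x)^*)) = (fun x => RE (f x) * IM (chi x)^* + IM (f x) * RE (chi x)^*)); last first.
    by apply/funext => x; rewrite cImM.
  by apply: measurable_funD; apply: measurable_funM => //; exact: mc.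
- apply: filterS f_cvg => x [h1 h2].
  rewrite cImM (_ : (fun J => _) = (fun J => RE (S J x) * IM (chi x)^* + IM (S J x) * RE (chi x)^*)); last first.
    by apply/funext => J; rewrite cImM.
  by apply: cvgD; apply: cvgM => //; exact: cvg_cst.
- by move=> J x; exact: le_trans (Im_le_cabs _) (le1 J x).
- by move=> J /Hz <-; rewrite fourierE.
Qed.

End BlockSums.

(** * The upper bound *)

Section UpperBound.
Context {R : realType} {G : topologicalZmodType} (mu : probability (borel G) R).
Variables (lambda : nat -> R) (beta : R -> G) (h : nat -> G -> R[i]).
Hypothesis dg : dirichlet_group lambda mu beta h.
Hypothesis freq : frequency lambda.
Let Gc := dgroup_compact dg.
Let Gh := dgroup_haar dg.
Local Notation hpoly := (hpoly h).
Local Notation nb := (nb freq).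
Local Notation bpoly := (bpoly h freq).
Local Notation block := (block freq).
Local Notation translate := (translate lambda).

Lemma fourier_hpoly a N n : fourier mu (hpoly a N) (h n) = if (n < N)%N then a n else 0.
Proof.
have cJ : ccont (fun y => (h n y)^*) by apply: ccontJ; exact: hcont dg n.
rewrite fourierE; case: ltnP => nN; first exact: (hpoly_coef dg freq).
have E x : hpoly a N x = hpoly (fun m => if (m < N)%N then a m else 0) n.+1 x.
  rewrite [RHS](@hpoly_widen _ _ h _ N)//; last 2 first.
  - exact: ltnW.
  - by move=> m Nm; rewrite ltnNge Nm.
  by apply: eq_hpoly => m ->.
rewrite (@eq_cint _ _ mu _ (fun x => hpoly (fun m => if (m < N)%N then a m else 0) n.+1 x * (h n x)^*)).
  by rewrite (hpoly_coef dg freq)// ltnNge nN.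
by move=> x; rewrite E.
Qed.

Lemma fourier_hpoly0 a N chi : character chi -> (forall n, chi <> h n) ->
  fourier mu (hpoly a N) chi = 0.
Proof.
move=> cchi nchi; have cJ := ccontJ (char_ccont cchi).
rewrite fourierE (@eq_cint _ _ mu _ (fun x => \sum_(n < N) a n * (h n x * (chi x)^*))).
  have cM i : ccont (fun x => h i x * (chi x)^*) by apply: ccontM => //; exact: hcont dg i.
  rewrite cint_sum//; last by move=> i; apply: ccontM => //; exact: ccont_cst.
  rewrite big1// => i _; rewrite cintZ// (cint_charM Gc Gh)//; last exact: hchar dg i.
  by case: eqP => [e|_]; [case: (nchi i)|rewrite mulr0].
by move=> x; rewrite /hpoly mulr_suml; apply: eq_bigr => i _; rewrite mulrA.
Qed.

Lemma hpoly_spectral a N : spectral mu h (hpoly a N).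
Proof.
move=> chi cchi; apply: contraNP => nchi.
rewrite fourier_hpoly0// => n e; apply: nchi; by exists n.
Qed.

Lemma hpoly_in_Lp (q : \bar R) a N : (1 <= q)%E -> in_Lp mu q (hpoly a N).
Proof.
move=> q1; have cP := hpoly_cont dg a N; have [c1 c2] := cP.
split; [exact: cont_measurable|exact: cont_measurable|].
by rewrite Lnorm_nrm// ltry.
Qed.

Lemma in_Hp_of_blocks (q : \bar R) (C rho : R) c : (1 <= q)%E -> 0 <= C -> 0 < rho -> rho < 1 ->
  (forall j, nrm mu q (bpoly c j) <= C * rho ^+ j) -> in_Hp mu h q c.
Proof.
move=> q1 C0 rho0 rho1 Hc.
have [F FLp HF] := block_sum_in_Lp Gc Gh q1 (fun j => bpoly_cont dg freq c j) C0 rho0 rho1 Hc.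
have E J : (fun x => \sum_(j < J) bpoly c j x) = hpoly c (nb J).
  by apply/funext => x; rewrite hpoly_blocks.
exists F; split=> //.
  move=> chi cchi; apply: contraNP => nchi; apply/eqP.
  apply: (HF chi 0 0%N cchi) => J _; rewrite E; apply: fourier_hpoly0 => // n e.
  by apply: nchi; exists n.
move=> n; have [J0 nJ0] := nb_unbounded freq n.+1.
apply/esym/(HF (h n) (c n) J0 (hchar dg n)) => J J0J.
by rewrite E fourier_hpoly (leq_trans nJ0)// nb_le.
Qed.

Lemma bpolyZ c a j x : bpoly (fun n => c * a n) j x = c * bpoly a j x.
Proof.
rewrite /bpoly -hpolyZ; apply: eq_hpoly => n _; rewrite /block /blk.
by case: ifP => _; rewrite ?mulr0.
Qed.

Lemma nrm_hpolyZ (q : \bar R) c a N : (1 <= q)%E ->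
  nrm mu q (hpoly (fun n => c * a n) N) = cabs c * nrm mu q (hpoly a N).
Proof.
move=> q1; rewrite -nrmZ//; last exact: (hpoly_cont dg).
by apply: eq_nrm => x; rewrite hpolyZ.
Qed.

Lemma nrm_bpolyZ (q : \bar R) c a j : (1 <= q)%E ->
  nrm mu q (bpoly (fun n => c * a n) j) = cabs c * nrm mu q (bpoly a j).
Proof.
move=> q1; rewrite -nrmZ//; last exact: (bpoly_cont dg).
by apply: eq_nrm => x; rewrite bpolyZ.
Qed.

Lemma bpolyD a b j x : bpoly (fun n => a n + b n) j x = bpoly a j x + bpoly b j x.
Proof.
rewrite /bpoly -hpolyD; apply: eq_hpoly => n _; rewrite /block /blk.
by case: ifP => _; rewrite ?addr0.
Qed.

Lemma nrm_hpoly_le (q : \bar R) a N : (1 <= q)%E ->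
  nrm mu q (hpoly a N) <= \sum_(n < N) cabs (a n).
Proof.
move=> q1; apply: nrm_le => //; first exact: (hpoly_cont dg).
move=> x; apply: (le_trans (cabs_sum _ _ _)); apply: ler_sum => n _.
by rewrite cabsM (cabs_h dg) mulr1.
Qed.

Lemma translateD (s t : R) a : translate s (translate t a) = translate (s + t) a.
Proof.
apply/funext => n; rewrite /translate -mulrA -rmorphM /= -expRD; congr (_ * (expR _)%:C%C); ring.
Qed.

Lemma translate_block_le (q : \bar R) (t : R) a j : (1 <= q)%E -> 0 <= t ->
  nrm mu q (bpoly (translate t a) j) <= expR (- (j%:R * t)) * nrm mu q (bpoly a j).
Proof.
move=> q1 t0; set m := nb j.
have jm : j%:R <= lambda m by rewrite -(nbP freq).
have am n : (n < m)%N -> block a j n = 0 by move=> nm; rewrite /block /blk leqNgt nm.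
have := hpoly_contract_up dg freq (nb j.+1) q1 t0 am.
have E x : bpoly (translate t a) j x = (expR (- (lambda m * t)))%:C%C *
    hpoly (fun n => block a j n * (expR (- ((lambda n - lambda m) * t)))%:C%C) (nb j.+1) x.
  rewrite -hpolyZ; apply: eq_hpoly => n _; rewrite /block /blk; case: ifP => _; last by rewrite mul0r mulr0.
  rewrite /translate mulrCA -rmorphM /= -expRD; congr (_ * (expR _)%:C%C); ring.
rewrite (eq_nrm mu q (fun x => congr1 cabs (E x))) nrmZ//; last exact: (hpoly_cont dg).
rewrite cabs_real ger0_norm ?expR_ge0// => H.
apply: ler_pM; rewrite ?expR_ge0//; first by apply: nrm_ge0 => //; exact: (hpoly_cont dg).
by rewrite ler_expR lerN2 ler_wpM2r.
Qed.

(** The bound for polynomials is transferred by a kernel: the multiplied series is a polynomial of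
    no larger L_p-norm, and on the given block the multipliers are so close to 1 that the change has
    norm at most 1. As M >= 1, this is absorbed in the constant. *)
Lemma blocks_of_Hp (p eps : R) (q : \bar R) a : 1 <= p -> (p%:E < q)%E -> 0 < eps ->
  in_Hp mu h p%:E a ->
  exists2 K, 0 <= K & forall j M, 1 <= M ->
    (forall b, nrm mu q (bpoly b j) <= M * nrm mu p%:E (bpoly b j)) ->
    nrm mu q (bpoly a j) <= K * M `^ (1 + eps).
Proof.
move=> p1 pq eps0 [f [fLp fs fa]].
have p1e : (1 <= p%:E)%E by rewrite lee_fin.
have q1 : (1 <= q)%E by apply: le_trans (ltW pq).
have [C C0 HC] := block_bound dg freq p1 pq eps0.
set F := Lnorm mu p%:E (fun x : borel G => (cabs (f x))%:E).
have F0 : (0 <= F)%E by exact: Lnorm_ge0.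
have Ffin : F \is a fin_num by rewrite ge0_fin_numE//; case: fLp.
pose s := fine F + 1.
have s0 : 0 < s by rewrite ltr_wpDl// fine_ge0.
exists (s * C + 1); first by rewrite addr_ge0// mulr_ge0// ltW.
move=> j M M1 Mb.
(* Multipliers within 1 / (A + 1) of 1 change the block by at most A / (A + 1). The kernel thus
   depends on j, but the constant K does not. *)
pose A := \sum_(n < nb j.+1) cabs (a n).
have A0 : 0 <= A by apply: sumr_ge0 => n _; exact: cabs_ge0.
have d0 : 0 < (A + 1)^-1 by rewrite invr_gt0 ltr_wpDl.
have [kap [N [_ Hk Hf]]] := approximate_identity dg freq (nb j.+1) d0.
pose N' := maxn N (nb j.+1).
have NN : (nb j.+1 <= N')%N by rewrite leq_maxr.
have B1 : nrm mu p%:E (hpoly (fun n => (s^-1)%:C%C * (kap n * a n)) N') <= 1.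
  rewrite nrm_hpolyZ//.
  rewrite cabs_real ger0_norm ?invr_ge0 ?(ltW s0)// mulrC ler_pdivrMr// mul1r.
  rewrite -lee_fin; apply: (@le_trans _ _ F); last first.
    by rewrite -(fineK Ffin) lee_fin lerDl.
  have fE : a = (fun n => fourier mu f (h n)) by apply/funext.
  by rewrite fE; exact: (Hf p%:E f N' p1e fLp fs (leq_maxl _ _)).
have BE b (r : \bar R) : nrm mu r (hpoly (blk b (nb j) (nb j.+1)) N') = nrm mu r (bpoly b j).
  by apply: eq_nrm => x; rewrite -(bpolyE _ _ x NN).
have Mb' b : nrm mu q (hpoly (blk b (nb j) (nb j.+1)) N') <=
    M * nrm mu p%:E (hpoly (blk b (nb j) (nb j.+1)) N') by rewrite !BE.
have := HC M _ N' _ _ M1 (nb_le freq (leqnSn j)) Mb' B1.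
rewrite BE nrm_bpolyZ//.
rewrite cabs_real ger0_norm ?invr_ge0 ?(ltW s0)// mulrC ler_pdivrMr// => H1.
have E x : bpoly a j x = bpoly (fun n => kap n * a n) j x + bpoly (fun n => (1 - kap n) * a n) j x.
  by rewrite -bpolyD; apply: eq_bpoly => n _; ring.
rewrite (eq_nrm mu q (fun x => congr1 cabs (E x))).
apply: (le_trans (nrmD Gc Gh q1 (bpoly_cont dg freq _ _) (bpoly_cont dg freq _ _))).
have H2 : nrm mu q (bpoly (fun n => (1 - kap n) * a n) j) <= 1.
  apply: (le_trans (nrm_hpoly_le _ _ q1)).
  apply: (@le_trans _ _ (\sum_(n < nb j.+1) (A + 1)^-1 * cabs (a n))).
    apply: ler_sum => n _; rewrite /block /blk; case: ifP => _; last first.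
      by rewrite cabs0 mulr_ge0 ?cabs_ge0// ltW.
    by rewrite cabsM ler_wpM2r ?cabs_ge0// cabsB Hk.
  by rewrite -mulr_sumr -/A mulrC ler_pdivrMr ?mul1r ?lerDl// ltr_wpDl.
have M1' : 1 <= M `^ (1 + eps).
  have e1 : (1 : R) = 1 `^ (1 + eps) by rewrite powR1.
  rewrite [leLHS]e1; apply: ge0_ler_powR; rewrite ?nnegrE//; lra.
have -> : (s * C + 1) * M `^ (1 + eps) = C * M `^ (1 + eps) * s + M `^ (1 + eps) by ring.
by apply: lerD => //; exact: le_trans M1'.
Qed.

Lemma translate_in_Hq (p L t : R) (q : \bar R) J a : 1 <= p -> (p%:E < q)%E -> 0 <= L -> L < t ->
  (forall j, (J <= j)%N -> forall b,
     nrm mu q (bpoly b j) <= expR (j%:R * L) * nrm mu p%:E (bpoly b j)) ->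
  in_Hp mu h p%:E a -> in_Hp mu h q (translate t a).
Proof.
move=> p1 pq L0 Lt HL aHp.
have q1 : (1 <= q)%E by apply: le_trans (ltW pq); rewrite lee_fin.
(* Small enough that L (1 + eps) < t; the difference [th] is the rate of decay of the blocks. *)
pose eps := (t - L) / (2 * (L + 1)).
have L1 : 0 < 2 * (L + 1) by lra.
have eps0 : 0 < eps by rewrite divr_gt0// subr_gt0.
have Le : L * eps < t - L.
  rewrite /eps mulrA ltr_pdivrMr// mulrC ltr_pM2l ?subr_gt0//; lra.
pose th := t - L * (1 + eps).
have th0 : 0 < th by rewrite /th; lra.
have [K K0 HK] := blocks_of_Hp p1 pq eps0 aHp.
have t0 : 0 <= t by lra.
pose c := translate t a.
(* Absorbs the finitely many blocks below J, about which nothing is assumed. *)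
pose K1 := \sum_(i < J) expR (i%:R * th) * nrm mu q (bpoly c i).
have n0 i : 0 <= nrm mu q (bpoly c i) by apply: nrm_ge0 => //; exact: (bpoly_cont dg).
have K10 : 0 <= K1 by apply: sumr_ge0 => i _; rewrite mulr_ge0 ?expR_ge0.
have rE j : expR (- th) ^+ j = expR (- (j%:R * th)) by rewrite -expRM_natl mulrN.
apply: (@in_Hp_of_blocks q (K + K1) (expR (- th))) => //; rewrite ?addr_ge0 ?expR_gt0//.
  by rewrite -[ltRHS]expR0 ltr_expR oppr_lt0.
move=> j; rewrite rE; have [jJ|Jj] := ltnP j J.
  have : expR (j%:R * th) * nrm mu q (bpoly c j) <= K1.
    rewrite /K1 (bigD1 (Ordinal jJ))//= lerDl sumr_ge0// => i _.
    by rewrite mulr_ge0 ?expR_ge0.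
  move=> H; rewrite expRN ler_pdivlMr ?expR_gt0// mulrC; apply: le_trans H _.
  by rewrite lerDr.
apply: (le_trans (translate_block_le _ _ q1 t0)).
have M1 : 1 <= expR (j%:R * L) by rewrite -[leLHS]expR0 ler_expR mulr_ge0.
have := HK j _ M1 (HL j Jj) => H.
apply: (@le_trans _ _ (expR (- (j%:R * t)) * (K * expR (j%:R * L) `^ (1 + eps)))).
  by rewrite ler_wpM2l ?expR_ge0.
have -> : expR (j%:R * L) `^ (1 + eps) = expR (j%:R * L * (1 + eps)).
  by rewrite /powR gt_eqF ?expR_gt0// expRK mulrC.
rewrite mulrCA -expRD (_ : - (j%:R * t) + j%:R * L * (1 + eps) = - (j%:R * th)); last first.
  by rewrite /th; ring.
by rewrite ler_wpM2r ?expR_ge0// lerDl.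
Qed.

End UpperBound.

(** * The lower bound *)

Section LowerBound.
Context {R : realType} {G : topologicalZmodType} (mu : probability (borel G) R).
Variables (lambda : nat -> R) (beta : R -> G) (h : nat -> G -> R[i]).
Hypothesis dg : dirichlet_group lambda mu beta h.
Hypothesis freq : frequency lambda.
Let Gc := dgroup_compact dg.
Let Gh := dgroup_haar dg.
Local Notation hpoly := (hpoly h).
Local Notation nb := (nb freq).
Local Notation bpoly := (bpoly h freq).
Local Notation block := (block freq).
Local Notation translate := (translate lambda).

Lemma same_block i j n : (nb i <= n < nb i.+1)%N -> (nb j <= n < nb j.+1)%N -> i = j.
Proof.
rewrite !nbP !nb_ltP => /andP[i1 i2] /andP[j1 j2]; apply/eqP; rewrite eqn_leq -[(i <= j)%N]ltnS -[(j <= i)%N]ltnS.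
by rewrite -[(i < _)%N](ltr_nat R) -[(j < _)%N](ltr_nat R) (le_lt_trans i1 j2) (le_lt_trans j1 i2).
Qed.

Lemma bpoly_eq0 a j x : (forall n, (nb j <= n < nb j.+1)%N -> a n = 0) -> bpoly a j x = 0.
Proof.
move=> a0; rewrite /bpoly /hpoly big1// => n _; rewrite /block /blk.
by case: ifP => [/a0 ->|_]; rewrite mul0r.
Qed.

(** Undoing a translation by t > 0 costs at most the exponential of t times the top frequency of the
    block, which is below j + 1. For t <= 0 undoing it is itself a contraction; the maximum with 0
    covers both cases. *)
Lemma translate_block_ge (q : \bar R) (t : R) a j : (1 <= q)%E ->
  nrm mu q (bpoly a j) <=
  expR (j.+1%:R * Num.max t 0) * nrm mu q (bpoly (translate t a) j).
Proof.
move=> q1; have n0 b : 0 <= nrm mu q (bpoly b j) by apply: nrm_ge0 => //; exact: (bpoly_cont dg).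
have [t0|t0] := leP t 0.
  have aE : a = translate (- t) (translate t a).
    rewrite translateD addNr; apply/funext => n.
    by rewrite /translate mulr0 oppr0 expR0 mulr1.
  have nt : 0 <= - t by rewrite oppr_ge0.
  rewrite mulr0 expR0 mul1r [in leLHS]aE.
  apply: (le_trans (translate_block_le dg freq _ _ q1 nt)).
  by rewrite ler_piMl// -expR0 ler_expR oppr_le0 mulr_ge0.
(* If there are no frequencies below j + 1, the block has no last index; both of its polynomials are
   0. *)
have [e|] := posnP (nb j.+1).
  rewrite (@eq_nrm _ _ mu q _ (hpoly (fun=> 0) 0)) => [|x].
    apply: (le_trans (nrm_hpoly_le dg _ _ q1)).
    by rewrite big_ord0 mulr_ge0 ?expR_ge0.
  by rewrite bpoly_eq0 ?/hpoly ?big_ord0// => n; rewrite e ltn0 andbF.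
case E : (nb j.+1) => [//|m] _.
have mj : lambda m < j.+1%:R by rewrite -(nb_ltP freq) E.
have am n : (m < n)%N -> block (translate t a) j n = 0.
  by move=> mn; rewrite /block /blk E [(_ < m.+1)%N]ltnNge mn andbF.
have := hpoly_contract_down dg freq (nb j.+1) q1 (ltW t0) am.
have HE x : bpoly a j x = (expR (lambda m * t))%:C%C *
    hpoly (fun n => block (translate t a) j n * (expR (- ((lambda m - lambda n) * t)))%:C%C) (nb j.+1) x.
  rewrite -hpolyZ; apply: eq_hpoly => n _; rewrite /block /blk; case: ifP => _; last by rewrite mul0r mulr0.
  rewrite /translate mulrCA -!mulrA -!rmorphM /= -!expRD.
  rewrite (_ : _ + _ = 0) ?expR0 ?mulr1//; ring.
rewrite (eq_nrm mu q (fun x => congr1 cabs (HE x))) nrmZ//; last exact: (hpoly_cont dg).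
rewrite cabs_real ger0_norm ?expR_ge0// => H.
apply: ler_pM; rewrite ?expR_ge0//; first by apply: nrm_ge0 => //; exact: (hpoly_cont dg).
by rewrite ler_expR ler_wpM2r// ltW.
Qed.

(** Each coefficient of the block is at most its L_1-norm and so at most its L_q-norm v. The change
    caused by the multipliers is then at most v / 2 and is absorbed; the closeness required does not
    depend on u. *)
Lemma kernel_block (q : \bar R) j kap u : (1 <= q)%E ->
  (forall n, (n < nb j.+1)%N -> cabs (kap n - 1) <= (2 * (nb j.+1).+1%:R)^-1) ->
  nrm mu q (bpoly u j) <= 2 * nrm mu q (bpoly (fun n => kap n * u n) j).
Proof.
move=> q1 Hk; set v := nrm mu q (bpoly u j).
have v0 : 0 <= v by apply: nrm_ge0 => //; exact: (bpoly_cont dg).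
have cu : ccont (bpoly u j) by exact: (bpoly_cont dg).
have coef n : (n < nb j.+1)%N -> cabs (block u j n) <= v.
  move=> nj; rewrite -(hpoly_coef dg freq (block u j) nj).
  have cJ : ccont (fun y => (h n y)^*) by apply: ccontJ; exact: hcont dg n.
  apply: (le_trans (cabs_cint mu Gc (ccontM cu cJ))).
  apply: le_trans (nrm1_le mu Gc q1 cu); rewrite nrm1E// le_eqVlt; apply/orP; left.
  by apply/eqP/eq_gint => y; rewrite cabsM cabsJ (cabs_h dg) mulr1.
have E x : bpoly u j x = bpoly (fun n => kap n * u n) j x + bpoly (fun n => (1 - kap n) * u n) j x.
  by rewrite -bpolyD; apply: eq_bpoly => n _; ring.
have H2 : nrm mu q (bpoly (fun n => (1 - kap n) * u n) j) <= v / 2.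
  apply: (le_trans (nrm_hpoly_le dg _ _ q1)).
  apply: (@le_trans _ _ (\sum_(n < nb j.+1) (2 * (nb j.+1).+1%:R)^-1 * v)).
    apply: ler_sum => n _.
    have -> : block (fun n => (1 - kap n) * u n) j n = (1 - kap n) * block u j n.
      by rewrite /block /blk; case: ifP => _; rewrite ?mulr0.
    rewrite cabsM cabsB; apply: ler_pM; rewrite ?cabs_ge0//; [exact: Hk|exact: coef].
  rewrite sumr_const card_ord -[leLHS]mulr_natl mulrA -[leRHS]mulrC ler_wpM2r//.
  by rewrite invfM mulrCA ler_piMr ?invr_ge0// ler_pdivrMr ?mul1r ?ler_nat// ltr0n.
have : v <= nrm mu q (bpoly (fun n => kap n * u n) j) + v / 2.
  rewrite {1}/v (eq_nrm mu q (fun x => congr1 cabs (E x))).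
  apply: (le_trans (nrmD Gc Gh q1 (bpoly_cont dg freq _ _) (bpoly_cont dg freq _ _))).
  by rewrite lerD2l.
by lra.
Qed.

(* The growth [r <= 3^m] of the partial sums cannot keep up with [exp(delta m^2)]. *)
Lemma quadratic_exponential_unbounded (delta K : R) : 0 < delta ->
  (forall m : nat, expR (delta * (m ^ 2)%:R) <= K * 3 ^+ m) -> False.
Proof.
move=> d0 H.
(* Then delta m > 5, so exp (delta m) >= 6, and the hypothesis would give 6^m <= K 3^m, that is 2^m
   <= K < m. *)
pose m := ((Num.truncn (5 / delta)).+1 + (Num.truncn K).+1)%N.
have m1 : 5 / delta < m%:R.
  by apply: (lt_le_trans (truncnS_gt _)); rewrite ler_nat leq_addr.
have m2 : K < m%:R.
  by apply: (lt_le_trans (truncnS_gt _)); rewrite ler_nat leq_addl.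
rewrite ltr_pdivrMr// in m1.
have e6 : 6 <= expR (delta * m%:R).
  apply: (@le_trans _ _ (1 + delta * m%:R)); last exact: expR_ge1Dx.
  by rewrite mulrC; lra.
have := H m; rewrite natrX expr2 mulrA mulrC expRM_natl => Hm.
have : 6 ^+ m <= K * 3 ^+ m by apply: le_trans Hm; rewrite lerXn2r ?nnegrE ?expR_ge0.
have -> : 6 ^+ m = 2 ^+ m * 3 ^+ m :> R by rewrite -exprMn; congr (_ ^+ _); ring.
rewrite ler_pM2r ?exprn_gt0// => HK.
have : m%:R < 2 ^+ m :> R by rewrite -natrX ltr_nat ltn_expl.
by lra.
Qed.

Definition bad (p q : \bar R) (L : R) j b :=
  nrm mu q (bpoly b j) = expR (j%:R * L) /\ nrm mu p (bpoly b j) <= 1.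

Lemma bad_exists (p q : \bar R) L j b : (1 <= p)%E -> (1 <= q)%E ->
  expR (j%:R * L) * nrm mu p (bpoly b j) < nrm mu q (bpoly b j) -> exists b', bad p q L j b'.
Proof.
move=> p1 q1; set e := expR _; set x := nrm mu p _; set y := nrm mu q _ => H.
have e0 : 0 < e by exact: expR_gt0.
have x0 : 0 <= x by apply: nrm_ge0 => //; exact: (bpoly_cont dg).
have y0 : 0 < y by apply: le_lt_trans H; rewrite mulr_ge0// ltW.
exists (fun n => (e / y)%:C%C * b n); split; rewrite (nrm_bpolyZ dg)// cabs_real ger0_norm ?divr_ge0 ?(ltW e0) ?(ltW y0)//.
  by rewrite -/y divfK// gt_eqF.
by rewrite -/x mulrAC ler_pdivrMr// mul1r ltW.
Qed.

(** The blocks of the constructed series have L_p-norm at most 1, so every translate by e > 0 is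
    summable. On the other side, membership of a translate in H_q bounds each selected block by the
    part of the series before it, and such growth is only geometric in the number of selected
    blocks. *)
Lemma gliding_hump (p q : \bar R) (L : R) : (1 <= p)%E -> (1 <= q)%E -> 0 < L ->
  (forall J, exists j, (J <= j)%N /\ exists b, bad p q L j b) ->
  exists a, (abscissa lambda mu h p a <= 0)%E /\ (L%:E <= abscissa lambda mu h q a)%E.
Proof.
move=> p1 q1 L0 Hbad.
have [nxt Hnxt] := choice Hbad.
have Hbb j : exists b, (exists b', bad p q L j b') -> bad p q L j b.
  by have [[b Hb]|nb_] := pselect (exists b', bad p q L j b'); [exists b|exists (fun=> 0)].
have [bb bbP] := choice Hbb.
have Hkap j : exists kN : (nat -> R[i]) * nat,
    [/\ forall n, (kN.2 <= n)%N -> kN.1 n = 0,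
      forall n, (n < nb j.+1)%N -> cabs (kN.1 n - 1) <= (2 * (nb j.+1).+1%:R)^-1 &
      forall q f M, (1 <= q)%E -> in_Lp mu q f -> spectral mu h f -> (kN.2 <= M)%N ->
      ((nrm mu q (hpoly (fun n => kN.1 n * fourier mu f (h n)) M))%:E <=
       Lnorm mu q (fun x : borel G => (cabs (f x))%:E))%E].
  have d0 : 0 < (2 * (nb j.+1).+1%:R : R)^-1 by rewrite invr_gt0 mulr_gt0// ltr0n.
  by have [kap [N HN]] := approximate_identity dg freq (nb j.+1) d0; exists (kap, N).
have [kN kNP] := choice Hkap.
have HPh j : exists J, ((kN j).2 <= nb J)%N by exact: nb_unbounded.
have [Ph PhP] := choice HPh.
(* The next index passes three thresholds: the end of the kernel that belongs to the block s m', the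
   index s m' itself, and the square of the new rank, which makes the prescribed norms exp (L s m)
   grow faster than any geometric sequence. *)
pose s := fix s m := if m is m'.+1 then nxt (Ph (s m') + (s m').+1 + m'.+1 ^ 2)%N else nxt 0%N.
have sS m : s m.+1 = nxt (Ph (s m) + (s m).+1 + m.+1 ^ 2)%N by [].
have sge m : (Ph (s m) + (s m).+1 + m.+1 ^ 2 <= s m.+1)%N by rewrite sS; case: (Hnxt (Ph (s m) + (s m).+1 + m.+1 ^ 2)%N).
have slt m : (s m < s m.+1)%N.
  by apply: leq_trans (sge m); rewrite -addnA addnCA leq_addr.
have ssq m : (m ^ 2 <= s m)%N.
  by case: m => [//|m]; apply: leq_trans (sge m); rewrite leq_addl.
have sN m : ((kN (s m)).2 <= nb (s m.+1))%N.
  apply: (leq_trans (PhP (s m))); apply: nb_le; apply: leq_trans (sge m).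
  by rewrite -addnA leq_addr.
have sbad m : bad p q L (s m) (bb (s m)).
  by apply: bbP; case: m => [|m]; [case: (Hnxt 0%N)|rewrite sS; case: (Hnxt (Ph (s m) + (s m).+1 + m.+1 ^ 2)%N)].
have smono m k : (m <= k)%N -> (s m <= s k)%N.
  by move=> mk; have := @homo_leq _ s leq leqnn leq_trans (fun i => ltnW (slt i)); apply.
pose c n : R[i] := if pselect (exists m, (nb (s m) <= n < nb (s m).+1)%N) is left e
  then bb (s (projT1 (cid e))) n else 0.
have c_in m n : (nb (s m) <= n < nb (s m).+1)%N -> c n = bb (s m) n.
  rewrite /c => Hn; case: pselect => [e|[]]; last by exists m.
  by case: (cid e) => m' Hm' /=; rewrite (same_block Hm' Hn).
have c_out n : ~ (exists m, (nb (s m) <= n < nb (s m).+1)%N) -> c n = 0.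
  by rewrite /c; case: pselect.
have c_gap m n : (nb (s m).+1 <= n)%N -> (n < nb (s m.+1))%N -> c n = 0.
  move=> n1 n2; apply: c_out => -[k /andP[k1 k2]].
  have [km|mk] := leqP k m.
    by move: k2; rewrite ltnNge (leq_trans _ n1)// nb_le// ltnS smono.
  by move: n2; rewrite ltnNge (leq_trans _ k1)// nb_le// smono.
exists c; split.
  have nc j : nrm mu p (bpoly c j) <= 1.
    have [[m sm]|nm] := pselect (exists m, s m = j).
      rewrite -sm (@eq_nrm _ _ mu p _ (bpoly (bb (s m)) (s m))); first by case: (sbad m).
      by move=> x; congr cabs; apply: eq_bpoly => n; exact: c_in.
    apply: nrm_le => //; first exact: (bpoly_cont dg).
    move=> x; rewrite bpoly_eq0 ?cabs0// => n Hn; apply: c_out => -[m Hm].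
    by apply: nm; exists m; exact: same_block Hm Hn.
  apply/lee_addgt0Pr => e e0; rewrite add0e; apply: ereal_inf_lbound; exists e => //=.
  apply: (@in_Hp_of_blocks _ _ _ _ _ _ dg freq p 1 (expR (- e))) => //; rewrite ?expR_gt0//.
    by rewrite -[ltRHS]expR0 ltr_expR oppr_lt0.
  move=> j; apply: (le_trans (translate_block_le dg freq _ _ p1 (ltW e0))).
  by rewrite mul1r -expRM_natl mulrN ler_piMr ?expR_ge0.
apply: le_ereal_inf_tmp => _ [t [f [fLp fs fa]] <-]; rewrite lee_fin leNgt; apply/negP => tL.
pose a := translate t c.
have a0 n : c n = 0 -> a n = 0 by move=> cn; rewrite /a /translate cn mul0r.
set F := Lnorm mu q (fun x : borel G => (cabs (f x))%:E).
have F0 : (0 <= F)%E by exact: Lnorm_ge0.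
have Ffin : F \is a fin_num by rewrite ge0_fin_numE//; case: fLp.
pose F' := fine F.
have F'0 : 0 <= F' by exact: fine_ge0.
pose V m := nrm mu q (hpoly a (nb (s m))).
pose v m := nrm mu q (bpoly a (s m)).
have V0 m : 0 <= V m by apply: nrm_ge0 => //; exact: (hpoly_cont dg).
(* The kernel of block s m vanishes on all later selected blocks, and between selected blocks the
   coefficients are 0. Hence the smoothed block is the smoothed series minus the smoothed head, of
   norms at most F' and V m; the factor 2 is that of [kernel_block]. *)
have H1 m : v m <= 2 * F' + 2 * V m.
  have [k0 kle kc] := kNP (s m); set kap := (kN (s m)).1 in k0 kle kc.
  set N := (kN (s m)).2 in k0 kc.
  have Hv := kernel_block a q1 kle; apply: (le_trans Hv); rewrite -mulrDr ler_wpM2l//.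
  pose M := maxn N (nb (s m).+1).
  have NM : (N <= M)%N by rewrite leq_maxl.
  have jM : (nb (s m).+1 <= M)%N by rewrite leq_maxr.
  have E x : bpoly (fun n => kap n * a n) (s m) x = hpoly (fun n => kap n * a n) M x -
      hpoly (fun n => kap n * (if (n < nb (s m))%N then a n else 0)) M x.
    rewrite -(bpolyE _ _ x jM) -hpolyB; apply: eq_hpoly => n _; rewrite /block /blk.
    have [n1|n1] := leqP (nb (s m)) n; last by rewrite subrr.
    rewrite mulr0 subr0 /=; have [//|n2] := ltnP n (nb (s m).+1).
    have [Nn|nN] := leqP N n; first by rewrite k0// mul0r.
    by rewrite a0 ?mulr0// (c_gap m)// (leq_trans nN (sN m)).
  rewrite (eq_nrm mu q (fun x => congr1 cabs (E x))).
  apply: (le_trans (nrmB Gc Gh q1 (hpoly_cont dg _ _) (hpoly_cont dg _ _))).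
  apply: lerD.
    have aE : a = (fun n => fourier mu f (h n)) by apply/funext.
    by rewrite aE -lee_fin (fineK Ffin); exact: (kc q f M).
  have sp : spectral mu h (hpoly a (nb (s m))) by exact: (hpoly_spectral dg).
  have := kc q (hpoly a (nb (s m))) M q1 (hpoly_in_Lp dg a _ q1) sp NM.
  rewrite Lnorm_nrm//; last exact: (hpoly_cont dg).
  rewrite lee_fin (_ : (fun n => kap n * fourier mu _ _) =
    (fun n => kap n * (if (n < nb (s m))%N then a n else 0)))//.
  by apply/funext => n; rewrite (fourier_hpoly dg freq).
have H2 m : V m.+1 <= V m + v m.
  pose K := nb (s m.+1).
  have jK : (nb (s m).+1 <= K)%N by exact: nb_le.
  have E x : hpoly a K x = hpoly a (nb (s m)) x + bpoly a (s m) x.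
    have -> : hpoly a (nb (s m)) x = hpoly (fun n => if (n < nb (s m))%N then a n else 0) K x.
      rewrite (@hpoly_widen _ _ h _ (nb (s m)))//.
      - by apply: eq_hpoly => n ->.
      - by apply: nb_le; exact: ltnW.
      - by move=> n Hn; rewrite ltnNge Hn.
    rewrite -(bpolyE _ _ x jK) -hpolyD; apply: eq_hpoly => n nK; rewrite /block /blk.
    have [n1|n1] := leqP (nb (s m)) n; last by rewrite addr0.
    rewrite add0r /=; have [//|n2] := ltnP n (nb (s m).+1).
    by rewrite a0// (c_gap m).
  rewrite /V (eq_nrm mu q (fun x => congr1 cabs (E x))).
  exact: (nrmD Gc Gh q1 (hpoly_cont dg _ _) (bpoly_cont dg freq _ _)).
(* Combining [H2] with [H1] gives V (m + 1) <= 3 V m + 2 F', which is a factor 3 for V + F'. *)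
have H3 m : V m + F' <= (V 0%N + F') * 3 ^+ m.
  elim: m => [|m IH]; first by rewrite mulr1.
  rewrite exprS mulrCA; have := H1 m; have := H2 m; lra.
have vle m : v m <= 2 * (V 0%N + F') * 3 ^+ m.
  by have := H1 m; have := H3 m; rewrite -mulrA; lra.
pose t' := Num.max t 0.
have t'L : 0 < L - t' by rewrite subr_gt0 gt_max tL.
have t'0 : 0 <= t' by rewrite le_max lexx orbT.
apply: (@quadratic_exponential_unbounded (L - t') (expR t' * (2 * (V 0%N + F'))) t'L) => m.
have [ebad _] := sbad m.
have := translate_block_ge t c (s m) q1.
rewrite (@eq_nrm _ _ mu q (bpoly c (s m)) (bpoly (bb (s m)) (s m))) ?ebad; last first.
  by move=> x; congr cabs; apply: eq_bpoly => n; exact: c_in.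
rewrite -/a -/(v m) -/t' => Hge.
have Hge2 : expR ((s m)%:R * (L - t')) <= expR t' * v m.
  rewrite mulrBr expRD expRN ler_pdivrMr ?expR_gt0//; apply: (le_trans Hge).
  by rewrite mulrAC -expRD ler_wpM2r ?nrm_ge0//; [exact: (bpoly_cont dg)|rewrite -natr1 mulrDl mul1r addrC].
apply: (@le_trans _ _ (expR ((s m)%:R * (L - t')))).
  by rewrite ler_expR mulrC ler_wpM2r ?ler_nat ?(ltW t'L).
apply: (le_trans Hge2); rewrite -mulrA ler_wpM2l ?expR_ge0//.
Qed.

End LowerBound.

(** * Gaps of abscissas, exponential rates and the conclusion *)

Section GapAndRate.
Context {R : realType}.
Implicit Types (x y : \bar R) (L : R) (j : nat).

(** If y is -oo, the hypothesis forces x = y and the gap is 0; if y is +oo, the gap is 0 or -oo.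
    Nonnegativity of L is needed for the value 0. *)
Lemma gap_le x y L : 0 <= L -> (x <= y + L%:E)%E -> (gap x y <= L%:E)%E.
Proof.
move=> L0 xy; rewrite /gap; case: eqP => [_|nxy]; first by rewrite lee_fin.
case: y xy nxy => [y| |] xy nxy.
- by rewrite leeBlDr// addeC.
- by case: x nxy {xy} => [x| |] nxy; rewrite /= ?leNye//; case: nxy.
- by move: xy; rewrite addNye leeNy_eq => /eqP.
Qed.

Lemma gap_ge x y L : 0 < L -> (y <= 0)%E -> (L%:E <= x)%E -> (L%:E <= gap x y)%E.
Proof.
move=> L0 y0 Lx; rewrite /gap; case: eqP => [e|_].
  by move: (le_trans Lx (le_trans (eq_ind _ (fun z => x <= z)%E (lexx x) _ e) y0)); rewrite lee_fin leNgt L0.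
case: y y0 => [y| |] y0.
- by rewrite leeBrDr//; apply: le_trans Lx; rewrite -EFinD lee_fin; rewrite lee_fin in y0; lra.
- by [].
- by case: x Lx => [x| |] //= _; rewrite leey.
Qed.

(** At j = 0 the quotient is a mere convention, which does not affect the upper limit; hence the
    condition 0 < j below. *)
Definition rate x j : \bar R := (lne x / j%:R%:E)%E.

Lemma rateE (r : R) j : 0 < r -> (0 < j)%N -> rate r%:E j = (ln r / j%:R)%:E.
Proof.
move=> r0 j0; rewrite /rate /lne leNgt r0 inver ifF//.
by apply/negbTE; rewrite pnatr_eq0 -lt0n.
Qed.

Lemma rate_y j : (0 < j)%N -> rate +oo j = +oo%E.
Proof.
move=> j0; rewrite /rate /= inver ifF; last by apply/negbTE; rewrite pnatr_eq0 -lt0n.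
by rewrite gt0_mulye// lte_fin invr_gt0 ltr0n.
Qed.

Lemma rate_ge0 x j : (1 <= x)%E -> (0 < j)%N -> (0 <= rate x j)%E.
Proof.
case: x => [r| |//] r1 j0; last by rewrite rate_y.
rewrite lee_fin in r1; rewrite rateE//; last lra.
by rewrite lee_fin divr_ge0// ln_ge0.
Qed.

Lemma rate_lt x j L : (1 <= x)%E -> (0 < j)%N -> (rate x j < L%:E)%E ->
  (x < (expR (j%:R * L))%:E)%E.
Proof.
case: x => [r| |//] r1 j0; last by rewrite rate_y.
rewrite lee_fin in r1; have r0 : 0 < r by lra.
rewrite rateE// !lte_fin ltr_pdivrMr ?ltr0n// => H.
by rewrite -[r]lnK ?posrE// ltr_expR mulrC.
Qed.

Lemma rate_gt x j L : (1 <= x)%E -> (0 < j)%N -> (L%:E < rate x j)%E ->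
  ((expR (j%:R * L))%:E < x)%E.
Proof.
case: x => [r| |//] r1 j0; last by rewrite ltry.
rewrite lee_fin in r1; have r0 : 0 < r by lra.
rewrite rateE// !lte_fin ltr_pdivlMr ?ltr0n// => H.
by rewrite -[r]lnK ?posrE// ltr_expR mulrC.
Qed.

Lemma limn_esupE (u : nat -> \bar R) : limn_esup u = ereal_inf (range (esups u)).
Proof. by rewrite limn_esup_lim; apply/cvg_lim => //; exact: cvg_esups_inf. Qed.

Lemma limn_esup_lt (u : nat -> \bar R) y : (limn_esup u < y)%E ->
  exists J, forall j, (J <= j)%N -> (u j < y)%E.
Proof.
rewrite limn_esupE => /ereal_inf_lt [_ [J _ <-] Hy]; exists J => j Jj.
by apply: le_lt_trans Hy; apply: ereal_sup_ubound; exists j.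
Qed.

Lemma limn_esup_gt (u : nat -> \bar R) y : (y < limn_esup u)%E ->
  forall J, exists j, (J <= j)%N /\ (y < u j)%E.
Proof.
rewrite limn_esupE => Hy J.
have : (y < esups u J)%E by apply: lt_le_trans Hy _; apply: ereal_inf_lbound; exists J.
by move=> /ereal_sup_gt [_ [j Jj <-] yj]; exists j.
Qed.

Lemma limn_esup_ge0 (u : nat -> \bar R) : (forall j, (0 < j)%N -> (0 <= u j)%E) ->
  (0 <= limn_esup u)%E.
Proof.
move=> u0; rewrite leNgt; apply/negP => /limn_esup_lt [J HJ].
by have := HJ J.+1 (leqnSn J); rewrite ltNge u0.
Qed.

End GapAndRate.

Section Main.
Context {R : realType} {G : topologicalZmodType} (mu : probability (borel G) R).
Variables (lambda : nat -> R) (beta : R -> G) (h : nat -> G -> R[i]).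
Hypothesis dg : dirichlet_group lambda mu beta h.
Hypothesis freq : frequency lambda.
Variables p q : \bar R.
Hypotheses (p1 : (1 <= p)%E) (q1 : (1 <= q)%E).
Local Notation Lam j := (Lambda q p (range lambda `&` `[j%:R, j.+1%:R[)).
Local Notation T_ := (T_ lambda mu h q p).

(** The zero series is a competitor in the supremum: all its translates lie in every H_r, so its two
    abscissas coincide and their gap is 0. *)
Lemma T_ge0 : (0 <= T_)%E.
Proof.
apply: le_ereal_sup_tmp; exists (gap (abscissa lambda mu h q (fun=> 0)) (abscissa lambda mu h p (fun=> 0))).
  by exists (fun=> 0).
have Hp r : (1 <= r)%E -> [set t : R | in_Hp mu h r (translate lambda t (fun=> 0))] = setT.
  move=> r1; apply/seteqP; split => // t _ /=.
  have h0 : (0 : R) < 2^-1 by rewrite invr_gt0.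
  have h1 : 2^-1 < (1 : R) by rewrite invf_lt1// ltr1n.
  apply: (in_Hp_of_blocks dg (freq := freq) r1 (lexx 0) h0 h1) => j.
  rewrite mul0r; apply: nrm_le => //; [exact: dgroup_compact dg|exact: (bpoly_cont dg)|].
  by move=> x; rewrite bpoly_eq0 ?cabs0// => n _; rewrite /translate mul0r.
by rewrite /abscissa !Hp// /gap eqxx.
Qed.

(** If the translate by t lies in H_p, the one by t + L + e lies in H_q for every e > 0; this margin
    e absorbs the loss 1 + eps in the block estimates. *)
Lemma T_le (L : R) J : (p < q)%E -> 0 <= L -> (0 < J)%N ->
  (forall j, (J <= j)%N -> (rate (Lam j) j < L%:E)%E) -> (T_ <= L%:E)%E.
Proof.
move=> pq L0 J0 HJ; apply: ge_ereal_sup => _ [a _ <-]; apply: gap_le => //.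
have [p' pE] : exists p', p = p'%:E.
  by case: (p) p1 pq => [r _ _|_|//]; [exists r|case: (q)].
have p'1 : 1 <= p' by rewrite -lee_fin -pE.
have p'q : (p'%:E < q)%E by rewrite -pE.
have HL j : (J <= j)%N -> forall b,
    nrm mu q (bpoly h freq b j) <= expR (j%:R * L) * nrm mu p'%:E (bpoly h freq b j).
  move=> Jj; rewrite -pE.
  have H := rate_lt (Lambda_ge1 _ _ _ _) (leq_trans J0 Jj) (HJ j Jj).
  by case: (Lambda_lt dg freq p1 q1 H).
rewrite -leeBlDr//; apply: le_ereal_inf_tmp => _ [t Ht <-]; rewrite leeBlDr//.
apply/lee_addgt0Pr => e e0; apply: ereal_inf_lbound; exists (t + L + e) => //=.
have Le : L < L + e by rewrite ltrDl.
rewrite pE in Ht; have := translate_in_Hq dg p'1 p'q L0 Le HL Ht.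
by rewrite translateD [L + e + t]addrC addrA.
Qed.

Lemma T_ge (L : R) : 0 < L -> (L%:E < limn_esup (fun j => rate (Lam j) j))%E -> (L%:E <= T_)%E.
Proof.
move=> L0 HL.
have Hb J : exists j, (J <= j)%N /\ exists b, bad mu h freq p q L j b.
  have [j [Jj Hj]] := limn_esup_gt HL J.+1; have j0 : (0 < j)%N by apply: leq_trans Jj.
  exists j; split; first exact: ltnW.
  have H := rate_gt (Lambda_ge1 _ _ _ _) j0 Hj.
  have e1 : 1 <= expR (j%:R * L) by rewrite -[leLHS]expR0 ler_expR mulr_ge0// ltW.
  have [b Hb] := Lambda_gt dg freq p1 q1 e1 H.
  exact: (bad_exists dg p1 q1 Hb).
have [a [a1 a2]] := gliding_hump dg p1 q1 L0 Hb.
apply: le_ereal_sup_tmp; exists (gap (abscissa lambda mu h q a) (abscissa lambda mu h p a)).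
  by exists a.
exact: gap_ge.
Qed.

End Main.

Theorem lemma1p11 (R : realType) (p q : \bar R) (lambda : nat -> R)
    (G : topologicalZmodType) (mu : probability (borel G) R)
    (beta : R -> G) (h : nat -> G -> R[i]) :
  (1 <= p)%E -> (p <= q)%E -> frequency lambda ->
  dirichlet_group lambda mu beta h ->
  T_ lambda mu h q p =
  limn_esup (fun j : nat =>
    (lne (Lambda q p (range lambda `&` `[j%:R, j.+1%:R[)) / j%:R%:E)%E).
Proof.
move=> p1 pq freq dg; have q1 := le_trans p1 pq.
set u := fun j : nat => _.
have uE j : u j = rate (Lambda q p (range lambda `&` `[j%:R, j.+1%:R[)) j by [].
have T0 := T_ge0 dg freq p1 q1.
have L0 : (0 <= limn_esup u)%E.
  by apply: limn_esup_ge0 => j j0; rewrite uE; apply: rate_ge0 => //; exact: Lambda_ge1.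
apply/eqP; rewrite eq_le; apply/andP; split.
  have [pq'|{}pq] := predU1P (eq_ind _ is_true pq _ (le_eqVlt p q)).
    apply: le_trans L0; apply: ge_ereal_sup => _ [a _ <-].
    by rewrite pq' /gap eqxx.
  case E : (limn_esup u) L0 => [l| |] //; last by move=> _; rewrite leey.
  rewrite lee_fin => l0; apply/lee_addgt0Pr => e e0.
  have : (limn_esup u < (l + e)%:E)%E by rewrite E lte_fin ltrDl.
  move=> /limn_esup_lt [J HJ].
  apply: (T_le dg freq p1 q1 (J := J.+1)) => //; first by rewrite addr_ge0// ltW.
  by move=> j Jj; rewrite -uE; apply: HJ; exact: ltnW.
rewrite leNgt; apply/negP => TL.
(* A real number strictly between the two sides contradicts [T_ge]; it is positive because the left
   side is nonnegative. *)
have [L [L1 TL1 L2]] : exists L : R, [/\ 0 < L, (T_ lambda mu h q p < L%:E)%E & (L%:E < limn_esup u)%E].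
  case ET : (T_ lambda mu h q p) T0 TL => [t| |] //; last by move=> _; rewrite ltNge leey.
  rewrite lee_fin => t0; case: (limn_esup u) => [l| |] //.
    rewrite lte_fin => tl; exists ((t + l) / 2); rewrite !lte_fin; split; lra.
  by move=> _; exists (t + 1); rewrite lte_fin ltry; split => //; lra.
by have := T_ge dg freq p1 q1 L1 L2; rewrite leNgt TL1.
Qed.
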